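(* Consider the Poincaré map $P$ on the section $\{f=0\}$ of the satellite rotation system (defined in the context) with $e=0.1$, $\omega^2=0.79$. Let $P_1\in\{\frac{\pi}{2}\}\times[1.098956671156713,\,1.098956671156731]$ and $P_2\in\{\frac{\pi}{2}\}\times[1.294511656257196,\,1.294511656257254]$ be points and let $M_1,M_2$ be $2\times2$ real matrices whose entries lie in the following intervals: $$M_1\in\begin{bmatrix}[0.7069564693959338,\,0.7069564693977127] & [0.7069564693959345,\,0.7069564693977133]\\ [0.7072570610281695,\,0.7072570610335063] & [-0.7072570610335054,\,-0.7072570610281689]\end{bmatrix},$$ $$M_2\in\begin{bmatrix}[0.7344289378330728,\,0.7344289378407212] & [0.7344289378330732,\,0.7344289378407215]\\ [0.6786855938153962,\,0.6786855938378076] & [-0.6786855938378071,\,-0.6786855938153957]\end{bmatrix}.$$ Let $N_0,N_1$ be the h-sets of the form $p+A\cdot b\cdot 10^{-3}$ with - $N_0$: $p=P_1$, $A=M_1$, $b=[-0.8,0.8]\times[-180,80]$; - $N_1$: $p=P_2$, $A=M_2$, $b=[-10,5]\times[-75,200]$. Then the following covering relations hold: $$N_0\overset{P}{\Longrightarrow}N_0\overset{P}{\Longrightarrow}N_1\overset{P}{\Longrightarrow}N_1\overset{P}{\Longrightarrow}N_0,$$ and consequently there is symbolic dynamics for $P$.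
   Context: **The system.** For parameters $e$, $\omega^2$ consider the ODE $$\theta'=\phi,\qquad \phi'=-\frac{\omega^2}{2r^3}\sin 2(\theta-f),\qquad f'=\frac{(1+e\cos f)^2}{(1-e^2)^{3/2}},\qquad r=\frac{1-e^2}{1+e\cos f},$$ on the phase space $(\theta,\phi,f)\in\mathbb{R}/\pi\mathbb{Z}\times\mathbb{R}\times\mathbb{R}/2\pi\mathbb{Z}$. Since $f$ is strictly increasing along solutions, the Poincaré (first return) map $P$ of the section $\{f=0\}$ is defined on all of $\mathbb{R}/\pi\mathbb{Z}\times\mathbb{R}$: $P(\theta,\phi)$ is the $(\theta,\phi)$-component, at the first return time to $\{f=0\}$, of the solution starting at $(\theta,\phi,0)$. Let $q:\mathbb{R}^2\to\mathbb{R}/\pi\mathbb{Z}\times\mathbb{R}$ be the quotient map. A lift of $P^k$ is a continuous $F:\mathbb{R}^2\to\mathbb{R}^2$ with $q\circ F=P^k\circ q$; lifts differ by translations by $(m\pi,0)$, $m\in\mathbb{Z}$. **h-sets (exit and entry dimension 1).** An h-set $N$ consists of a compact set $|N|\subset\mathbb{R}^2$ (its support) and a homeomorphism $c_N:\mathbb{R}^2\to\mathbb{R}^2$ with $c_N(|N|)=N_c:=[-1,1]^2$. Put $N_c^-=\{-1,1\}\times[-1,1]$ and $N_c^+=[-1,1]\times\{-1,1\}$. The h-set $p+A\cdot b\cdot10^{-3}$, where $p\in\mathbb{R}^2$, $A$ is an invertible $2\times 2$ matrix and $b=[b_1,b_2]\times[b_3,b_4]$, has support $\{p+10^{-3}A(x,y)^T:(x,y)\in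 b\}$, and $c_N$ is the affine map sending $p+10^{-3}A(x,y)^T$ to $\left(\frac{2x-b_1-b_2}{b_2-b_1},\frac{2y-b_3-b_4}{b_4-b_3}\right)$; thus the first coordinate of $b$ is the exit direction and the second is the entry direction. **Covering.** For h-sets $M,N$ and a continuous map $F:|M|\to\mathbb{R}^2$ let $F_c=c_N\circ F\circ c_M^{-1}:M_c\to\mathbb{R}^2$. We say $M$ $F$-covers $N$, written $M\overset{F}{\Longrightarrow}N$, if there are a continuous homotopy $h:[0,1]\times M_c\to\mathbb{R}^2$ and a linear map $L:\mathbb{R}\to\mathbb{R}$ such that $h_0=F_c$; $h([0,1],M_c^-)\cap N_c=\varnothing$; $h([0,1],M_c)\cap N_c^+=\varnothing$; $h_1(x,y)=(L(x),0)$ for all $(x,y)\in[-1,1]^2$; and $L(\{-1,1\})\subset\mathbb{R}\setminus(-1,1)$. For the cylinder map $P^k$, $M\overset{P^k}{\Longrightarrow}N$ means $M\overset{F}{\Longrightarrow}N$ for some lift $F$ of $P^k$. A chain $A\overset{f}{\Longrightarrow}B\overset{g}{\Longrightarrow}C$ means that each consecutive relation holds. **Symbolic dynamics.** Let $\Sigma_2=\{0,1\}^{\mathbb{Z}}$ with the product topology and $\sigma:\Sigma_2\to\Sigma_2$, $(\sigma(c))_n=c_{n+1}$. ''There is symbolic dynamics for $P^k$'' means: there exist a compact set $I\subset\mathbb{R}/\pi\mathbb{Z}\times\mathbb{R}$ invariant under $P^k$ and a continuous surjection $g:I\to\Sigma_2$ with $g\circ P^k|_I=\sigma\circ g$. 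*)

(* Defs.v *)
From HB Require Import structures.
From mathcomp Require Import all_boot all_order all_algebra generic_quotient.
From mathcomp Require Import all_classical all_reals all_analysis.
From mathcomp Require Import ring lra.

Set Implicit Arguments.
Unset Strict Implicit.
Unset Printing Implicit Defensive.

Import Order.TTheory GRing.Theory Num.Theory.
Import numFieldNormedType.Exports.

Local Open Scope classical_set_scope.
Local Open Scope ring_scope.

(** * The circle R/cZ and the cylinder R/piZ x R *)

Definition eqmodZ (R : realType) (c : R) : rel R :=
  fun x y => `[< exists m : int, x - y = m%:~R * c >].

Lemma eqmodZ_refl (R : realType) (c : R) : reflexive (eqmodZ c).
Proof. by move=> x; apply/asboolP; exists 0; rewrite subrr mul0r. Qed.

Lemma eqmodZ_sym (R : realType) (c : R) : symmetric (eqmodZ c).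
Proof.
move=> x y; apply/idP/idP => /asboolP[m xy]; apply/asboolP; exists (- m);
  by rewrite mulrNz mulNr -xy opprB.
Qed.

Lemma eqmodZ_trans (R : realType) (c : R) : transitive (eqmodZ c).
Proof.
move=> y x z /asboolP[m xy] /asboolP[n yz]; apply/asboolP; exists (m + n).
by rewrite mulrzDr mulrDl -xy -yz addrA subrK.
Qed.

Definition eqmodZ_equiv (R : realType) (c : R) : equiv_rel R :=
  EquivRel (eqmodZ c) (@eqmodZ_refl R c) (@eqmodZ_sym R c) (@eqmodZ_trans R c).

Definition circle (R : realType) (c : R) : topologicalType :=
  quotient_topology {eq_quot (eqmodZ_equiv c)}%qT.

Definition to_circle (R : realType) (c : R) (x : R) : circle c :=
  (\pi_(quotient_topology {eq_quot (eqmodZ_equiv c)}%qT) x)%qT.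

Lemma to_circle_eqP (R : realType) (c x y : R) :
  to_circle c x = to_circle c y <-> exists m : int, x - y = m%:~R * c.
Proof.
split=> [xy|xy]; first exact/asboolP/(@eqmodP _ (eqmodZ_equiv c) x y).
exact/(@eqmodP _ (eqmodZ_equiv c) x y)/asboolP.
Qed.

Definition cylinder (R : realType) : topologicalType := (circle (@pi R) * R)%type.

Definition to_cylinder (R : realType) (z : R * R) : cylinder R :=
  (to_circle pi z.1, z.2).

(** * The satellite system and its Poincare map *)

Definition orbital_radius (R : realType) (e f : R) : R :=
  (1 - e ^+ 2) / (1 + e * cos f).

(* The two angles of a solution curve are given by continuous real-valued
   representatives; the vector field is pi-periodic in theta and 2pi-periodic
   in f. *)
Definition is_solution (R : realType) (e w2 : R) (theta phi f : R -> R) : Prop :=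
  forall t : R,
  [/\ is_derive t 1 theta (phi t),
      is_derive t 1 phi
        (- (w2 / (2 * orbital_radius e (f t) ^+ 3)) * sin (2 * (theta t - f t)))
    & is_derive t 1 f ((1 + e * cos (f t)) ^+ 2 / (1 - e ^+ 2) `^ (3 / 2))].

Definition in_section (R : realType) (f : R) : Prop :=
  to_circle (2 * pi) f = to_circle (2 * pi) 0.

Definition first_return (R : realType) (e w2 : R) (z z' : cylinder R) : Prop :=
  exists theta phi f : R -> R, exists T : R,
  [/\ is_solution e w2 theta phi f,
      to_cylinder (theta 0, phi 0) = z /\ in_section (f 0),
      0 < T /\ in_section (f T),
      forall t, 0 < t < T -> ~ in_section (f t)
    & z' = to_cylinder (theta T, phi T)].

(* For `|e| < 1 the relation first_return is the graph of a total function,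
   so the default value z given to xget is never used. *)
Definition poincare (R : realType) (e w2 : R) (z : cylinder R) : cylinder R :=
  xget z [set z' | first_return e w2 z z'].

(** * h-sets with one exit and one entry direction *)

Definition square (R : realType) : set (R * R) := `[-1, 1] `*` `[-1, 1].
Definition square_exit (R : realType) : set (R * R) := [set -1; 1] `*` `[-1, 1].
Definition square_entry (R : realType) : set (R * R) := `[-1, 1] `*` [set -1; 1].

Record hset (R : realType) := HSet {
  supp : set (R * R);
  chart : R * R -> R * R;
  chart_inv : R * R -> R * R;
  supp_compact : compact supp;
  chartK : cancel chart chart_inv;
  chart_invK : cancel chart_inv chart;
  chart_continuous : continuous chart;
  chart_inv_continuous : continuous chart_inv;
  chart_supp : chart @` supp = @square R }.

Definition affine_pt (R : realType) (p : R * R) (A : 'M[R]_2) (z : R * R) : R * R :=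
  (p.1 + 10 ^- 3 * (A 0 0 * z.1 + A 0 1 * z.2),
   p.2 + 10 ^- 3 * (A 1 0 * z.1 + A 1 1 * z.2)).

Definition box_to_square (R : realType) (b1 b2 b3 b4 : R) (z : R * R) : R * R :=
  ((2 * z.1 - b1 - b2) / (b2 - b1), (2 * z.2 - b3 - b4) / (b4 - b3)).

(* N is the h-set p + A . ([b1, b2] x [b3, b4]) . 10^-3 *)
Definition is_affine_hset (R : realType) (N : hset R) (p : R * R) (A : 'M[R]_2)
    (b1 b2 b3 b4 : R) : Prop :=
  [/\ A \in unitmx,
      supp N = affine_pt p A @` (`[b1, b2] `*` `[b3, b4])
    & forall z, chart N (affine_pt p A z) = box_to_square b1 b2 b3 b4 z].

Lemma det_mx2 (R : comNzRingType) (A : 'M[R]_2) :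
  \det A = A 0 0 * A 1 1 - A 0 1 * A 1 0.
Proof.
rewrite (expand_det_row _ 0) !big_ord_recl big_ord0 addr0 /cofactor !det_mx11.
rewrite !mxE /= expr0 expr1 mul1r mulN1r mulrN.
by congr (A _ _ * A _ _ - A _ _ * A _ _); apply: val_inj.
Qed.

Lemma affine_hset_exists (R : realType) (p : R * R) (A : 'M[R]_2)
    (b1 b2 b3 b4 : R) :
  A \in unitmx -> b1 < b2 -> b3 < b4 ->
  exists N : hset R, is_affine_hset N p A b1 b2 b3 b4.
Proof.
move=> uA b12 b34.
pose d := A 0 0 * A 1 1 - A 0 1 * A 1 0.
have d0 : d != 0.
  by move: uA; rewrite unitmxE det_mx2 unitfE.
have b12' : b2 - b1 != 0 by rewrite subr_eq0 gt_eqF.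
have b34' : b4 - b3 != 0 by rewrite subr_eq0 gt_eqF.
pose lin (z : R * R) : R * R :=
  (1000 * (A 1 1 * (z.1 - p.1) - A 0 1 * (z.2 - p.2)) / d,
   1000 * (A 0 0 * (z.2 - p.2) - A 1 0 * (z.1 - p.1)) / d).
pose unbox (z : R * R) : R * R :=
  ((z.1 * (b2 - b1) + b1 + b2) / 2, (z.2 * (b4 - b3) + b3 + b4) / 2).
pose box := @box_to_square R b1 b2 b3 b4.
have linK : cancel lin (affine_pt p A).
  by move=> [x y]; rewrite /lin /affine_pt /=; congr (_, _); rewrite /d; field.
have affK : cancel (affine_pt p A) lin.
  by move=> [x y]; rewrite /lin /affine_pt /=; congr (_, _); rewrite /d; field.
have boxK : cancel box unbox.
  by move=> [x y]; rewrite /box /unbox /box_to_square /=; congr (_, _); field.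
have unboxK : cancel unbox box.
  by move=> [x y]; rewrite /box /unbox /box_to_square /=; congr (_, _); field.
have c1 (T : topologicalType) (f g : T -> R) : continuous f -> continuous g ->
    continuous (fun z => (f z, g z)).
  by move=> cf cg z; apply: (cvg_pair (cf z) (cg z)).
have cfst : continuous (fst : R * R -> R) by move=> z; exact: cvg_fst.
have csnd : continuous (snd : R * R -> R) by move=> z; exact: cvg_snd.
have caff2 (a b c : R) : continuous (fun z : R * R => a * z.1 + b * z.2 + c).
  move=> z; apply: (@continuousD _ _ _ (fun z => a * z.1 + b * z.2) (cst c));
    last exact: cst_continuous.
  apply: (@continuousD _ _ _ (fun z => a * z.1) (fun z => b * z.2)).
    exact: (continuousM (@cst_continuous _ _ a z) (cfst z)).
  exact: (continuousM (@cst_continuous _ _ b z) (csnd z)).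
have ext (f g : R * R -> R * R) : (forall z, f z = g z) ->
  continuous f -> continuous g by move=> /funext ->.
have caff : continuous (affine_pt p A).
  apply: ext; last apply: (c1 _ _ _ (caff2 (10 ^- 3 * A 0 0) (10 ^- 3 * A 0 1) p.1)
    (caff2 (10 ^- 3 * A 1 0) (10 ^- 3 * A 1 1) p.2)).
  by move=> z; rewrite /affine_pt /=; congr (_, _); ring.
have clin : continuous lin.
  apply: ext; last apply: (c1 _ _ _
    (caff2 (1000 * A 1 1 / d) (- (1000 * A 0 1 / d))
       (1000 * (A 0 1 * p.2 - A 1 1 * p.1) / d))
    (caff2 (- (1000 * A 1 0 / d)) (1000 * A 0 0 / d)
       (1000 * (A 1 0 * p.1 - A 0 0 * p.2) / d))).
  by move=> z; rewrite /lin /=; congr (_, _); ring.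
have cbox : continuous box.
  apply: ext; last apply: (c1 _ _ _
    (caff2 (2 / (b2 - b1)) 0 ((- b1 - b2) / (b2 - b1)))
    (caff2 0 (2 / (b4 - b3)) ((- b3 - b4) / (b4 - b3)))).
  by move=> z; rewrite /box /box_to_square /=; congr (_, _); ring.
have cunbox : continuous unbox.
  apply: ext; last apply: (c1 _ _ _
    (caff2 ((b2 - b1) / 2) 0 ((b1 + b2) / 2))
    (caff2 0 ((b4 - b3) / 2) ((b3 + b4) / 2))).
  by move=> z; rewrite /unbox /=; congr (_, _); ring.
have ccomp (f g : R * R -> R * R) :
    continuous f -> continuous g -> continuous (f \o g).
  by move=> cf cg z; apply: continuous_comp; [exact: cg|exact: cf].
pose S := affine_pt p A @` (`[b1, b2] `*` `[b3, b4]).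
have cS : compact S.
  apply: continuous_compact; first exact: continuous_subspaceT.
  by apply: compact_setX; exact: segment_compact.
have SE : (box \o lin) @` S = @square R.
  apply/seteqP; split=> [_ [_ [[x y] [/= xb yb] <-] <-]|z zsq].
    rewrite /= affK /square /box /box_to_square /= !in_itv /=.
    move: xb yb; rewrite /= !in_itv /= => /andP[x1 x2] /andP[y1 y2].
    by split; rewrite ler_pdivlMr ?ler_pdivrMr ?subr_gt0//; lra.
  exists (affine_pt p A (unbox z)); last by rewrite /= affK unboxK.
  exists (unbox z) => //; case: z zsq => x y [/=].
  rewrite /unbox /= !in_itv /= => /andP[x1 x2] /andP[y1 y2].
  by split; nra.
exists (HSet cS (can_comp boxK linK : cancel (box \o lin) (affine_pt p A \o unbox))
  (can_comp affK unboxK) (ccomp _ _ cbox clin) (ccomp _ _ caff cunbox) SE).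
by split=> // z; rewrite /= affK.
Qed.

(** * Covering relations *)

Definition covers (R : realType) (F : R * R -> R * R) (M N : hset R) : Prop :=
  exists (h : R * (R * R) -> R * R) (L : {linear R^o -> R^o}),
  [/\ {within `[0, 1] `*` @square R, continuous h},
      forall z, square z -> h (0, z) = chart N (F (chart_inv M z)),
      (forall (t : R) z, 0 <= t <= 1 -> square_exit z -> ~ square (h (t, z))) /\
      (forall (t : R) z, 0 <= t <= 1 -> square z -> ~ square_entry (h (t, z))),
      forall x y, square (x, y) -> h (1, (x, y)) = (L x, 0)
    & forall x : R, [set -1; 1] x -> ~ (-1 < L x < 1)].

Definition is_lift (R : realType) (G : cylinder R -> cylinder R)
    (F : R * R -> R * R) : Prop :=
  continuous F /\ forall z, to_cylinder (F z) = G (to_cylinder z).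

Definition cyl_covers (R : realType) (G : cylinder R -> cylinder R)
    (M N : hset R) : Prop :=
  exists F, is_lift G F /\ covers F M N.

(** * Symbolic dynamics *)

Definition Sigma2 : topologicalType := prod_topology (fun _ : int => bool).

Definition shift_map (c : Sigma2) : Sigma2 := fun n : int => c (n + 1).

Definition symbolic_dynamics (R : realType) (G : cylinder R -> cylinder R) : Prop :=
  exists (I : set (cylinder R)) (g : cylinder R -> Sigma2),
  [/\ compact I,
      G @` I = I,
      {within I, continuous g},
      g @` I = setT
    & forall x, I x -> g (G x) = shift_map (g x)].

(* Main.v *)
(* Write X = 2 (theta - pi/2 - f) and V = 2 (1 - e^2)^(3/2) phi.  In the variable f
   the system becomes X' = V / (1 + cos f / 10)^2 - 2 and
   V' = (79/100) (1 + cos f / 10) sin X, so the flow from f = 0 to f = 2 pi is a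
   homeomorphism of the plane, and its translates by multiples of (pi, 0) are
   lifts of P.  Taylor models with integer coefficients and explicit error radii
   enclose the images of the edges of the two boxes: in the chart of either box,
   the image of the boundary lies in the open strip |y| < 1, the left edge goes to
   x < -1 and the right edge to x > 1.  A homeomorphism sending the boundary of the
   square into the strip sends the whole square into it, so contracting y and
   blending x with 2x gives all the covering relations.

   A curve crossing one box from left to right contains a subcurve whose image
   crosses the other, or the same, box; hence every finite itinerary is realised,
   and by compactness every bi-infinite one.  As P is injective and the boxes are
   disjoint on the cylinder, an orbit staying in the boxes is determined by its
   initial point, and the itinerary is a continuous function of that point. *)
From Stdlib Require Import ZArith.
From HB Require Import structures.
Require Import Defs.
From mathcomp Require Import all_boot all_order all_algebra.
From mathcomp Require Import all_classical all_reals all_analysis.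
From mathcomp Require Import ring lra zify ssrZ.

Set Implicit Arguments.
Unset Strict Implicit.
Unset Printing Implicit Defensive.

Import Order.TTheory GRing.Theory Num.Theory.
Import numFieldNormedType.Exports.

Local Open Scope classical_set_scope.
Local Open Scope ring_scope.

Local Arguments Z.mul : simpl never.
Local Arguments Z.add : simpl never.
Local Arguments Z.sub : simpl never.
Local Arguments Z.pow : simpl never.
Local Arguments Z.div : simpl never.

(** * Integer Taylor models *)

(** Errors are controlled a posteriori. The integrator rounds and truncates freely; for each step
    only the defect of the polynomials that it returns is bounded, in exact integer arithmetic, and
    these defects enter Gronwall-type inequalities. Sine and cosine are extra unknowns of a
    polynomial system; their error is a distance to a circle, which the motion of the angle does not
    amplify. Only edges are integrated, so one parameter s suffices. Two irrational numbers remain.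
    The factor (1 - e^2)^(3/2) is absorbed in V and in the speed of f; the end time 2 pi is replaced
    by a slightly smaller rational, and a slack of 10^-4 covers the rest of the flow. There is one
    lift per source box, common to both targets. Hence one integration of an edge serves two
    covering relations, and orbits can be followed in the plane, each symbol naming the lift to
    apply. Closedness arguments on the cylinder go through a continuous map to the plane that is
    injective on the boxes. *)

Section certificate.
Local Open Scope Z_scope.

(* An integer stands for a multiple of 2^-30.  A list of integers is a polynomial
   in the parameter s of an edge, |s| <= 1, and a list of such lists a polynomial
   in the local time t in [0, 1] with coefficients depending on s. *)
Definition prec : Z := 30.
Definition one : Z := 1073741824.

Fixpoint padd (p q : seq Z) : seq Z :=
  match p, q with
  | [::], _ => q
  | _, [::] => p
  | a :: p', b :: q' => (a + b) :: padd p' q'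
  end.
Fixpoint pscale (k : Z) (p : seq Z) : seq Z :=
  match p with [::] => [::] | a :: p' => k * a :: pscale k p' end.
Fixpoint pmul (p q : seq Z) : seq Z :=
  match p with
  | [::] => [::]
  | a :: p' => padd (pscale a q) (0 :: pmul p' q)
  end.
Fixpoint pnorm (p : seq Z) : Z :=
  match p with [::] => 0 | a :: p' => Z.abs a + pnorm p' end.

Fixpoint badd (p q : seq (seq Z)) : seq (seq Z) :=
  match p, q with
  | [::], _ => q
  | _, [::] => p
  | a :: p', b :: q' => padd a b :: badd p' q'
  end.
Definition bscale (k : Z) (p : seq (seq Z)) := [seq pscale k a | a <- p].
Fixpoint bmul (p q : seq (seq Z)) : seq (seq Z) :=
  match p with
  | [::] => [::]
  | a :: p' => badd [seq pmul a b | b <- q] ([::] :: bmul p' q)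
  end.
Fixpoint bnorm (p : seq (seq Z)) : Z :=
  match p with [::] => 0 | a :: p' => pnorm a + bnorm p' end.
Fixpoint bderiv_from (k : Z) (p : seq (seq Z)) : seq (seq Z) :=
  match p with [::] => [::] | a :: p' => pscale k a :: bderiv_from (k + 1) p' end.
Definition bderiv (p : seq (seq Z)) := bderiv_from 1 (behead p).
Fixpoint bsum (p : seq (seq Z)) : seq Z :=
  match p with [::] => [::] | a :: p' => padd a (bsum p') end.

(* The functions from ptrmul to gen_rot and taylor_arc guess Taylor coefficients with
   truncation and rounding; nothing is proved about them, since verify bounds the
   defect of whatever they return. *)
Fixpoint ptrmul (d : nat) (p q : seq Z) : seq Z :=
  match d, p with
  | S d', a :: p' => padd (pscale a (take d q)) (0 :: ptrmul d' p' q)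
  | _, _ => [::]
  end.
Fixpoint dot (d : nat) (p q : seq (seq Z)) : seq Z :=
  match p, q with
  | a :: p', b :: q' => padd (ptrmul d a b) (dot d p' q')
  | _, _ => [::]
  end.
Definition rshift (k : Z) (p : seq Z) := [seq Z.shiftr (k * a) prec | a <- p].
Definition rnd (p : seq Z) := [seq Z.shiftr a prec | a <- p].
Definition recip (k : Z) : Z := one / k.

Fixpoint gen_cs (n : nat) (k h : Z) (c s : Z) : seq Z * seq Z :=
  match n with
  | O => ([:: c], [:: s])
  | S n' => let r := recip k in
    let hr := Z.shiftr (h * r) prec in
    let: (cs, ss) := gen_cs n' (k + 1) h (- Z.shiftr (hr * s) prec) (Z.shiftr (hr * c) prec) in
    (c :: cs, s :: ss)
  end.

Fixpoint gen_g (n : nat) (g0 : Z) (Q : seq (seq Z)) (grev : seq (seq Z)) : seq (seq Z) :=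
  match n with
  | O => grev
  | S n' =>
    let r := Z.shiftr (head 0 (dot 1 grev (behead Q))) prec in
    gen_g n' g0 Q ([:: - Z.shiftr (g0 * r) prec] :: grev)
  end.

Fixpoint gen (n d : nat) (k h : Z) (G q : seq (seq Z)) (X V Y C Xt : seq (seq Z)) :=
  match n with
  | O => (rev X, rev V, rev Y, rev C)
  | S n' =>
    let r := recip k in
    let xt0 := rshift h (rnd (dot d V G)) in
    (* [X], [V], [Y], [C] list their coefficients in decreasing order and [G], [q], [Xt'] in
       increasing order, so [dot] gives a coefficient of a Cauchy product. [X] has a single entry
       only in the first step, where the constant -2 h of X' enters. *)
    let xt := if X is [:: _] then padd xt0 [:: -2 * h] else xt0 in
    let Xt' := rcons Xt xt in
    (* 848256041 = 0.79 * 2^30 *)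
    let hv := Z.shiftr (Z.shiftr (h * 848256041) prec * r) prec in
    gen n' d (k + 1) h G q
      (rshift r xt :: X)
      (rshift hv (rnd (dot d Y q)) :: V)
      (rshift r (rnd (dot d C Xt')) :: Y)
      (pscale (-1) (rshift r (rnd (dot d Y Xt'))) :: C) Xt'
  end.

Fixpoint gen_rot (n d : nat) (k : Z) (X0 : seq Z) (s c : seq Z) : seq (seq Z) * seq (seq Z) :=
  match n with
  | O => ([:: s], [:: c])
  | S n' => let r := recip k in
    let: (ss, cs) := gen_rot n' d (k + 1) X0 (rshift r (rnd (ptrmul d c X0)))
                       (pscale (-1) (rshift r (rnd (ptrmul d s X0)))) in
    (s :: ss, c :: cs)
  end.

Definition cdiv (a b : Z) := a / b + 1.

Definition same (p q : seq Z) : bool := pnorm (padd p (pscale (-1) q)) <=? 0.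

Definition rot_defect (C Y dX : seq (seq Z)) : Z :=
  bnorm (badd (bscale one (bderiv C)) (bmul Y dX))
  + bnorm (badd (bscale one (bderiv Y)) (bscale (-1) (bmul C dX))).

(* Models c, s, X, V, C, Y of cos f, sin f, X, V, cos X, sin X, with radii ec for
   (c, s), eY for (C, Y), eX and eV. *)
Record state := State { st_c : seq Z; st_s : seq Z; st_ec : Z;
  st_X : seq Z; st_V : seq Z; st_C : seq Z; st_Y : seq Z;
  st_eX : Z; st_eV : Z; st_eY : Z }.

Record arc := Arc { arc_c : seq (seq Z); arc_s : seq (seq Z);
  arc_X : seq (seq Z); arc_V : seq (seq Z);
  arc_C : seq (seq Z); arc_Y : seq (seq Z) }.

(* A step of length h in f.  With q = 10 + cos f in [9, 11], the equations are
   q^2 (X' + 2 h) = 100 h V and 1000 V' = 79 h q sin X; the constants 81, 869 and 158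
   are 9^2, 79 * 11 and 79 * 2.  The comparisons on eX' and eV' say that these radii
   solve the coupled Gronwall inequalities for the errors of X and V. *)
Definition verify (h : Z) (st : state) (a : arc) : option state :=
  let: State c s ec X V C Y eX eV eY := st in
  let: Arc cs ss Xs Vs Cs Ys := a in
  let dX := bderiv Xs in
  let dX2 := badd dX [:: [:: 2 * h]] in
  let q := badd [:: [:: 10 * one]] cs in
  let dc := rot_defect cs ss [:: [:: h]] in
  let dC := rot_defect Cs Ys dX in
  let ec' := ec + cdiv dc one in
  let eY' := eY + cdiv dC one in
  let r1 := bnorm (badd (bmul (bmul q q) dX2) (bscale (- 100 * one * h) Vs))
            + 23 * one * ec' * bnorm dX2 in
  let r2 := bnorm (badd (bscale (1000 * one * one) (bderiv Vs)) (bscale (- 79 * h) (bmul q Ys)))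
            + one * h * (869 * eY' + 158 * ec') in
  let p1 := cdiv r1 (81 * one * one) in
  let p2 := cdiv r2 (1000 * one * one) in
  (* Eliminating the new radius of V from the two error inequalities leaves the factor 1 - (100/81)
     (869/1000) h^2 in front of [eX']; 1073/1000 is that product of constants rounded up. *)
  let eX' := cdiv ((eX + p1 + cdiv (100 * h * (eV + p2)) (81 * one)) * one)
                  (one - cdiv (1073 * h * h) (1000 * one)) in
  let eV' := eV + p2 + cdiv (869 * h * eX') (1000 * one) in
  if same (head [::] cs) c && same (head [::] ss) s && same (head [::] Xs) X
     && same (head [::] Vs) V && same (head [::] Cs) C && same (head [::] Ys) Y
     && (0 <? h) && (2 * h <=? one) && (ec' <=? one) && (eY' <=? one)
     && (ec * one + dc <=? ec' * one)
     && (eY * one + dC <=? eY' * one)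
     && (100 * one * h * eV' + r1 <=? 81 * one * one * (eX' - eX))
     && (869 * one * h * eX' + r2 <=? 1000 * one * one * (eV' - eV))
  then Some (State (bsum cs) (bsum ss) ec' (bsum Xs) (bsum Vs) (bsum Cs) (bsum Ys) eX' eV' eY')
  else None.

Definition taylor_arc (n d : nat) (h : Z) (st : state) : arc :=
  let: State c s ec X V C Y _ _ _ := st in
  let: (cs, ss) := gen_cs n 1 h (head 0 c) (head 0 s) in
  let cs := [seq [:: a] | a <- cs] in
  let ss := [seq [:: a] | a <- ss] in
  (* 107374183 is 2^30 / 10 rounded up: this [q] models 1 + cos f / 10, one tenth of the [q] of
     [verify]. *)
  let q := [seq rnd a | a <- bscale 107374183 (badd [:: [:: 10 * one]] cs)] in
  let Q := [seq rnd a | a <- bmul q q] in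
  let g0 := (one * one) / head 0 (head [::] Q) in
  let G := rev (gen_g (n.-1) g0 Q [:: [:: g0]]) in
  let: (X, V, Y, C) := gen n d 1 h G q [:: X] [:: V] [:: Y] [:: C] [::] in
  Arc cs ss X V C Y.

Fixpoint run (n d : nat) (hs : seq Z) (st : state) : option state :=
  match hs with
  | [::] => Some st
  | h :: hs' => if verify h st (taylor_arc n d h st) is Some st' then run n d hs' st' else None
  end.

(** The models of cos X and sin X at f = 0 are themselves obtained by a rotation: the angle r X with
    r running from 0 to 1, started at the exact point (1, 0). *)
Definition init (n d : nat) (X V : seq Z) (e : Z) : option state :=
  let: (Ys, Cs) := gen_rot n d 1 X [::] [:: one] in
  let dC := rot_defect Cs Ys [:: X] in
  let eY := cdiv dC one in
  if same (head [::] Cs) [:: one] && same (head [::] Ys) [::]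
     && (dC <=? eY * one)
  then Some (State [:: one] [::] 0 X V (bsum Cs) (bsum Ys) e e eY)
  else None.

Definition lin (al be : Z) (st : state) : seq Z :=
  padd (pscale al (st_X st)) (pscale be (st_V st)).
(** 107374 is 10^-4 in units of 2^-30, rounded down. It pays for the flow between the rational end
    time of the integration and f = 2 pi. The norm of the tail of the polynomial bounds its
    dependence on s. *)
Definition lin_rad (al be : Z) (st : state) : Z :=
  pnorm (behead (lin al be st)) + Z.abs al * (st_eX st + 107374) + Z.abs be * (st_eV st + 107374).
Definition lin_gt (al be lo : Z) (st : state) : bool :=
  lo * one <? head 0 (lin al be st) - lin_rad al be st.
Definition lin_lt (al be hi : Z) (st : state) : bool :=
  head 0 (lin al be st) + lin_rad al be st <? hi * one.

(* The centre (pi/2, 10^-15 p) and the matrix 10^-16 [mu mu; ka -ka] of a box. *)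
Record box := Box { bx_mu : Z; bx_ka : Z; bx_p : Z }.
(* The strip lo < al X - be V < hi lies in the open strip |y| < 1 of the chart of the
   target box, and the half-planes al X + be V < L and al X + be V > R lie in x < -1
   and x > 1. *)
Record target := Target { tg_al : Z; tg_be : Z; tg_lo : Z; tg_hi : Z; tg_L : Z; tg_R : Z }.
Inductive side := Left | Right | Entry.

Definition in_strip (t : target) (st : state) : bool :=
  lin_gt (tg_al t) (- tg_be t) (tg_lo t) st && lin_lt (tg_al t) (- tg_be t) (tg_hi t) st.
Definition on_side (sd : side) (t : target) (st : state) : bool :=
  match sd with
  | Left => lin_lt (tg_al t) (tg_be t) (tg_L t) st
  | Right => lin_gt (tg_al t) (tg_be t) (tg_R t) st
  | Entry => true
  end.

(* 10^15 (1 - e^2)^(3/2), rounded up *)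
Definition Kz : Z := 985037562735554.

(* The edge with box coordinates ((am + s ah) / 10, (bm + s bh) / 10). *)
Definition edge_X (bx : box) (am ah bm bh : Z) : seq Z :=
  [:: 2 * one * bx_mu bx * (am + bm) / 10 ^ 20; 2 * one * bx_mu bx * (ah + bh) / 10 ^ 20].
(** The denominator 10^35 is 10^15 for [Kz] times 10^20, the latter being 10^16 for the matrix, 10^3
    for its scale and 10 for the tenths. The factor [10 ^ 5] brings the centre, given in units of
    10^-15, to the same 10^20. *)
Definition edge_V (bx : box) (am ah bm bh : Z) : seq Z :=
  [:: 2 * one * Kz * (bx_p bx * 10 ^ 5 + bx_ka bx * (am - bm)) / 10 ^ 35;
      2 * one * Kz * (bx_ka bx * (ah - bh)) / 10 ^ 35].

(** The bounds on pi used later place 2 pi between 6.283184 and 6.283188, so a run of this length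
    stops before 2 pi and misses it by at most 5 10^-6. *)
Definition time_ok (hs : seq Z) : bool :=
  (6283183 * one <=? foldr Z.add 0 hs * 1000000) && (foldr Z.add 0 hs * 1000000 <=? 6283184 * one).

Definition edge_ok (n d : nat) (hs : seq Z) (bx : box) (t0 t1 : target) (sd : side)
    (am ah bm bh : Z) : bool :=
  time_ok hs &&
  if init 8 d (edge_X bx am ah bm bh) (edge_V bx am ah bm bh) 10 is Some st then
    if run n d hs st is Some st' then
      (pnorm (st_V st') + st_eV st' <=? 8 * one)
      && in_strip t0 st' && on_side sd t0 st' && in_strip t1 st' && on_side sd t1 st'
    else false
  else false.

(** Midpoints of the given intervals, up to a few last digits. The two columns of each matrix agree
    up to sign so closely that one pair (mu, ka) approximates both. *)
Definition box0 := Box 7069564693968235 7072570610308376 1098956671156722.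
Definition box1 := Box 7344289378368971 6786855938266016 1294511656257225.
(** In units of 10^-6, [tg_al] is ka and [tg_be] is mu / (1 - e^2)^(3/2) for the target box. With
    these slopes al X - be V follows the entry coordinate of the target and al X + be V the exit
    coordinate. The bounds of [tg10] and [tg11] differ from those of [tg00] and [tg01] by 2 pi ka,
    the additional half turn made from box 1. *)
Definition tg00 := Target 707257 717695 (-1911829) (-1395829) 1550229 1557429.
Definition tg01 := Target 678686 745585 (-2048988) (-1504697) 1879516 1913423.
Definition tg10 := Target 707257 717695 2531998 3047998 5994056 6001256.
Definition tg11 := Target 678686 745585 2215320 2759611 6143823 6177730.

Definition steps (k : Z) (n : nat) : seq Z :=
  let h := one / k in
  rcons (nseq n h) (6283184 * one / 1000000 - Z.of_nat n * h).

(* Enclosures of 2^30 cos (h / 2^30), used to locate pi / 2. *)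
Definition cos_range (n : nat) (h : Z) : option (Z * Z) :=
  let: (cs, ss) := gen_cs n 1 h one 0 in
  let cs := [seq [:: a] | a <- cs] in
  let ss := [seq [:: a] | a <- ss] in
  let d := rot_defect cs ss [:: [:: h]] in
  let e := cdiv d one in
  let c := head 0 (bsum cs) in
  if same (head [::] cs) [:: one] && same (head [::] ss) [::] && (d <=? e * one)
     && same (bsum cs) [:: c]
  then Some (c - e, c + e) else None.

(** The two arguments are 2^29 times 3.141592, rounded up, and 2^29 times 3.141594, rounded down.
    The change of sign of the cosine brackets pi / 2 between them. *)
Lemma cos_range_pihalf :
  cos_range 16 1686629363 = Some (285, 425) /\
  cos_range 16 1686630435 = Some (-788, -648).
Proof. by split; vm_compute. Qed.

Definition boxes (i : bool) : box := if i then box1 else box0.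
Definition targets (i j : bool) : target :=
  match i, j with
  | false, false => tg00 | false, true => tg01
  | true, false => tg10 | true, true => tg11
  end.
(* Sides of the boxes, in tenths of the unit of their coordinates. *)
Definition box_left (i : bool) : Z := if i then -100 else -8.
Definition box_right (i : bool) : Z := if i then 50 else 8.
Definition box_bottom (i : bool) : Z := if i then -750 else -1800.
Definition box_top (i : bool) : Z := if i then 2000 else 800.
(* Starting from box i, the lift of P used below subtracts (turns i + 2) pi from theta. *)
Definition turns (i : bool) : Z := if i then 1 else 0.

(** The last four comparisons are in units of 10^-36, where [10 ^ 33] is a margin of 10^-3 that
    absorbs the replacement of the true matrix, centre and time scale by their approximations. The
    third and fourth conditions make |V| <= 9 and the strip imply |X| <= 16. *)
Definition target_ok (i j : bool) : bool :=
  let b := boxes j in let t := targets i j in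
  let pi_lo := 2 * bx_ka b * turns i * 3141592 * 10 ^ 14 in
  let pi_hi := 2 * bx_ka b * turns i * 3141594 * 10 ^ 14 in
  let d := 4 * bx_ka b * bx_mu b in
  let p := 2 * bx_mu b * bx_p b * 10 ^ 5 in
  [&& 0 <? tg_al t, 0 <=? tg_be t, tg_hi t + 9 * tg_be t <=? 16 * tg_al t,
      - (16 * tg_al t) <=? tg_lo t - 9 * tg_be t,
      Z.abs (tg_al t * 10 ^ 10 - bx_ka b) <=? 10 ^ 10,
      Z.abs (tg_be t * Kz - bx_mu b * 10 ^ 5) <=? 10 ^ 15,
      d * box_bottom j + pi_hi - p + 10 ^ 33 <=? tg_lo t * 10 ^ 30,
      tg_hi t * 10 ^ 30 <=? d * box_top j + pi_lo - p - 10 ^ 33,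
      tg_L t * 10 ^ 30 <=? d * box_left j + pi_lo + p - 10 ^ 33
    & d * box_right j + pi_hi + p + 10 ^ 33 <=? tg_R t * 10 ^ 30].

Definition box_ok (i : bool) : bool :=
  let b := boxes i in
  [&& 10 ^ 15 <=? bx_ka b, bx_ka b <=? 10 ^ 16, 10 ^ 15 <=? bx_mu b, bx_mu b <=? 10 ^ 16,
      Z.abs (bx_p b) <=? 19 * 10 ^ 14,
      Z.abs (box_left i) <=? 2000, Z.abs (box_right i) <=? 2000, Z.abs (box_bottom i) <=? 2000
    & Z.abs (box_top i) <=? 2000].

Lemma box_okT i : box_ok i.
Proof. by case: i; vm_compute. Qed.

Lemma target_okT i j : target_ok i j.
Proof. by case: i; case: j; vm_compute. Qed.

Lemma edge0_left :
  edge_ok 5 5 (steps 4 25) (boxes false) (targets false false) (targets false true)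
    Left (-8) 0 (-500) 1300.
Proof. by vm_compute. Qed.
(** The right edge of box 0 is cut into three overlapping pieces, from -500 to 800, from -1367 to
    -499 and from -1800 to -1366 in tenths. On shorter pieces the coefficients of s, and with them
    the bounds by [pnorm], are smaller. *)
Lemma edge0_right_top :
  edge_ok 5 4 (steps 4 25) (boxes false) (targets false false) (targets false true)
    Right 8 0 150 650.
Proof. by vm_compute. Qed.
Lemma edge0_right_mid :
  edge_ok 5 4 (steps 4 25) (boxes false) (targets false false) (targets false true)
    Right 8 0 (-933) 434.
Proof. by vm_compute. Qed.
Lemma edge0_right_bottom :
  edge_ok 5 3 (steps 4 25) (boxes false) (targets false false) (targets false true)
    Right 8 0 (-1583) 217.
Proof. by vm_compute. Qed.
Lemma edge0_bottom :
  edge_ok 5 3 (steps 4 25) (boxes false) (targets false false) (targets false true)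
    Entry 0 8 (-1800) 0.
Proof. by vm_compute. Qed.
Lemma edge0_top :
  edge_ok 5 3 (steps 4 25) (boxes false) (targets false false) (targets false true)
    Entry 0 8 800 0.
Proof. by vm_compute. Qed.
Lemma edge1_left :
  edge_ok 5 5 (steps 8 50) (boxes true) (targets true false) (targets true true)
    Left (-100) 0 625 1375.
Proof. by vm_compute. Qed.
Lemma edge1_right :
  edge_ok 5 5 (steps 8 50) (boxes true) (targets true false) (targets true true)
    Right 50 0 625 1375.
Proof. by vm_compute. Qed.
Lemma edge1_bottom :
  edge_ok 5 4 (steps 8 50) (boxes true) (targets true false) (targets true true)
    Entry (-25) 75 (-750) 0.
Proof. by vm_compute. Qed.
Lemma edge1_top :
  edge_ok 5 4 (steps 8 50) (boxes true) (targets true false) (targets true true)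
    Entry (-25) 75 2000 0.
Proof. by vm_compute. Qed.
End certificate.

(** * Comparison of derivatives, primitives on the line and geometric limits *)

Lemma is_derive_continuous (R : realType) (f : R -> R) (x df : R) :
  is_derive x 1 f df -> {for x, continuous f}.
Proof. by move=> fx; apply/differentiable_continuous/derivable1_diffP. Qed.

Lemma ler_of_derive (R : realType) (f g df dg : R -> R) (a b : R) : a <= b ->
  (forall t, a <= t <= b -> is_derive t 1 f (df t)) ->
  (forall t, a <= t <= b -> is_derive t 1 g (dg t)) ->
  (forall t, a <= t <= b -> df t <= dg t) ->
  f b - f a <= g b - g a.
Proof.
move=> ab ff gg fg.
have dh t : a <= t <= b -> is_derive t 1 (g - f) (dg t - df t).
  by move=> tab; have := ff _ tab; have := gg _ tab => *; apply: is_deriveB.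
have [||c] := @MVT_segment R (g - f) (fun t => dg t - df t) a b ab.
- by move=> t; rewrite in_itv/= => /andP[t1 t2]; apply: dh; rewrite !ltW.
- apply: continuous_in_subspaceT => t; rewrite inE/= in_itv/= => tab.
  exact: is_derive_continuous (dh _ tab).
rewrite in_itv/= => cab /= E; have := fg _ cab.
rewrite -subr_ge0 => h; rewrite -subr_ge0.
have -> : g b - g a - (f b - f a) = (g - f) b - (g - f) a.
  by rewrite !fctE; ring.
by rewrite E mulr_ge0// subr_ge0.
Qed.

Lemma ler_norm_of_derive (R : realType) (f g df dg : R -> R) (a b : R) : a <= b ->
  (forall t, a <= t <= b -> is_derive t 1 f (df t)) ->
  (forall t, a <= t <= b -> is_derive t 1 g (dg t)) ->
  (forall t, a <= t <= b -> `|df t| <= dg t) ->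
  `|f b - f a| <= g b - g a.
Proof.
move=> ab ff gg fg; rewrite ler_norml lerNl; apply/andP; split.
  have -> : - (f b - f a) = (- f) b - (- f) a by rewrite !fctE; ring.
  apply: (@ler_of_derive _ _ g (fun t => - df t) dg) => // t tab.
    by have := ff _ tab => ?; apply: is_deriveN.
  by have := fg _ tab; rewrite ler_norml => /andP[]; lra.
apply: (@ler_of_derive _ f g df dg) => // t tab.
exact: le_trans (ler_norm _) (fg _ tab).
Qed.

Lemma eq_of_derive0 (R : realType) (f : R -> R) (a b : R) :
  (forall t, Num.min a b <= t <= Num.max a b -> is_derive t 1 f 0) -> f a = f b.
Proof.
wlog ab : a b / a <= b.
  by move=> H; case/orP: (le_total a b) => [/H//|ba h];
    apply/esym/H => //; rewrite minC maxC.
rewrite min_l// max_r// => h; apply/eqP; rewrite eq_sym -subr_eq0 -normr_le0.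
have := @ler_norm_of_derive _ f (cst 0) (fun=> 0) (fun=> 0) _ _ ab h.
by rewrite /= subrr; apply => t _; rewrite normr0.
Qed.

(** The integral from -n is a primitive to the right of -n. Normalised to vanish at 0, these
    primitives agree wherever two of them are defined, so n may be chosen from |x|; the choice
    leaves enough room for one n to serve a whole neighbourhood. *)
Lemma continuous_primitive (R : realType) (g : R -> R) : continuous g ->
  exists G : R -> R, G 0 = 0 /\ forall t : R, is_derive t 1 G (g t).
Proof.
move=> cg.
pose F (n : nat) (x : R) : R := \int[lebesgue_measure]_(t in `[- n%:R, x]) g t.
have dF (n : nat) (x : R) : - n%:R < x -> is_derive x 1 (F n) (g x).
  move=> nx.
  have [||dF] := @continuous_FTC1_closed _ g (- n%:R) x (x + 1) _ _ nx (cg x).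
  - by rewrite ltrDl.
  - apply: continuous_compact_integrable; first exact: segment_compact.
    exact: continuous_subspaceT.
  by rewrite derive1E => <-; exact: derivableP.
pose N (x : R) : nat := (Num.truncn `|x|).+3.
have NP (x : R) : `|x| < (N x)%:R - 2.
  by rewrite /N -addn2 natrD addrK; case/andP: (truncn_itv (normr_ge0 x)).
pose G (m : nat) (x : R) := F m x - F m 0.
have GE (n m : nat) (x : R) : `|x| < n%:R -> `|x| < m%:R -> G n x = G m x.
  move=> xn xm.
  suff : (F n - F m) 0 = (F n - F m) x by rewrite !fctE => E;
    rewrite /G -(subrK (F m x) (F n x)) -E; ring.
  apply: eq_of_derive0 => t /andP[t1 t2].
  have tx : - `|x| <= t.
    apply: le_trans t1; rewrite le_min oppr_le0 normr_ge0/=.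
    by rewrite lerNl; apply: le_trans (ler_norm _) _; rewrite normrN.
  have nt (k : nat) : `|x| < k%:R -> - k%:R < t.
    by move=> xk; apply: lt_le_trans tx; rewrite ltrN2.
  rewrite -(subrr (g t)); have := dF n t (nt _ xn); have := dF m t (nt _ xm).
  by move=> *; apply: is_deriveB.
exists (fun x => G (N x) x); split; first by rewrite /G subrr.
move=> t; pose M := (N t).+1.
have tM : `|t| < M%:R - 3 by rewrite /M -addn1 natrD; have := NP t; lra.
have : is_derive t 1 (G M) (g t).
  have ?: is_derive t 1 (F M) (g t).
    apply: dF; apply: (@lt_le_trans _ _ (- `|t|)).
      by rewrite ltrN2 (lt_trans tM)// ltrBlDr ltrDl.
    by rewrite lerNl; apply: le_trans (ler_norm _) _; rewrite normrN.
  by rewrite -[g t]subr0; apply: is_deriveB.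
apply: near_eq_is_derive; near=> y.
have yt : `|t - y| < 1.
  by near: y; exact: (nbhsx_ballx t 1 ltr01).
have : `|y| < `|t| + 1.
  have := ler_normB t (t - y); rewrite opprB addrC subrK.
  lra.
move=> h; apply: GE; first by lra.
by have := NP y; lra.
Unshelve. all: by end_near. Qed.

Lemma le0_of_geometric (R : realType) (x C : R) :
  (forall n, x <= C / 2 ^+ n) -> x <= 0.
Proof.
move=> h; rewrite leNgt; apply/negP => x0.
have C0 : 0 < C by have := h 0%N; rewrite expr0 divr1; apply: lt_le_trans.
have [n nx] : exists n : nat, C / x < n%:R.
  by exists (Num.truncn (C / x)).+1; rewrite truncnS_gt.
have /(le_trans (h n)) : C / 2 ^+ n <= C / n.+1%:R.
  rewrite ler_pM2l// lef_pV2 ?posrE ?exprn_gt0 ?ltr0n//.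
  by rewrite -natrX ler_nat ltn_expl.
rewrite ler_pdivlMr ?ltr0n// leNgt => /negP; apply.
by move: nx; rewrite ltr_pdivrMr// mulrC => /lt_le_trans; apply; rewrite ler_pM2l// ler_nat.
Qed.

(** The sequences u n - 2 C / 2^n and u n + 2 C / 2^n are monotone in opposite directions and the
    first stays below the second; the limit is the supremum of the first. *)
Lemma geometric_cauchy_limit (R : realType) (u : nat -> R) (C : R) :
  (forall n, `|u n.+1 - u n| <= C / 2 ^+ n) ->
  exists l, forall n, `|l - u n| <= 2 * C / 2 ^+ n.
Proof.
move=> h.
have E2 (n : nat) : C / 2 ^+ n = 2 * C / 2 ^+ n.+1.
  by rewrite exprS; field; rewrite expf_neq0.
pose a n := u n - 2 * C / 2 ^+ n.
pose b n := u n + 2 * C / 2 ^+ n.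
have D n : 2 * C / 2 ^+ n = C / 2 ^+ n + 2 * C / 2 ^+ n.+1 by rewrite -E2; ring.
have ndec : {homo a : m n / (m <= n)%N >-> m <= n}.
  apply: homo_leq; [exact: lexx|exact: le_trans|] => n.
  by have := h n; rewrite /a (D n) ler_norml => /andP[]; lra.
have ninc : {homo b : m n / (m <= n)%N >-> n <= m}.
  apply: homo_leq => [//|? ? ? ? /le_trans|n]; first exact.
  by have := h n; rewrite /b (D n) ler_norml => /andP[]; lra.
have C0 n : 0 <= C / 2 ^+ n by apply: le_trans (h n).
have ab m n : a m <= b n.
  apply: (@le_trans _ _ (a (maxn m n))); first by apply: ndec; rewrite leq_maxl.
  apply: (@le_trans _ _ (b (maxn m n))); last by apply: ninc; rewrite leq_maxr.
  by have := C0 (maxn m n); rewrite /a /b -mulrA; lra.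
have sa : has_sup (range a).
  by split; [exists (a 0%N), 0%N|exists (b 0%N) => _ [m _ <-]; exact: ab].
exists (sup (range a)) => n; rewrite ler_distl.
have := ub_le_sup sa.2 (imageT a n); rewrite {1}/a => -> /=.
apply: ge_sup; first by exists (a 0%N), 0%N.
by move=> _ [m _ <-]; exact: ab.
Qed.

(** Integration followed by an L-Lipschitz field contracts by 1/2 in the norm weighted by exp(- 2 L
    |t|). With this weight Picard iteration converges on the whole line at once, without gluing
    short intervals. *)
Lemma weighted_primitive_bound (R : realType) (u du : R -> R) (L C : R) :
  0 < L -> 0 <= C -> u 0 = 0 ->
  (forall t : R, is_derive t 1 u (du t)) ->
  (forall t, `|du t| <= L * C * expR (2 * L * `|t|)) ->
  forall t, `|u t| <= C / 2 * expR (2 * L * `|t|).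
Proof.
move=> L0 C0 u0 ud box_bottom t.
have dE (s k c : R) : is_derive s 1 (fun s => c * expR (k * s)) (c * k * expR (k * s)).
  by apply: is_derive_eq; rewrite /GRing.scale/=; ring.
have [t0|t0] := leP 0 t.
  have := @ler_norm_of_derive _ u _ du _ 0 t t0 (fun s _ => ud s)
    (fun s _ => dE s (2 * L) (C / 2)).
  rewrite u0 subr0 mulr0 expR0 mulr1 (ger0_norm t0) => h.
  apply: le_trans (h _) _; last by rewrite lerBlDr lerDl divr_ge0.
  move=> s /andP[s0 _]; apply: le_trans (box_bottom s) _; rewrite ger0_norm// le_eqVlt.
  by apply/orP; left; apply/eqP; field.
have := @ler_norm_of_derive _ u _ du _ t 0 (ltW t0) (fun s _ => ud s)
    (fun s _ => dE s (- (2 * L)) (- (C / 2))).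
rewrite u0 sub0r normrN mulr0 expR0 mulr1 (ltr0_norm t0) => h.
apply: le_trans (h _) _.
  move=> s /andP[_ s0]; apply: le_trans (box_bottom s) _; rewrite ler0_norm// le_eqVlt.
  by apply/orP; left; apply/eqP; rewrite (mulrN (2 * L)) -(mulNr (2 * L)); field.
rewrite (mulrN (2 * L)) -(mulNr (2 * L)) (mulNr (C / 2)) opprK gerDr oppr_le0.
by rewrite divr_ge0.
Qed.

(** * The Picard-Lindelof theorem *)

Section picard.
Variables (R : realType) (I : finType) (G : I -> (I -> R) -> R) (L : R).
Hypothesis L0 : 0 < L.
Hypothesis lipG : forall (x y : I -> R) (M : R), (forall j, `|x j - y j| <= M) ->
  forall i, `|G i x - G i y| <= L * M.

Lemma lipschitz_comp_continuous (x : I -> R -> R) i :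
  (forall j, continuous (x j)) -> continuous (fun t => G i (x ^~ t)).
Proof.
move=> cx t; apply/cvgrPdist_le => /= e e0.
have : \forall s \near t, forall j, `|x j t - x j s| <= e / L.
  apply: (@filter_forall _ I (fun j s => `|x j t - x j s| <= e / L) (nbhs t)) => j.
  by move/cvgrPdist_le: (cx j t); apply; rewrite divr_gt0.
apply: filterS => s /lipG /(_ i); rewrite mulrC divfK//.
by rewrite gt_eqF.
Qed.

Lemma picard_step (x0 : I -> R) (x : I -> R -> R) :
  (forall j, continuous (x j)) ->
  exists y : I -> R -> R, (forall i, y i 0 = x0 i) /\
    forall i (t : R), is_derive t 1 (y i) (G i (x ^~ t)).
Proof.
move=> cx.
have /choice[y yP] : forall i, exists y : R -> R, y 0 = x0 i /\
    forall t : R, is_derive t 1 y (G i (x ^~ t)).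
  move=> i; have [y [y0 yd]] := continuous_primitive (@lipschitz_comp_continuous x i cx).
  exists (fun t => x0 i + y t); split; first by rewrite y0 addr0.
  by move=> t; rewrite -[G i _]add0r; have := yd t => ?; apply: is_deriveD.
by exists y; split => i; have [] := yP i.
Qed.

Theorem picard_lindelof (x0 : I -> R) : exists x : I -> R -> R,
  (forall i, x i 0 = x0 i) /\
  forall i (t : R), is_derive t 1 (x i) (G i (x ^~ t)).
Proof.
pose cont (x : I -> R -> R) := forall j, continuous (x j).
(* [nx] is the Picard operator; on discontinuous arguments it is the identity. *)
have /choice[nx nxP] : forall x, exists y : I -> R -> R, cont x ->
    (forall i, y i 0 = x0 i) /\
    forall i (t : R), is_derive t 1 (y i) (G i (x ^~ t)).
  move=> x; have [cx|ncx] := pselect (cont x); last by exists x => /ncx.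
  by have [y yP] := picard_step x0 cx; exists y.
have nx_cont x : cont x -> cont (nx x).
  by move=> /nxP[_ h] j t; apply: is_derive_continuous (h j t).
pose X n := iter n nx (fun i => cst (x0 i)).
have cX n : cont (X n).
  elim: n => [|n IH]; last exact: nx_cont.
  by move=> j; exact: cst_continuous.
have X0 n i : X n i 0 = x0 i by case: n => [//|n]; exact: (nxP _ (cX n)).1.
have dX n i (t : R) : is_derive t 1 (X n.+1 i) (G i ((X n) ^~ t)).
  exact: (nxP _ (cX n)).2.
pose A := \sum_i `|G i x0|.
have AP i : `|G i x0| <= A by rewrite /A (bigD1 i)//= lerDl sumr_ge0.
have A0 : 0 <= A by rewrite sumr_ge0.
pose E (t : R) := expR (2 * L * `|t|).
have E0 t : 0 < E t by exact: expR_gt0.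
(* The first increment has derivative at most A = L (A / L), so the weighted bound with C = A / L
   gives it the size A / L / 2. *)
pose D := A / L / 2.
have D0 : 0 <= D by rewrite !divr_ge0// ltW.
have Dn (n : nat) : 0 <= 2 * D / 2 ^+ n.
  by apply: divr_ge0; [exact: mulr_ge0|exact: exprn_ge0].
have XX n i t : `|X n.+1 i t - X n i t| <= D * E t / 2 ^+ n.
  elim: n i t => [|n IH] i t.
    rewrite expr0 divr1 /D.
    apply: (@weighted_primitive_bound _ (X 1%N i - X 0%N i) (fun=> G i x0)) => //.
    - by rewrite divr_ge0// ltW.
    - by rewrite !fctE !X0 subrr.
    - move=> s; rewrite -[G i x0]subr0.
      by have := dX 0%N i s => ?; apply: is_deriveB.
    - move=> s; rewrite mulrCA mulfV ?gt_eqF// mulr1.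
      apply: le_trans (AP i) _; rewrite ler_peMr//.
      by rewrite -expR0 ler_expR mulr_ge0// mulr_ge0// ltW.
  have -> : D * E t / 2 ^+ n.+1 = D / 2 ^+ n / 2 * E t.
    by rewrite exprS; field; rewrite expf_neq0.
  apply: (@weighted_primitive_bound _ (X n.+2 i - X n.+1 i)
    (fun s => G i ((X n.+1) ^~ s) - G i ((X n) ^~ s))) => //.
  - by rewrite divr_ge0// exprn_ge0.
  - by rewrite !fctE !X0 subrr.
  - move=> s; rewrite -mulrA; apply: lipG => j.
    by apply: le_trans (IH j s) _; rewrite mulrAC.
have /choice[x xP] : forall it : I * R, exists l,
    forall n, `|l - X n it.1 it.2| <= 2 * (D * E it.2) / 2 ^+ n.
  by move=> [i t]; apply: geometric_cauchy_limit => n; exact: XX.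
pose x' i t := x (i, t).
have x'P n i t : `|x' i t - X n i t| <= 2 * D / 2 ^+ n * E t.
  by apply: le_trans (xP (i, t) n) _; rewrite /= mulrA mulrAC.
have cx : cont x'.
  move=> j t; apply/cvgrPdist_le => /= e e0.
  pose K := 2 * D * expR (2 * L * (`|t| + 1)).
  have [n nK] : exists n : nat, K / 2 ^+ n <= e / 3.
    apply: contrapT => /forallNP h.
    have : e / 3 <= 0.
      by apply: (@le0_of_geometric _ _ K) => n; have /negP := h n; rewrite -ltNge => /ltW.
    by rewrite leNgt divr_gt0.
  have KP s : `|s| <= `|t| + 1 -> `|x' j s - X n j s| <= e / 3.
    move=> st; apply: le_trans (x'P n j s) _; apply: le_trans nK.
    rewrite /K [leRHS]mulrAC ler_wpM2l//.
    by rewrite ler_expR ler_wpM2l// mulr_ge0// ltW.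
  near=> s.
  have st : `|t - s| < 1.
    by near: s; exact: (nbhsx_ballx t 1 ltr01).
  have sn : `|s| <= `|t| + 1.
    have := ler_normB t (t - s); rewrite opprB addrC subrK => /le_trans; apply.
    by rewrite lerD2l ltW.
  have h1 := KP _ sn.
  have h2 := KP t (ltac:(by rewrite lerDl)).
  have h3 : `|X n j t - X n j s| <= e / 3.
    by near: s; move/cvgrPdist_le: (cX n j t); apply; rewrite divr_gt0.
  have -> : x' j t - x' j s = (x' j t - X n j t) + (X n j t - X n j s) - (x' j s - X n j s) by ring.
  apply: le_trans (ler_normB _ _) _.
  apply: le_trans (lerD (ler_normD _ _) (lexx _)) _.
  by apply: le_trans (lerD (lerD h2 h3) h1) _; lra.
have [y0 dy] := nxP _ cx.
(* The limit is a fixed point of the Picard operator: both sides are within a geometrically small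
   distance of the same iterate. *)
suff xE i t : nx x' i t = x' i t.
  have xE' : nx x' = x' by apply/funext => i; apply/funext => t; exact: xE.
  by exists x'; rewrite -{1}xE'; split => // i t; rewrite -{1}xE'; exact: dy.
apply/eqP; rewrite -subr_eq0 -normr_le0.
apply: (@le0_of_geometric _ _ (2 * D * E t)) => n.
have -> : nx x' i t - x' i t = (nx x' i t - X n.+1 i t) - (x' i t - X n.+1 i t) by ring.
apply: le_trans (ler_normB _ _) _.
have -> : 2 * D * E t / 2 ^+ n = (2 * D / 2 ^+ n) / 2 * E t + 2 * D / 2 ^+ n.+1 * E t.
  by rewrite exprS; field; rewrite expf_neq0.
apply: lerD; last exact: x'P.
apply: (@weighted_primitive_bound _ (nx x' i - X n.+1 i)
    (fun s => G i (x' ^~ s) - G i ((X n) ^~ s))) => //.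
- by rewrite !fctE X0 y0 subrr.
- by move=> s; rewrite -mulrA; apply: lipG => j; exact: x'P.
Unshelve. all: by end_near. Qed.

End picard.

(** * Continuous dependence on the initial data *)

Lemma is_derive_bigsum (R : realType) (I : finType) (h : I -> R -> R)
    (dh : I -> R) (x : R) : (forall i, is_derive x 1 (h i) (dh i)) ->
  is_derive x 1 (fun t => \sum_i h i t) (\sum_i dh i).
Proof.
move=> dP; have -> : (fun t => \sum_i h i t) = \sum_i h i.
  by apply/funext => t; rewrite fct_sumE.
by apply: (big_rec2 (fun f d => is_derive x 1 f d)) => [|i f d _ fd];
  [exact: is_derive_cst|exact: is_deriveD].
Qed.

(** u times exp(- k t) decreases for t >= 0 and u times exp(k t) increases for t <= 0. Bounding |du|
    rather than du is what covers both directions of time. *)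
Lemma gronwall (R : realType) (u du : R -> R) (k : R) :
  (forall t : R, is_derive t 1 u (du t)) ->
  (forall t, `|du t| <= k * u t) ->
  forall t, u t <= u 0 * expR (k * `|t|).
Proof.
move=> ud box_bottom t.
have dE (c s : R) : is_derive s 1 (fun s => u s * expR (c * s))
    ((du s + c * u s) * expR (c * s)).
  have ? := ud s; apply: is_derive_eq; rewrite /GRing.scale/=; ring.
have [t0|t0] := leP 0 t.
  have := @ler_of_derive _ _ (fun=> 0) _ (fun=> 0) _ _ t0 (fun s _ => dE (- k) s).
  rewrite ger0_norm// mulr0 expR0 mulr1 subrr => h.
  rewrite -ler_pdivrMr ?expR_gt0// -expRN -mulNr -subr_le0; apply: h => // s _.
  rewrite pmulr_lle0 ?expR_gt0// mulNr subr_le0.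
  exact: le_trans (ler_norm _) (box_bottom s).
have := @ler_of_derive _ (fun=> 0) _ (fun=> 0) _ _ _ (ltW t0) _ (fun s _ => dE k s).
rewrite ltr0_norm// mulr0 expR0 mulr1 subrr => h.
rewrite -ler_pdivrMr ?expR_gt0// -expRN -mulrN opprK -subr_ge0; apply: h => // s _.
rewrite pmulr_lge0 ?expR_gt0//.
by have := box_bottom s; rewrite ler_norml => /andP[]; lra.
Qed.

Section dependence.
Variables (R : realType) (I : finType) (G : I -> (I -> R) -> R) (L : R).
Hypothesis lipG : forall (x y : I -> R) (M : R),
  (forall j, `|x j - y j| <= M) -> forall i, `|G i x - G i y| <= L * M.
Variables x y : I -> R -> R.
Hypothesis dx : forall i (t : R), is_derive t 1 (x i) (G i (x ^~ t)).
Hypothesis dy : forall i (t : R), is_derive t 1 (y i) (G i (y ^~ t)).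

(** Gronwall is applied to the sum of squares, which is differentiable where the maximum norm is
    not; passing from one to the other costs the factors #|I|. *)
Lemma solution_dist (M : R) : 0 <= M ->
  (forall i, `|x i 0 - y i 0| <= M) ->
  forall i t, `|x i t - y i t| <= #|I|%:R * M * expR (#|I|%:R * L * `|t|).
Proof.
move=> M0 xy0 i t; set n : R := #|I|%:R.
pose D t := \sum_j (x j t - y j t) ^+ 2.
pose dD t := \sum_j 2 * (x j t - y j t) * (G j (x ^~ t) - G j (y ^~ t)).
have DP (s : R) : is_derive s 1 D (dD s).
  apply: is_derive_bigsum => j; have ? := dx j s; have ? := dy j s.
  by apply: is_derive_eq; rewrite /GRing.scale/=; ring.
have D0 s : 0 <= D s by apply: sumr_ge0 => j _; exact: sqr_ge0.
have xD j s : `|x j s - y j s| <= Num.sqrt (D s).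
  rewrite -sqrtr_sqr ler_sqrt ?D0//.
  by rewrite /D (bigD1 j)//= lerDl sumr_ge0// => k _; exact: sqr_ge0.
have box_bottom : forall s, `|dD s| <= (2 * n * L) * D s.
  move=> s; apply: le_trans (ler_norm_sum _ _ _) _.
  have -> : 2 * n * L * D s = \sum_(j : I) 2 * L * D s.
    by rewrite sumr_const -mulr_natl -/n; ring.
  apply: ler_sum => j _; rewrite !normrM (ger0_norm (ler0n _ 2)).
  have := lipG (xD^~ s) j; have := xD j s; have sD := sqr_sqrtr (D0 s).
  rewrite -{3}sD; move: (Num.sqrt _) (sqrtr_ge0 (D s)) => q q0 h1 h2.
  by rewrite -!mulrA ler_pM2l// expr2 mulrCA; apply: ler_pM.
have D00 : D 0 <= (n * M) ^+ 2.
  have n2 : n <= n ^+ 2.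
    by rewrite /n -natrX ler_nat; case: #|I| => // k; rewrite leq_pmulr.
  apply: (@le_trans _ _ (n * M ^+ 2)); last first.
    by rewrite exprMn ler_wpM2r// sqr_ge0.
  have -> : n * M ^+ 2 = \sum_(j : I) M ^+ 2 by rewrite sumr_const mulr_natl.
  by apply: ler_sum => j _; rewrite -real_normK ?num_real// lerXn2r ?nnegrE.
rewrite -(@ler_pXn2r _ 2)// ?nnegrE//; last first.
  by rewrite !mulr_ge0// expR_ge0.
apply: (@le_trans _ _ (D t)).
  by rewrite -[leRHS]sqr_sqrtr// ler_pXn2r ?nnegrE ?sqrtr_ge0.
apply: le_trans (gronwall DP box_bottom t) _; rewrite [leRHS]exprMn -expRM_natl.
rewrite (_ : 2 * n * L * `|t| = 2%:R * (n * L * `|t|)); last by ring.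
by rewrite ler_wpM2r// expR_ge0.
Qed.

End dependence.

Lemma sin_lipschitz (R : realType) (x y : R) : `|sin x - sin y| <= `|x - y|.
Proof.
wlog xy : x y / x <= y.
  by move=> H; case/orP: (le_total x y) => [/H//|/H]; rewrite distrC (distrC y).
rewrite distrC (distrC x) (ger0_norm (_ : 0 <= y - x)) ?subr_ge0//.
apply: (@ler_norm_of_derive _ sin id cos (fun=> 1)) => // t _.
by rewrite cos_max.
Qed.

Lemma cos_lipschitz (R : realType) (x y : R) : `|cos x - cos y| <= `|x - y|.
Proof.
rewrite -!sinDpihalf; apply: le_trans (sin_lipschitz _ _) _.
by rewrite opprD addrACA subrr addr0.
Qed.

Lemma sinD_period (R : realType) (x : R) (m : int) :
  sin (x + m%:~R * (2 * pi)) = sin x.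
Proof.
have nat_case (y : R) (n : nat) : sin (y + n%:R * (2 * pi)) = sin y.
  rewrite (_ : n%:R * (2 * pi) = (pi *+ 2) *+ n); last first.
    by rewrite -mulrnA -[RHS]mulr_natl natrM; ring.
  by rewrite (periodicn (@sinD2pi R)).
case: m => n; first exact: nat_case.
by rewrite NegzE mulrNz mulNr -[in RHS](subrK (n.+1%:R * (2 * pi)) x) nat_case.
Qed.

Lemma cosD_period (R : realType) (x : R) (m : int) :
  cos (x + m%:~R * (2 * pi)) = cos x.
Proof. by rewrite -!sinDpihalf addrAC sinD_period. Qed.

(** * The flow of the satellite *)

Section satellite.
Variables (R : realType) (e w2 : R).
Hypothesis e1 : `|e| < 1.

Let c : R := (1 - e ^+ 2) `^ (3 / 2).

Lemma eccentricity_gt0 : 0 < 1 - e ^+ 2.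
Proof. by rewrite subr_gt0 -real_normK ?num_real// expr_lt1. Qed.

Let c_gt0 : 0 < c. Proof. by rewrite powR_gt0// eccentricity_gt0. Qed.

Let p (x : R) := 1 + e * cos x.

Let ecos_max x : `|e * cos x| <= `|e|.
Proof. by rewrite normrM ler_piMr// cos_max. Qed.

Let p_ge x : 1 - `|e| <= p x.
Proof. by have := ecos_max x; rewrite ler_norml /p => /andP[]; lra. Qed.

Let p_gt0 x : 0 < p x.
Proof. by apply: lt_le_trans (p_ge x); rewrite subr_gt0. Qed.

Let p_le2 x : p x <= 2.
Proof.
by have := ecos_max x; have := e1; rewrite ler_norml /p => ? /andP[]; lra.
Qed.

Let p_lipschitz x y : `|p x - p y| <= `|x - y|.
Proof.
rewrite /p (_ : _ - _ = e * (cos x - cos y)); last by ring.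
by rewrite normrM -[leRHS]mul1r ler_pM// ?cos_lipschitz// ltW.
Qed.

(* [None] indexes f, [Some false] indexes theta and [Some true] indexes phi *)
Let field (i : option bool) (x : option bool -> R) : R :=
  match i with
  | Some false => x (Some true)
  | Some true => - (w2 / (2 * orbital_radius e (x None) ^+ 3)) *
      sin (2 * (x (Some false) - x None))
  | None => (1 + e * cos (x None)) ^+ 2 / c
  end.

Let triple (T : Type) (a b d : T) (i : option bool) : T :=
  match i with Some false => a | Some true => b | None => d end.

Let solutionE theta phi f : is_solution e w2 theta phi f <->
  forall i (t : R), is_derive t 1 (triple theta phi f i)
    (field i ((triple theta phi f) ^~ t)).
Proof.
split=> [h [[]|] t|h t]; try by have [] := h t.
by split; [exact: (h (Some false) t)|exact: (h (Some true) t)|exact: (h None t)].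
Qed.

Let A := `|w2| / (2 * (1 - e ^+ 2) ^+ 3).
(** One term for each component of the field. In the phi component p^3 <= 8 multiplies a difference
    of sines at most 4 M, and p^3 itself varies by at most 12 M: 44 = 8 * 4 + 12. *)
Let L := 1 + 44 * A + 4 / c.

Let A_ge0 : 0 <= A.
Proof. by rewrite divr_ge0// mulr_ge0// exprn_ge0// ltW// eccentricity_gt0. Qed.

Let L_gt0 : 0 < L.
Proof.
have h : 0 <= 4 / c by rewrite divr_ge0// ltW.
by rewrite /L; have := A_ge0; lra.
Qed.

Let speed_lipschitz x y : `|p x ^+ 2 / c - p y ^+ 2 / c| <= 4 / c * `|x - y|.
Proof.
rewrite -mulrBl normrM [`|c^-1|]ger0_norm ?invr_ge0 ?(ltW c_gt0)// [leRHS]mulrAC.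
rewrite ler_pM2r ?invr_gt0// subr_sqr normrM mulrC.
apply: ler_pM => //; rewrite ger0_norm; last by rewrite addr_ge0// ltW.
by have := p_le2 x; have := p_le2 y; lra.
Qed.

Let field_lipschitz (x y : option bool -> R) (M : R) :
  (forall j, `|x j - y j| <= M) -> forall i, `|field i x - field i y| <= L * M.
Proof.
move=> xyM; have M0 : 0 <= M by apply: le_trans (xyM None).
have cM : 0 <= 4 / c * M by rewrite mulr_ge0// divr_ge0// ltW.
have A0 := A_ge0; have AM : 0 <= 44 * A * M by apply: mulr_ge0 => //; exact: mulr_ge0.
have LE : L * M = M + 44 * A * M + 4 / c * M by rewrite /L; ring.
case=> [[]|] /=.
- pose B (z : R) := - (w2 / (2 * orbital_radius e z ^+ 3)).
  rewrite -/(B _) -/(B _).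
  have BE z : B z = - (w2 / (2 * (1 - e ^+ 2) ^+ 3)) * p z ^+ 3.
    rewrite /B /orbital_radius -/(p z) expr_div_n.
    have := eccentricity_gt0; have := p_gt0 z; move: (p z) (1 - e ^+ 2) => q d q0 d0.
    by field; rewrite !gt_eqF.
  set a := x None; set b := y None; set u := sin _; set v := sin _.
  have ab : `|p a - p b| <= M by apply: le_trans (p_lipschitz _ _) (xyM None).
  have uv : `|u - v| <= 4 * M.
    apply: le_trans (sin_lipschitz _ _) _.
    rewrite (_ : _ - _ = 2 * ((x (Some false) - y (Some false)) - (a - b))); last by ring.
    rewrite normrM ger0_norm// (_ : 4 = 2 * 2 :> R); last by ring.
    rewrite -mulrA ler_pM2l//; apply: le_trans (ler_normB _ _) _.
    by have := xyM (Some false); have := xyM None; rewrite -/a -/b; lra.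
  have pab : `|p a ^+ 3 - p b ^+ 3| <= 12 * M.
    rewrite (_ : _ - _ = (p a ^+ 2 + p a * p b + p b ^+ 2) * (p a - p b)); last by ring.
    rewrite normrM ler_pM// ger0_norm; last first.
      by rewrite !addr_ge0 ?mulr_ge0 ?sqr_ge0// ltW.
    by have := p_le2 a; have := p_le2 b; have := p_gt0 a; have := p_gt0 b; nra.
  have p8 : p a ^+ 3 <= 8.
    rewrite (_ : 8 = 2 ^+ 3); last by ring.
    by rewrite lerXn2r// ?nnegrE// ltW.
  have -> : B a * u - B b * v = - (w2 / (2 * (1 - e ^+ 2) ^+ 3)) *
      (p a ^+ 3 * (u - v) + (p a ^+ 3 - p b ^+ 3) * v).
    by rewrite !BE; ring.
  rewrite normrM normrN (_ : `|w2 / _| = A); last first.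
    rewrite normrM normfV [`|2 * _|]ger0_norm// mulr_ge0// exprn_ge0//.
    exact/ltW/eccentricity_gt0.
  apply: (@le_trans _ _ (A * (44 * M))); last by rewrite LE; lra.
  apply: ler_wpM2l => //; apply: le_trans (ler_normD _ _) _.
  rewrite (normrM (p a ^+ 3)) (normrM (_ - _)).
  have -> : 44 * M = 8 * (4 * M) + 12 * M * 1 by ring.
  apply: lerD; apply: ler_pM => //; last exact: sin_max.
  by rewrite ger0_norm// exprn_ge0// ltW.
- by apply: le_trans (xyM _) _; rewrite LE; lra.
- apply: le_trans (speed_lipschitz _ _) _.
  apply: (@le_trans _ _ (4 / c * M)); last by rewrite LE; lra.
  by apply: ler_wpM2l; [rewrite divr_ge0// ltW|exact: xyM].
Qed.

Lemma solution_exists (theta0 phi0 f0 : R) : exists theta phi f,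
  [/\ is_solution e w2 theta phi f, theta 0 = theta0, phi 0 = phi0 & f 0 = f0].
Proof.
have [x [x0 dx]] := picard_lindelof L_gt0 field_lipschitz (triple theta0 phi0 f0).
exists (x (Some false)), (x (Some true)), (x None).
split; rewrite ?x0//.
Qed.

Lemma solution_dist3 theta phi f theta' phi' f' (M : R) :
  is_solution e w2 theta phi f -> is_solution e w2 theta' phi' f' -> 0 <= M ->
  `|theta 0 - theta' 0| <= M -> `|phi 0 - phi' 0| <= M -> `|f 0 - f' 0| <= M ->
  forall t, let E := 3 * M * expR (3 * L * `|t|) in
  [/\ `|theta t - theta' t| <= E, `|phi t - phi' t| <= E & `|f t - f' t| <= E].
Proof.
move=> /solutionE s /solutionE s' M0 h1 h2 h3 t E.
have := solution_dist field_lipschitz s s' M0.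
rewrite card_option card_bool -/E => h.
have h' : forall i, `|triple theta phi f i 0 - triple theta' phi' f' i 0| <= M.
  by case=> [[]|].
by split; [exact: (h h' (Some false))|exact: (h h' (Some true))|exact: (h h' None)].
Qed.

(** The equation of f involves neither theta nor phi, so a scalar Gronwall estimate suffices. This
    is why the time from f = 0 to f = 2 pi is the same for all initial points. *)
Lemma anomaly_uniq theta phi f theta' phi' f' :
  is_solution e w2 theta phi f -> is_solution e w2 theta' phi' f' ->
  f 0 = f' 0 -> f = f'.
Proof.
move=> s s' f0; apply/funext => t; apply/eqP; rewrite -subr_eq0 -sqrf_eq0.
pose du (r : R) := 2 * (f r - f' r) * (p (f r) ^+ 2 / c - p (f' r) ^+ 2 / c).
have ud (r : R) : is_derive r 1 (fun r => (f r - f' r) ^+ 2) (du r).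
  have [_ _ ?] := s r; have [_ _ ?] := s' r.
  by apply: is_derive_eq; rewrite /du /GRing.scale/= /p; ring.
have box_bottom r : `|du r| <= 8 / c * (f r - f' r) ^+ 2.
  rewrite /du normrM -[(f r - f' r) ^+ 2]real_normK ?num_real// normrM ger0_norm//.
  apply: (@le_trans _ _ (2 * `|f r - f' r| * (4 / c * `|f r - f' r|))).
    by rewrite ler_wpM2l// ?mulr_ge0// speed_lipschitz.
  by rewrite le_eqVlt; apply/orP; left; apply/eqP; ring.
have := gronwall ud box_bottom t; rewrite f0 subrr expr0n mul0r => h.
by rewrite eq_le h sqr_ge0.
Qed.

Lemma solution_shift theta phi f (k m : int) : is_solution e w2 theta phi f ->
  is_solution e w2 (fun t => theta t + k%:~R * pi) phi
    (fun t => f t + m%:~R * (2 * pi)).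
Proof.
move=> s t; have [h1 h2 h3] := s t; rewrite /orbital_radius cosD_period.
split; [by rewrite -[phi t]addr0; exact: is_deriveD| |].
  apply: is_derive_eq; rewrite /orbital_radius; congr (_ * _).
  rewrite -[LHS](sinD_period _ (k - 2 * m)); congr sin.
  by rewrite intrB intrM; ring.
by rewrite -[X in is_derive _ _ _ X]addr0; exact: is_deriveD.
Qed.

Lemma solution_time_shift theta phi f (r : R) : is_solution e w2 theta phi f ->
  is_solution e w2 (fun t => theta (t + r)) (fun t => phi (t + r))
    (fun t => f (t + r)).
Proof.
move=> s t; have [h1 h2 h3] := s (t + r).
have dE (g : R -> R) (dg : R) : is_derive (t + r) 1 g dg ->
    is_derive t 1 (fun t => g (t + r)) dg.
  move=> h; have ? : is_derive t 1 (fun t => t + r) (1 : R).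
    by rewrite -[X in is_derive _ _ _ X]addr0; apply: is_deriveD.
  by apply: is_derive_eq; rewrite mulr1.
by split; exact: dE.
Qed.

Lemma anomaly_rate theta phi f : is_solution e w2 theta phi f ->
  forall a b, a <= b -> (1 - `|e|) ^+ 2 / c * (b - a) <= f b - f a.
Proof.
move=> s a b ab; rewrite mulrBr.
apply: (@ler_of_derive _ (fun t => (1 - `|e|) ^+ 2 / c * t) f
  (fun=> (1 - `|e|) ^+ 2 / c) (fun t => p (f t) ^+ 2 / c)) => // t _.
- by apply: is_derive_eq; rewrite /GRing.scale/= mulr1.
- by have [] := s t.
- rewrite ler_pM2r ?invr_gt0// lerXn2r ?nnegrE//; last exact: ltW.
  by rewrite subr_ge0 ltW.
Qed.

Lemma anomaly_increasing theta phi f : is_solution e w2 theta phi f ->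
  {mono f : a b / a <= b}.
Proof.
move=> s a b.
have rate : 0 < (1 - `|e|) ^+ 2 / c by rewrite divr_gt0// exprn_gt0// subr_gt0.
have lt a' b' : a' < b' -> f a' < f b'.
  move=> ab; rewrite -subr_gt0; apply: lt_le_trans (anomaly_rate s (ltW ab)).
  by rewrite mulr_gt0// subr_gt0.
have [/lt h|/lt h|->] := ltgtP a b; last by rewrite lexx.
- by rewrite ltW.
- by apply/negbTE; rewrite -ltNge.
Qed.

Lemma anomaly_continuous theta phi f : is_solution e w2 theta phi f ->
  continuous f.
Proof. by move=> s t; have [_ _ /is_derive_continuous] := s t. Qed.

Lemma anomaly_surjective theta phi f : is_solution e w2 theta phi f ->
  forall y, exists t, f t = y.
Proof.
move=> s y; set rate := (1 - `|e|) ^+ 2 / c.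
have rate0 : 0 < rate by rewrite divr_gt0// exprn_gt0// subr_gt0.
pose d := `|y - f 0| / rate.
have d0 : 0 <= d by rewrite divr_ge0// ltW.
have rd : rate * d = `|y - f 0| by rewrite mulrC divfK// gt_eqF.
have [|||t _ ft] := @IVT _ f (- d) d y; last by exists t.
- by rewrite ge0_cp.
- exact/continuous_subspaceT/(anomaly_continuous s).
- have h1 := anomaly_rate s d0.
  have h2 : - d <= 0 by rewrite oppr_le0.
  have h3 := anomaly_rate s h2.
  move: h1 h3; rewrite -/rate subr0 sub0r opprK rd => h1 h3.
  rewrite ge_min le_max; have := ler_norm (y - f 0); have := ler_norm (- (y - f 0)).
  rewrite normrN => k1 k2; apply/andP; split; apply/orP; [left|right]; lra.
Qed.

Lemma period_exists : exists T, 0 < T /\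
  forall theta phi f, is_solution e w2 theta phi f -> f 0 = 0 -> f T = 2 * pi.
Proof.
have [theta [phi [f [s _ _ f0]]]] := solution_exists 0 0 0.
have [T fT] := anomaly_surjective s (2 * pi).
exists T; split; last first.
  move=> theta' phi' f' s' f'0; rewrite -fT; congr (_ T).
  by apply: (anomaly_uniq s' s); rewrite f0.
by rewrite -(leW_mono (anomaly_increasing s)) f0 fT mulr_gt0// pi_gt0.
Qed.

End satellite.

(** * The map over one period of f and the first return map *)

Lemma lipschitz_pair_continuous (R : realType) (F : R * R -> R * R) (C : R) :
  (forall z z' M, 0 <= M -> `|z.1 - z'.1| <= M -> `|z.2 - z'.2| <= M ->
    `|(F z).1 - (F z').1| <= C * M /\ `|(F z).2 - (F z').2| <= C * M) ->
  continuous F.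
Proof.
move=> h z; have C0 : 0 <= C.
  have [] := h z z 1; rewrite ?subrr ?normr0//.
  by rewrite mulr1.
apply/cvgrPdist_le => /= d d0.
have dC : 0 < d / (C + 1) by rewrite divr_gt0// ltr_wpDl.
near=> z'.
have [z1 z2] : ball z (d / (C + 1)) z' by near: z'; exact: (nbhsx_ballx z _ dC).
have [f1 f2] := h z z' _ (ltW dC) (ltW z1) (ltW z2).
have Cd : C * (d / (C + 1)) <= d.
  by rewrite mulrA ler_pdivrMr ?ltr_wpDl//; nra.
by rewrite prod_normE ge_max/= (le_trans f1)// (le_trans f2).
Unshelve. all: by end_near. Qed.

Section flow.
Variables (R : realType) (e w2 : R).

(** The period map and its inverse are both chosen from this one relation, read in the two
    directions. For |e| < 1 it is the graph of a bijection, so the default values of [xget] do not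
    occur. *)
Definition period_rel (z z' : R * R) : Prop :=
  exists theta phi f : R -> R, exists t : R,
  [/\ is_solution e w2 theta phi f, f 0 = 0, f t = 2 * pi,
      z = (theta 0, phi 0) & z' = (theta t, phi t)].

Definition period_map (z : R * R) : R * R := xget z (period_rel z).
Definition period_map_inv (z : R * R) : R * R := xget z (period_rel ^~ z).

Hypothesis e1 : `|e| < 1.

(** The Lipschitz estimate over the common period, forwards and backwards in time. With M = 0 it
    gives uniqueness and injectivity, with general M the continuity of the map and of its
    inverse. *)
Lemma period_rel_dist : exists C, forall z1 z2 z1' z2' M, 0 <= M ->
  period_rel z1 z1' -> period_rel z2 z2' ->
  (`|z1.1 - z2.1| <= M -> `|z1.2 - z2.2| <= M ->
   `|z1'.1 - z2'.1| <= C * M /\ `|z1'.2 - z2'.2| <= C * M) /\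
  (`|z1'.1 - z2'.1| <= M -> `|z1'.2 - z2'.2| <= M ->
   `|z1.1 - z2.1| <= C * M /\ `|z1.2 - z2.2| <= C * M).
Proof.
have [T [T0 TP]] := period_exists w2 e1.
have fT theta phi f t : is_solution e w2 theta phi f -> f 0 = 0 -> f t = 2 * pi ->
    t = T.
  move=> s f0; rewrite -(TP _ _ _ s f0); apply: (inc_inj (anomaly_increasing e1 s)).
have [C CP] : exists C, forall theta phi f theta' phi' f' M (r : R),
    is_solution e w2 theta phi f -> is_solution e w2 theta' phi' f' -> 0 <= M ->
    `|theta 0 - theta' 0| <= M -> `|phi 0 - phi' 0| <= M -> f 0 = f' 0 ->
    `|r| = T -> `|theta r - theta' r| <= C * M /\ `|phi r - phi' r| <= C * M.
  eexists => theta phi f theta' phi' f' M r s s' M0 h1 h2 h3 rT.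
  have h4 : `|f 0 - f' 0| <= M by rewrite h3 subrr normr0.
  have [] := solution_dist3 e1 s s' M0 h1 h2 h4 r; rewrite rT => k1 k2 _.
  by split; [apply: le_trans k1 _|apply: le_trans k2 _]; rewrite mulrAC.
exists C => z1 z2 z1' z2' M M0 [theta [phi [f [t [s f0 ft -> ->]]]]].
move=> [theta' [phi' [f' [t' [s' f0' ft' -> ->]]]]].
have tT := fT _ _ _ _ s f0 ft; have tT' := fT _ _ _ _ s' f0' ft'.
move: ft ft'; rewrite tT tT' /= => ft ft'; split=> h1 h2.
  by apply: (CP _ _ f _ _ f') => //; rewrite ?f0 ?f0' ?gtr0_norm.
(* Shifting time by T makes the end points the initial data, and the starting points are recovered
   at time -T. *)
have := CP _ _ _ _ _ _ M (- T) (solution_time_shift T s) (solution_time_shift T s') M0.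
by rewrite /= !add0r addNr ft ft' normrN (gtr0_norm T0); exact.
Qed.

Lemma period_rel_total z : exists z', period_rel z z'.
Proof.
have [T [T0 TP]] := period_exists w2 e1.
have [theta [phi [f [s h1 h2 f0]]]] := solution_exists w2 e1 z.1 z.2 0.
exists (theta T, phi T), theta, phi, f, T; split => //; first exact: TP s f0.
by rewrite h1 h2; case: z {h1 h2}.
Qed.

Lemma period_rel_surj z : exists z', period_rel z' z.
Proof.
have [T [T0 TP]] := period_exists w2 e1.
have [theta0 [phi0 [g [s0 _ _ g0]]]] := solution_exists w2 e1 0 0 0.
have [theta [phi [f [s h1 h2 f0]]]] := solution_exists w2 e1 z.1 z.2 (2 * pi).
(* Uniqueness of the anomaly makes f a time shift of g, so f vanishes at -T. *)
have gf : (fun t => g (t + T)) = f.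
  apply: (anomaly_uniq e1 (solution_time_shift T s0) s).
  by rewrite add0r f0 (TP _ _ _ s0 g0).
have fE t : f t = g (t + T) by rewrite -gf.
exists (theta (- T), phi (- T)).
exists (fun t => theta (t - T)), (fun t => phi (t - T)), (fun t => f (t - T)), T.
rewrite !add0r subrr fE addNr g0 f0; split => //; last first.
  by rewrite h1 h2; case: z {h1 h2}.
exact: (solution_time_shift (- T) s).
Qed.

Lemma period_rel_uniq z z1 z2 : period_rel z z1 -> period_rel z z2 -> z1 = z2.
Proof.
have [C CP] := period_rel_dist => r1 r2.
have [] := (CP _ _ _ _ 0 (lexx _) r1 r2).1; rewrite ?subrr ?normr0//.
rewrite mulr0 !normr_le0 !subr_eq0 => /eqP h1 /eqP h2.
by rewrite [z1]surjective_pairing h1 h2 -surjective_pairing.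
Qed.

Lemma period_rel_inj z z1 z2 : period_rel z1 z -> period_rel z2 z -> z1 = z2.
Proof.
have [C CP] := period_rel_dist => r1 r2.
have [] := (CP _ _ _ _ 0 (lexx _) r1 r2).2; rewrite ?subrr ?normr0//.
rewrite mulr0 !normr_le0 !subr_eq0 => /eqP h1 /eqP h2.
by rewrite [z1]surjective_pairing h1 h2 -surjective_pairing.
Qed.

Lemma period_mapP z : period_rel z (period_map z).
Proof. by have [z' h] := period_rel_total z; rewrite /period_map; case: xgetP => [//|/(_ z')]. Qed.

Lemma period_map_invP z : period_rel (period_map_inv z) z.
Proof.
by have [z' h] := period_rel_surj z; rewrite /period_map_inv; case: xgetP => [//|/(_ z')].
Qed.

Lemma period_map_solution theta phi f t : is_solution e w2 theta phi f ->
  f 0 = 0 -> f t = 2 * pi -> period_map (theta 0, phi 0) = (theta t, phi t).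
Proof.
move=> s f0 ft; apply: (period_rel_uniq (period_mapP _)).
by exists theta, phi, f, t.
Qed.

Lemma period_mapK : cancel period_map period_map_inv.
Proof. by move=> z; apply: (period_rel_inj (period_map_invP _) (period_mapP z)). Qed.

Lemma period_map_invK : cancel period_map_inv period_map.
Proof. by move=> z; apply: (period_rel_uniq (period_mapP _) (period_map_invP z)). Qed.

Lemma period_map_continuous : continuous period_map.
Proof.
have [C CP] := period_rel_dist.
apply: (@lipschitz_pair_continuous _ _ C) => z z' M M0.
exact: (CP _ _ _ _ M M0 (period_mapP z) (period_mapP z')).1.
Qed.

Lemma period_map_inv_continuous : continuous period_map_inv.
Proof.
have [C CP] := period_rel_dist.
apply: (@lipschitz_pair_continuous _ _ C) => z z' M M0.
exact: (CP _ _ _ _ M M0 (period_map_invP z) (period_map_invP z')).2.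
Qed.

Lemma period_mapD_pi z (k : int) :
  period_map (z.1 + k%:~R * pi, z.2) =
  ((period_map z).1 + k%:~R * pi, (period_map z).2).
Proof.
have [theta [phi [f [t [s f0 ft zE ->]]]]] := period_mapP z.
have := period_map_solution (solution_shift k 0 s).
by rewrite zE /= f0 => /(_ t); rewrite !mul0r !addr0 ft; apply.
Qed.

Lemma first_return_period_map z : first_return e w2 (to_cylinder z)
  (to_cylinder (period_map z)).
Proof.
have [theta [phi [f [t [s f0 ft zE ->]]]]] := period_mapP z.
have mono := anomaly_increasing e1 s.
exists theta, phi, f, t; split => //.
- by rewrite zE /in_section f0.
- split; last by apply/to_circle_eqP; exists 1; rewrite ft subr0 mul1r.
  by rewrite -(leW_mono mono) f0 ft mulr_gt0// pi_gt0.
- move=> r; rewrite -(leW_mono mono 0) -(leW_mono mono r) f0 ft => /andP[r0 rt] /to_circle_eqP[m].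
  have pi2 : 0 < 2 * pi :> R by rewrite mulr_gt0// pi_gt0.
  rewrite subr0 => fr; move: r0 rt; rewrite fr pmulr_lgt0//.
  by rewrite gtr_pMl// ltr0z ltrz1; case: m {fr} => -[].
Qed.

(** A witness may start at f = 2 pi m and from another representative of theta; an integer shift
    reduces it to a solution from z with f = 0. Its return time cannot exceed the time r where f = 2
    pi, as r would be an earlier return, and cannot be smaller, as f then lies strictly between 0
    and 2 pi. *)
Lemma first_return_uniq z z' : first_return e w2 (to_cylinder z) z' ->
  z' = to_cylinder (period_map z).
Proof.
move=> [theta [phi [f [t [s [zE /to_circle_eqP[m]]]]]]].
rewrite subr0 => fm [t0 /to_circle_eqP[n]]; rewrite subr0 => fn noret ->.
move: zE => [/to_circle_eqP[k thk] ph].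
have := solution_shift (- k) (- m) s.
set th := fun t => _; set g := fun t => _ => s'.
have g0 : g 0 = 0 by rewrite /g fm mulrNz mulNr subrr.
have mono := anomaly_increasing e1 s'.
have gn r (j : int) : g r = j%:~R * (2 * pi) -> in_section (f r).
  move=> gr; apply/to_circle_eqP; exists (j + m); rewrite subr0 intrD mulrDl -gr.
  by rewrite /g mulrNz; ring.
have pi2 : 0 < 2 * pi :> R by rewrite mulr_gt0// pi_gt0.
have [r gr] : exists r, g r = 2 * pi.
  have [T [T0 TP]] := period_exists w2 e1.
  by exists T; exact: TP s' g0.
have rt : r = t.
  have r0 : 0 < r by rewrite -(leW_mono mono) g0 gr.
  have gt : g t = (n - m)%:~R * (2 * pi) by rewrite /g fn mulrNz intrB; ring.
  have [rt|tr|//] := ltgtP r t.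
    by exfalso; apply: (noret r); [rewrite r0|apply: (gn r 1); rewrite gr mul1r].
  exfalso; move: t0 tr; rewrite -(leW_mono mono 0) -(leW_mono mono t) g0 gr gt.
  by rewrite pmulr_lgt0// gtr_pMl// ltr0z ltrz1; case: (n - m) => -[].
have := period_map_solution s' g0 gr.
have -> : (th 0, phi 0) = z.
  rewrite /th ph mulrNz mulNr; case: z thk {ph} => x y /= thk; congr (_, _).
  by rewrite -thk; ring.
move=> ->; rewrite rt /to_cylinder /=; congr (_, _).
by apply/to_circle_eqP; exists k; rewrite /th mulrNz; ring.
Qed.

Lemma poincare_period_map z :
  poincare e w2 (to_cylinder z) = to_cylinder (period_map z).
Proof.
rewrite /poincare; case: xgetP => [z' _ /first_return_uniq//|/(_ (to_cylinder (period_map z)))].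
by case; exact: first_return_period_map.
Qed.

End flow.

(** * Soundness of the Taylor models *)

Section evaluation.
Variable R : realType.

Fact zr_key : unit. Proof. by []. Qed.
(* locked, so that unification never expands a large integer in unary *)
Definition zr (z : Z) : R := locked_with zr_key (int_of_Z z)%:~R.

Let zrK z : zr z = (int_of_Z z)%:~R. Proof. exact: unlock. Qed.

Lemma zrD a b : zr (Z.add a b) = zr a + zr b.
Proof. by rewrite !zrK (rmorphD int_of_Z) intrD. Qed.
Lemma zrM a b : zr (Z.mul a b) = zr a * zr b.
Proof. by rewrite !zrK (rmorphM int_of_Z) intrM. Qed.
Lemma zrN a : zr (Z.opp a) = - zr a.
Proof. by rewrite !zrK (rmorphN int_of_Z) mulrNz. Qed.
Lemma zrB a b : zr (Z.sub a b) = zr a - zr b.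
Proof. by rewrite -Z.add_opp_r zrD zrN. Qed.
Lemma zr0 : zr 0 = 0. Proof. by rewrite zrK. Qed.
Lemma zr1 : zr 1 = 1. Proof. by rewrite zrK. Qed.
Lemma zr_le a b : Z.leb a b -> zr a <= zr b.
Proof. by move=> ab; rewrite !zrK ler_int; move: ab; lia. Qed.
Lemma zr_lt a b : Z.ltb a b -> zr a < zr b.
Proof. by move=> ab; rewrite !zrK ltr_int; move: ab; lia. Qed.
Lemma zr_abs a : zr (Z.abs a) = `|zr a|.
Proof.
rewrite !zrK -intr_norm; congr (_%:~R); lia.
Qed.
Let zr2 : zr 2 = 2. Proof. by rewrite zrK. Qed.
Lemma zr_xO p : zr (Z.pos (xO p)) = 2 * zr (Z.pos p).
Proof. by rewrite (_ : Z.pos (xO p) = Z.mul 2 (Z.pos p))// zrM zr2. Qed.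
Lemma zr_xI p : zr (Z.pos (xI p)) = 2 * zr (Z.pos p) + 1.
Proof. by rewrite (_ : Z.pos (xI p) = Z.add (Z.mul 2 (Z.pos p)) 1)// zrD zrM zr2 zr1. Qed.
Lemma zr_neg p : zr (Z.neg p) = - zr (Z.pos p).
Proof. by rewrite -zrN. Qed.
(** Rewriting with these rules unfolds a literal along its binary digits, after which [ring] or
    [field] can evaluate it. *)
Definition zrE := (zrD, zrM, zrB, zrN, zr0, zr_xO, zr_xI, zr_neg, zr1).

Definition peval (p : seq Z) (s : R) : R := foldr (fun a r => zr a + s * r) 0 p.
Definition beval (P : seq (seq Z)) (t s : R) : R :=
  foldr (fun p r => peval p s + t * r) 0 P.

Lemma peval_padd p q s : peval (padd p q) s = peval p s + peval q s.
Proof.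
elim: p q => [|a p IH] [|b q] /=; rewrite ?add0r ?addr0//.
by rewrite IH zrD; ring.
Qed.

Lemma peval_pscale k p s : peval (pscale k p) s = zr k * peval p s.
Proof. by elim: p => [|a p /= ->]; rewrite /= ?mulr0// zrM; ring. Qed.

Lemma peval_pmul p q s : peval (pmul p q) s = peval p s * peval q s.
Proof.
elim: p => [|a p IH]; rewrite /= ?mul0r// peval_padd peval_pscale /= IH zr0.
by ring.
Qed.

Lemma peval_norm p s : `|s| <= 1 -> `|peval p s| <= zr (pnorm p).
Proof.
move=> s1; elim: p => [|a p IH] /=; first by rewrite normr0 zr0.
rewrite zrD zr_abs (le_trans (ler_normD _ _))// lerD2l normrM.
by rewrite -[leRHS]mul1r ler_pM.
Qed.

Lemma beval_badd P Q t s : beval (badd P Q) t s = beval P t s + beval Q t s.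
Proof.
elim: P Q => [|a P IH] [|b Q] /=; rewrite ?add0r ?addr0//.
by rewrite IH peval_padd; ring.
Qed.

Lemma beval_bscale k P t s : beval (bscale k P) t s = zr k * beval P t s.
Proof.
elim: P => [|a P IH]; rewrite /= ?mulr0//.
by rewrite -/(bscale k P) IH peval_pscale; ring.
Qed.

Lemma beval_bmul P Q t s : beval (bmul P Q) t s = beval P t s * beval Q t s.
Proof.
elim: P => [|a P IH]; rewrite /= ?mul0r// beval_badd /= IH.
rewrite add0r mulrDl -mulrA; congr (_ + _).
by elim: Q {IH} => [|b Q IH] /=; rewrite ?mulr0// peval_pmul IH; ring.
Qed.

Lemma beval_norm P t s : `|t| <= 1 -> `|s| <= 1 -> `|beval P t s| <= zr (bnorm P).
Proof.
move=> t1 s1; elim: P => [|p P IH] /=; first by rewrite normr0 zr0.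
rewrite zrD (le_trans (ler_normD _ _))// lerD ?peval_norm// normrM.
by rewrite -[leRHS]mul1r ler_pM.
Qed.

Lemma beval0 P s : beval P 0 s = peval (head [::] P) s.
Proof. by case: P => [|p P] //=; rewrite mul0r addr0. Qed.

Lemma beval1 P s : beval P 1 s = peval (bsum P) s.
Proof. by elim: P => [|p P IH] //=; rewrite IH peval_padd mul1r. Qed.

Fixpoint dval (P : seq (seq Z)) (t s : R) : R :=
  if P is _ :: P' then beval P' t s + t * dval P' t s else 0.

Let is_derive_dval P (t s : R) : is_derive t 1 (fun t => beval P t s) (dval P t s).
Proof.
elim: P => [|p P IH] /=; first exact: is_derive_cst.
by apply: is_derive_eq; rewrite /GRing.scale/=; ring.
Qed.

Let beval_bderiv_from k P t s :
  beval (bderiv_from k P) t s = zr k * beval P t s + t * dval P t s.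
Proof.
elim: P k => [|p P IH] k /=; first by rewrite !mulr0 addr0.
by rewrite peval_pscale IH zrD zr1; ring.
Qed.

Lemma is_derive_beval P (t s : R) :
  is_derive t 1 (fun t => beval P t s) (beval (bderiv P) t s).
Proof.
rewrite /bderiv beval_bderiv_from zr1 mul1r; have := is_derive_dval P t s.
by case: P => [|p P] //=; rewrite mulr0 addr0.
Qed.

Lemma same_peval p q s : same p q -> peval p s = peval q s.
Proof.
rewrite /same => pq; apply/eqP; rewrite -subr_eq0.
have h : forall r, Z.leb (pnorm r) 0 -> peval r s = 0.
  have n0 r : Z.leb 0 (pnorm r) by elim: r => [//|a r IH] /=; lia.
  elim=> [//|a r IH] /= ar; have := n0 r => r0.
  have -> : a = Z0 by lia.
  by rewrite IH ?zr0 ?mulr0 ?addr0//; lia.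
by have := h _ pq; rewrite peval_padd peval_pscale zr_neg zr1 mulN1r => ->.
Qed.

(** The point (c, v) is within Euclidean distance r of B (cos y, sin y): the left side pairs their
    difference with the unit vector of angle psi. This form is linear in (c, v) and can be
    differentiated, unlike the norm. *)
Definition near_circle (B c v y r : R) :=
  forall psi, c * cos psi + v * sin psi - B * cos (y - psi) <= r.

(* Rotating the frame by the angle y cancels the drift, so that only the
   defect (dc + v dy, dv - c dy) moves the point away from the circle. *)
Lemma near_circle_rotation (B r rho : R) (c v y dc dv dy : R -> R) :
  (forall t : R, 0 <= t <= 1 -> is_derive t 1 c (dc t)) ->
  (forall t : R, 0 <= t <= 1 -> is_derive t 1 v (dv t)) ->
  (forall t : R, 0 <= t <= 1 -> is_derive t 1 y (dy t)) ->
  (forall t, 0 <= t <= 1 -> `|dc t + v t * dy t| + `|dv t - c t * dy t| <= rho) ->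
  near_circle B (c 0) (v 0) (y 0) r ->
  forall t, 0 <= t <= 1 -> near_circle B (c t) (v t) (y t) (r + rho).
Proof.
move=> hc hv hy hd near t /andP[t0 t1] psi.
pose a (u : R) := y u - y t + psi.
pose g u := c u * cos (a u) + v u * sin (a u).
pose dg u := (dc u + v u * dy u) * cos (a u) + (dv u - c u * dy u) * sin (a u).
have in01 u : 0 <= u <= t -> 0 <= u <= 1.
  by move=> /andP[-> ut]; rewrite (le_trans ut).
have rho0 : 0 <= rho.
  by apply: le_trans (hd 0 _); rewrite ?addr_ge0// lexx ler01.
have := @ler_of_derive _ g (fun u => rho * u) dg (fun=> rho) 0 t t0.
rewrite mulr0 subr0 => /(_ _ _ _)/wrap[|||H].
- move=> u /in01 u1; have ? := hc _ u1; have ? := hv _ u1; have ? := hy _ u1.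
  rewrite /g /dg /a; apply: is_derive_eq; rewrite /GRing.scale/=; ring.
- by move=> u _; apply: is_derive_eq; rewrite /GRing.scale/= mulr1.
- move=> u /in01 /hd; apply: le_trans; apply: le_trans (ler_norm _) _.
  rewrite (le_trans (ler_normD _ _))// !normrM.
  by rewrite lerD// -[leRHS]mulr1 ler_pM// ?cos_max ?sin_max.
have := near (a 0); rewrite {2}/a opprD opprB addrA addrCA subrr addr0 => Hn.
have gt : g t = c t * cos psi + v t * sin psi by rewrite /g /a subrr add0r.
have rt : rho * t <= rho by rewrite ler_piMr.
rewrite -gt.
move: Hn H rt; rewrite -/(g 0); lra.
Qed.

Lemma near_circle_cos B c v y r : near_circle B c v y r -> `|c - B * cos y| <= r.
Proof.
move=> h; have := h 0; have := h pi; rewrite cos0 sin0 cospi sinpi subr0.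
have -> : cos (y - pi) = - cos y by rewrite cosB cospi sinpi; ring.
by rewrite ler_norml; lra.
Qed.

Lemma near_circle_sin B c v y r : near_circle B c v y r -> `|v - B * sin y| <= r.
Proof.
move=> h; have := h (pi / 2); have := h (- (pi / 2)).
rewrite opprK cosN sinN cosDpihalf cosBpihalf cos_pihalf sin_pihalf.
by rewrite ler_norml; lra.
Qed.

Lemma rot_defect_le C Y dX t s : `|t| <= 1 -> `|s| <= 1 ->
  `|zr one * beval (bderiv C) t s + beval Y t s * beval dX t s| +
  `|zr one * beval (bderiv Y) t s - beval C t s * beval dX t s|
    <= zr (rot_defect C Y dX).
Proof.
move=> t1 s1; rewrite zrD; apply: lerD; apply: le_trans (beval_norm _ t1 s1).
  by rewrite beval_badd beval_bscale beval_bmul.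
by rewrite beval_badd !beval_bscale beval_bmul zr_neg zr1 mulN1r.
Qed.

Lemma zr_pow10 (n : nat) : zr (Z.pow 10 (Z.of_nat n)) = 10 ^+ n.
Proof.
elim: n => [|n IH]; first by rewrite Z.pow_0_r zr1.
rewrite Nat2Z.inj_succ Z.pow_succ_r; last exact: Nat2Z.is_nonneg.
by rewrite zrM IH exprS; congr (_ * _); rewrite !zrE; ring.
Qed.

End evaluation.

(** * Propagation of the errors of X and V along an arc *)

Lemma EVT_norm (R : realType) (u : R -> R) (a b : R) : a <= b ->
  (forall t, a <= t <= b -> {for t, continuous u}) ->
  exists2 t, a <= t <= b & forall r, a <= r <= b -> `|u r| <= `|u t|.
Proof.
move=> ab cu; have [|c] := @EVT_max _ (fun t => `|u t|) a b ab.
  apply: continuous_in_subspaceT => t; rewrite inE/= in_itv/= => /cu ct.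
  exact: (continuous_comp ct (@norm_continuous _ _ _)).
by rewrite in_itv/= => cab h; exists c.
Qed.

(* The suprema n of |a| and m of |b| satisfy n <= a0 + k1 m + p1 and
   m <= b0 + k2 n + p2, and k1 k2 < 1 makes (A, D) an upper bound. *)
Lemma coupled_bound (R : realType) (a b tau da db dtau : R -> R)
  (t0 t1 k1 k2 p1 p2 a0 b0 A D : R) : t0 <= t1 ->
  (forall t, t0 <= t <= t1 -> is_derive t 1 a (da t)) ->
  (forall t, t0 <= t <= t1 -> is_derive t 1 b (db t)) ->
  (forall t, t0 <= t <= t1 -> is_derive t 1 tau (dtau t)) ->
  (forall t, t0 <= t <= t1 -> 0 <= dtau t) ->
  tau t0 = 0 -> tau t1 <= 1 -> 0 <= k1 -> 0 <= k2 -> k1 * k2 < 1 ->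
  0 <= p1 -> 0 <= p2 ->
  (forall t, t0 <= t <= t1 -> `|da t| <= dtau t * (k1 * `|b t| + p1)) ->
  (forall t, t0 <= t <= t1 -> `|db t| <= dtau t * (k2 * `|a t| + p2)) ->
  `|a t0| <= a0 -> `|b t0| <= b0 ->
  a0 + (k1 * D + p1) <= A -> b0 + (k2 * A + p2) <= D ->
  `|a t1| <= A /\ `|b t1| <= D.
Proof.
move=> t01 ha hb ht dt0 tau0 tau1 k10 k20 k12 p10 p20 hda hdb ha0 hb0 hA hD.
have [ta ta1 amax] := EVT_norm t01 (fun t h => is_derive_continuous (ha t h)).
have [tb tb1 bmax] := EVT_norm t01 (fun t h => is_derive_continuous (hb t h)).
have grow (u du : R -> R) (C t : R) : t0 <= t <= t1 -> 0 <= C ->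
    (forall r, t0 <= r <= t1 -> is_derive r 1 u (du r)) ->
    (forall r, t0 <= r <= t1 -> `|du r| <= dtau r * C) ->
    `|u t| <= `|u t0| + C.
  move=> /andP[t0t tt1] C0 hu hdu.
  have sub r : t0 <= r <= t -> t0 <= r <= t1.
    by move=> /andP[-> rt]; rewrite (le_trans rt).
  have := @ler_norm_of_derive _ u (fun r => tau r * C) du (fun r => dtau r * C)
    t0 t t0t (fun r h => hu r (sub r h)).
  rewrite tau0 mul0r subr0 => /(_ _ _)/wrap[||h].
  - move=> r /sub h; have ? := ht r h.
    by apply: is_derive_eq; rewrite /GRing.scale/=; ring.
  - by move=> r /sub; exact: hdu.
  have taut : tau t <= 1.
    apply: le_trans tau1; rewrite -subr_ge0 -(subrr 0).
    apply: (@ler_of_derive _ (fun=> 0) tau (fun=> 0) dtau t t1 tt1).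
    - by move=> r /andP[tr rt1]; apply: ht; rewrite rt1 (le_trans t0t).
    - by move=> r /andP[tr rt1]; apply: dt0; rewrite rt1 (le_trans t0t).
  have : `|u t| <= `|u t0| + `|u t - u t0|.
    by rewrite -{1}[u t](subrKC (u t0)) ler_normD.
  by move/le_trans; apply; rewrite lerD2l (le_trans h)// ler_piMl.
have nE : `|a ta| <= a0 + (k1 * `|b tb| + p1).
  rewrite (le_trans (grow a da (k1 * `|b tb| + p1) ta ta1 _ ha _))// ?lerD2r//.
    by rewrite addr_ge0// mulr_ge0.
  move=> r hr; rewrite (le_trans (hda r hr))// ler_wpM2l ?dt0// lerD2r.
  by rewrite ler_wpM2l// bmax.
have mE : `|b tb| <= b0 + (k2 * `|a ta| + p2).
  rewrite (le_trans (grow b db (k2 * `|a ta| + p2) tb tb1 _ hb _))// ?lerD2r//.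
    by rewrite addr_ge0// mulr_ge0.
  move=> r hr; rewrite (le_trans (hdb r hr))// ler_wpM2l ?dt0// lerD2r.
  by rewrite ler_wpM2l// amax.
have t1in : t0 <= t1 <= t1 by rewrite t01 lexx.
have nA : `|a ta| <= A.
  have h1 : `|a ta| - A <= k1 * (`|b tb| - D) by rewrite mulrBr; lra.
  have h2 : k1 * (`|b tb| - D) <= k1 * (k2 * (`|a ta| - A)).
    by apply: ler_wpM2l => //; rewrite mulrBr; lra.
  rewrite -subr_le0 leNgt; apply/negP => pos.
  have := le_trans h1 h2; rewrite mulrA leNgt => /negP; apply.
  by rewrite gtr_pMl.
have mD : `|b tb| <= D.
  apply: le_trans mE _; apply: le_trans hD; rewrite lerD2l lerD2r.
  exact: ler_wpM2l.
by split; [apply: le_trans nA; apply: amax|apply: le_trans mD; apply: bmax].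
Qed.

Section pendulum.
Variable R : realType.

(** [g] is the speed of f in the original time. Keeping it general avoids reparametrising solutions
    by f; in the estimates the local time of an arc is an affine function of f. *)
Definition pendulum (X V f g : R -> R) := forall t : R,
  [/\ 0 <= g t, is_derive t 1 f (g t),
      is_derive t 1 X (g t * (V t / (1 + cos (f t) / 10) ^+ 2 - 2)) &
      is_derive t 1 V
        (g t * (79 / 100 * (1 + cos (f t) / 10) * sin (X t)))].

(** After multiplication by q^2 >= 81/100 the defect is polynomial. The constant 23 comes from
    replacing the true cosine by its model inside the square: |20 B + c + B cf| <= 23 B, because |c|
    <= 2 B. *)
Lemma position_defect (B h q v w dx c cf ec nx r1 b : R) : 0 < B -> 0 < h ->
  q = 1 + cf / 10 -> `|cf| <= 1 -> `|c - B * cf| <= ec -> ec <= B ->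
  `|dx + 2 * h| <= nx ->
  `|(10 * B + c) ^+ 2 * (dx + 2 * h) - 100 * B * h * w| <= r1 ->
  b = B * v - w ->
  `|h * (v / q ^+ 2 - 2) - dx| <=
    100 * h / (81 * B) * `|b| + (r1 + 23 * B * ec * nx) / (81 * B ^+ 2).
Proof.
move=> B0 h0 qE cf1 hc ecB hnx hr bE.
have q9 : 9 / 10 <= q by move: cf1; rewrite qE ler_norml; lra.
have q0 : 0 < q by lra.
set N := h * v - q ^+ 2 * (dx + 2 * h).
have -> : h * (v / q ^+ 2 - 2) - dx = N / q ^+ 2.
  by rewrite /N; field; rewrite gt_eqF.
have hN : 100 * B ^+ 2 * `|N| <= 100 * B * h * `|b| + (r1 + 23 * B * ec * nx).
  have -> : 100 * B ^+ 2 * `|N| = `|100 * B ^+ 2 * N|.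
    by rewrite normrM [`|100 * _|]ger0_norm// mulr_ge0// sqr_ge0.
  set R1 := (10 * B + c) ^+ 2 * (dx + 2 * h) - 100 * B * h * w in hr.
  have -> : 100 * B ^+ 2 * N = 100 * B * h * b - R1 +
      (c - B * cf) * (20 * B + c + B * cf) * (dx + 2 * h).
    by rewrite /N /R1 bE qE; field.
  apply: le_trans (ler_normD _ _) _; rewrite addrA; apply: lerD.
    apply: le_trans (ler_normB _ _) _; apply: lerD => //.
    by rewrite normrM ger0_norm//; apply: mulr_ge0; [apply: mulr_ge0|]; rewrite ?ltW.
  rewrite !normrM (_ : 23 * B * ec * nx = ec * (23 * B) * nx); last by ring.
  apply: ler_pM => //.
  apply: ler_pM => //; rewrite ler_norml.
  have : `|B * cf| <= B by rewrite normrM gtr0_norm// ler_piMr// ltW.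
  by move: hc; rewrite !ler_norml; lra.
rewrite normrM normfV (ger0_norm (sqr_ge0 q)).
apply: (@le_trans _ _ (`|N| * (100 / 81))).
  rewrite ler_wpM2l// -[100 / 81]invrK lef_pV2 ?posrE ?exprn_gt0 ?invr_gt0//.
  by nra.
rewrite -(@ler_pM2l _ (81 * B ^+ 2)) ?mulr_gt0 ?exprn_gt0//.
rewrite (_ : 81 * B ^+ 2 * (`|N| * (100 / 81)) = 100 * B ^+ 2 * `|N|); last by field.
rewrite (_ : 81 * B ^+ 2 * _ = 100 * B * h * `|b| + (r1 + 23 * B * ec * nx))//.
by field; rewrite gt_eqF.
Qed.

(** The model u is close to the sine of the model angle x / B, and the Lipschitz property of the
    sine carries this to the true angle at the cost of [a]. The factor 10 B + B cf is at most 11 B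
    and |u| at most 2 B. *)
Lemma velocity_defect (B h q dw c cf u sx x a ec ey r2 : R) : 0 < B -> 0 < h ->
  q = 1 + cf / 10 -> `|cf| <= 1 -> `|c - B * cf| <= ec ->
  `|u - B * sin (x / B)| <= ey -> ey <= B -> a = B * sx - x ->
  `|1000 * B ^+ 2 * dw - 79 * h * ((10 * B + c) * u)| <= r2 ->
  `|h * (79 / 100 * q * sin sx) - dw| <= 869 * h / (1000 * B) * `|a| +
    (r2 + B * h * (869 * ey + 158 * ec)) / (1000 * B ^+ 2).
Proof.
move=> B0 h0 qE cf1 hc hu eyB aE hr.
have hB : `|B * cf| <= B by rewrite normrM gtr0_norm// ler_piMr// ltW.
have hsin : `|B * sin sx - u| <= `|a| + ey.
  rewrite (_ : _ - u = (B * sin sx - B * sin (x / B)) + (B * sin (x / B) - u));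
    last by ring.
  rewrite (le_trans (ler_normD _ _))// lerD//; last by rewrite distrC.
  rewrite -mulrBr normrM gtr0_norm//.
  apply: (@le_trans _ _ (B * `|sx - x / B|)).
    by rewrite ler_pM2l// sin_lipschitz.
  rewrite -{1}(gtr0_norm B0) -normrM aE le_eqVlt; apply/orP; left; apply/eqP.
  by congr (`|_|); field; rewrite gt_eqF.
have u2 : `|u| <= 2 * B.
  have : `|B * sin (x / B)| <= B.
    by rewrite normrM gtr0_norm// ler_piMr ?sin_max// ltW.
  by move: hu; rewrite !ler_norml; lra.
set R2 := 1000 * B ^+ 2 * dw - 79 * h * ((10 * B + c) * u) in hr.
have B2 : 0 < 1000 * B ^+ 2 by rewrite mulr_gt0 ?ltr0n// exprn_gt0.
rewrite -(ler_pM2l B2).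
rewrite (_ : 1000 * B ^+ 2 * (_ + _) = 869 * B * h * `|a| +
   (r2 + B * h * (869 * ey + 158 * ec))); last first.
  by field; rewrite gt_eqF.
have -> : 1000 * B ^+ 2 * `|h * (79 / 100 * q * sin sx) - dw| =
    `|1000 * B ^+ 2 * (h * (79 / 100 * q * sin sx) - dw)|.
  by rewrite normrM (gtr0_norm B2).
have -> : 1000 * B ^+ 2 * (h * (79 / 100 * q * sin sx) - dw) =
    79 * h * ((10 * B + B * cf) * (B * sin sx - u) - (c - B * cf) * u) - R2.
  by rewrite /R2 qE; field.
rewrite (le_trans (ler_normB _ _))// addrCA addrC lerD//.
rewrite normrM [`|79 * h|]ger0_norm ?mulr_ge0 ?(ltW h0)//.
apply: (@le_trans _ _ (79 * h * (11 * B * (`|a| + ey) + ec * (2 * B)))); last first.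
  by rewrite le_eqVlt; apply/orP; left; apply/eqP; ring.
rewrite ler_wpM2l ?mulr_ge0 ?(ltW h0)// (le_trans (ler_normB _ _))//.
rewrite lerD// normrM ler_pM//.
by move: hB; rewrite !ler_norml; lra.
Qed.

Lemma pendulum_arc_error (X V f g c u x w dx dw : R -> R)
    (t0 t1 B h ec ey nx r1 r2 eX eV EX EV : R) :
  pendulum X V f g -> t0 <= t1 -> 0 < B -> 0 < h -> 2 * h <= B ->
  f t1 = f t0 + h / B ->
  (forall r : R, is_derive r 1 x (dx r)) ->
  (forall r : R, is_derive r 1 w (dw r)) ->
  (forall r, 0 <= r <= 1 -> `|c r - B * cos (f t0 + h / B * r)| <= ec) ->
  (forall r, 0 <= r <= 1 -> `|u r - B * sin (x r / B)| <= ey) ->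
  ec <= B -> ey <= B ->
  (forall r, 0 <= r <= 1 -> `|dx r + 2 * h| <= nx) ->
  (forall r, 0 <= r <= 1 ->
    `|(10 * B + c r) ^+ 2 * (dx r + 2 * h) - 100 * B * h * w r| <= r1) ->
  (forall r, 0 <= r <= 1 ->
    `|1000 * B ^+ 2 * dw r - 79 * h * ((10 * B + c r) * u r)| <= r2) ->
  `|B * X t0 - x 0| <= eX -> `|B * V t0 - w 0| <= eV ->
  100 * B * h * EV + (r1 + 23 * B * ec * nx) <= 81 * B ^+ 2 * (EX - eX) ->
  869 * B * h * EX + (r2 + B * h * (869 * ey + 158 * ec))
    <= 1000 * B ^+ 2 * (EV - eV) ->
  `|B * X t1 - x 1| <= EX /\ `|B * V t1 - w 1| <= EV.
Proof.
move=> pend t01 B0 h0 hB ft1 hx hw hc hu ecB eyB hnx hr1 hr2 hX hV hEX hEV.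
pose tau t := (f t - f t0) * (B / h).
have Bh : 0 < B / h by rewrite divr_gt0.
have B0' := ltW B0; have h0' := ltW h0; have Bh' := ltW Bh.
have n0 (n : nat) : 0 <= n%:R :> R by rewrite ler0n.
have B2 : 0 < B ^+ 2 by rewrite exprn_gt0.
have tau0 : tau t0 = 0 by rewrite /tau subrr mul0r.
have tau1 : tau t1 = 1.
  by rewrite /tau ft1; field; rewrite !gt_eqF.
have fmono a b : a <= b -> f a <= f b.
  move=> ab; rewrite -subr_ge0 -(subrr 0).
  apply: (@ler_of_derive _ (fun=> 0) f (fun=> 0) g a b ab) => r _;
  by have [] := pend r.
have tau01 t : t0 <= t <= t1 -> 0 <= tau t <= 1.
  move=> /andP[a b]; apply/andP; split.
    by apply: mulr_ge0; [rewrite subr_ge0 fmono|exact: ltW].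
  apply: (@le_trans _ _ (tau t1)); last by rewrite tau1.
  by rewrite ler_pM2r// lerD2r fmono.
have ftau t : f t0 + h / B * tau t = f t.
  by rewrite /tau; field; rewrite !gt_eqF.
have ec0 : 0 <= ec by apply: le_trans (hc 0 _); rewrite ?lexx ?ler01.
have ey0 : 0 <= ey by apply: le_trans (hu 0 _); rewrite ?lexx ?ler01.
have nx0 : 0 <= nx by apply: le_trans (hnx 0 _); rewrite ?lexx ?ler01.
have r10 : 0 <= r1 by apply: le_trans (hr1 0 _); rewrite ?lexx ?ler01.
have r20 : 0 <= r2 by apply: le_trans (hr2 0 _); rewrite ?lexx ?ler01.
pose dtau t := g t * (B / h).
have htau (t : R) : is_derive t 1 tau (dtau t).
  have [_ ? _ _] := pend t.
  by rewrite /tau /dtau; apply: is_derive_eq; rewrite /GRing.scale/=; ring.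
have := @coupled_bound R (fun t => B * X t - x (tau t)) (fun t => B * V t - w (tau t))
  tau
  (fun t => dtau t * (h * (V t / (1 + cos (f t) / 10) ^+ 2 - 2) - dx (tau t)))
  (fun t => dtau t * (h * (79 / 100 * (1 + cos (f t) / 10) * sin (X t)) - dw (tau t)))
  dtau t0 t1 (100 * h / (81 * B)) (869 * h / (1000 * B))
  ((r1 + 23 * B * ec * nx) / (81 * B ^+ 2))
  ((r2 + B * h * (869 * ey + 158 * ec)) / (1000 * B ^+ 2)) eX eV EX EV t01.
rewrite tau0 tau1; apply.
- move=> t _; have [_ _ ? _] := pend t; have ? := htau t; have ? := hx (tau t).
  rewrite /dtau; apply: is_derive_eq; rewrite /dtau /GRing.scale/=.
  by set W := V t / _; field; rewrite gt_eqF.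
- move=> t _; have [_ _ _ ?] := pend t; have ? := htau t; have ? := hw (tau t).
  rewrite /dtau; apply: is_derive_eq; rewrite /dtau /GRing.scale/=.
  by field; rewrite gt_eqF.
- by move=> t _; have [g0 _ _ _] := pend t; exact: mulr_ge0.
- by [].
- by [].
- exact: divr_ge0 (mulr_ge0 (n0 _) h0') (mulr_ge0 (n0 _) B0').
- exact: divr_ge0 (mulr_ge0 (n0 _) h0') (mulr_ge0 (n0 _) B0').
(* Here the restriction of a step to length 1/2 is used: the product of the two coupling constants
   is then at most 1.073 / 4. *)
- have y2 : h / B <= 1 / 2 by rewrite ler_pdivrMr//; lra.
  have y0 : 0 <= h / B by exact: divr_ge0.
  rewrite (_ : _ * _ = 100 / 81 * (869 / 1000) * (h / B * (h / B))).
    by have : h / B * (h / B) <= 1 / 2 * (1 / 2); [exact: ler_pM|lra].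
  by field; rewrite gt_eqF.
- apply: divr_ge0 (mulr_ge0 (n0 _) (ltW B2)).
  exact: addr_ge0 r10 (mulr_ge0 (mulr_ge0 (mulr_ge0 (n0 _) B0') ec0) nx0).
- apply: divr_ge0 (mulr_ge0 (n0 _) (ltW B2)).
  apply: addr_ge0 r20 (mulr_ge0 (mulr_ge0 B0' h0') _).
  exact: addr_ge0 (mulr_ge0 (n0 _) ey0) (mulr_ge0 (n0 _) ec0).
- move=> t /tau01 tt; have [g0 _ _ _] := pend t.
  rewrite normrM [`|dtau t|]ger0_norm; last exact: mulr_ge0.
  apply: ler_wpM2l; first exact: mulr_ge0.
  have hct : `|c (tau t) - B * cos (f t)| <= ec by have := hc _ tt; rewrite ftau.
  exact: (@position_defect B h _ (V t) (w (tau t)) (dx (tau t)) (c (tau t))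
    (cos (f t)) ec nx r1 _ B0 h0 erefl (cos_max _) hct ecB (hnx _ tt) (hr1 _ tt) erefl).
- move=> t /tau01 tt; have [g0 _ _ _] := pend t.
  rewrite normrM [`|dtau t|]ger0_norm; last exact: mulr_ge0.
  apply: ler_wpM2l; first exact: mulr_ge0.
  have hct : `|c (tau t) - B * cos (f t)| <= ec by have := hc _ tt; rewrite ftau.
  exact: (@velocity_defect B h _ (dw (tau t)) (c (tau t)) (cos (f t)) (u (tau t))
    _ (x (tau t)) _ ec ey r2 B0 h0 erefl (cos_max _) hct (hu _ tt) eyB erefl (hr2 _ tt)).
- exact: hX.
- exact: hV.
- rewrite -lerBrDl -(@ler_pM2l _ (81 * B ^+ 2)); last first.
    by rewrite mulr_gt0 ?ltr0n// exprn_gt0.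
  by apply: le_trans hEX; rewrite le_eqVlt; apply/orP; left; apply/eqP;
    field; rewrite gt_eqF.
- rewrite -lerBrDl -(@ler_pM2l _ (1000 * B ^+ 2)); last first.
    by rewrite mulr_gt0 ?ltr0n// exprn_gt0.
  by apply: le_trans hEV; rewrite le_eqVlt; apply/orP; left; apply/eqP;
    field; rewrite gt_eqF.
Qed.
End pendulum.

(** * Soundness of a step and of a whole run *)

Section soundness.
Variable R : realType.
Local Notation zr := (@zr R).
Local Notation B := (zr one).

Lemma zr_one_gt0 : 0 < B.
Proof. by have := @zr_lt R 0 one isT; rewrite zr0. Qed.

Definition encloses (st : state) (s y X V : R) :=
  [/\ near_circle B (peval (st_c st) s) (peval (st_s st) s) y (zr (st_ec st)),
      near_circle B (peval (st_C st) s) (peval (st_Y st) s)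
        (peval (st_X st) s / B) (zr (st_eY st)),
      `|B * X - peval (st_X st) s| <= zr (st_eX st) &
      `|B * V - peval (st_V st) s| <= zr (st_eV st)].

Lemma arc_rotation (Cs Ys : seq (seq Z)) (dX : seq (seq Z)) (y : R -> R)
    (s : R) (e e' : Z) : `|s| <= 1 ->
  (forall r : R, is_derive r 1 y (beval dX r s / B)) ->
  Z.leb (Z.add (Z.mul e one) (rot_defect Cs Ys dX)) (Z.mul e' one) ->
  near_circle B (beval Cs 0 s) (beval Ys 0 s) (y 0) (zr e) ->
  forall r, 0 <= r <= 1 ->
    near_circle B (beval Cs r s) (beval Ys r s) (y r) (zr e').
Proof.
move=> s1 hy he h0 r r01.
have B0 := zr_one_gt0.
have He : zr e + zr (rot_defect Cs Ys dX) / B <= zr e'.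
  by move/(@zr_le R): he; rewrite zrD !zrM -ler_pdivrMr// mulrDl mulfK ?gt_eqF.
move=> psi; apply: le_trans He.
apply: (@near_circle_rotation R B (zr e) _ (fun r => beval Cs r s) (fun r => beval Ys r s) y
  (fun r => beval (bderiv Cs) r s) (fun r => beval (bderiv Ys) r s)
  (fun r => beval dX r s / B)) => //.
- by move=> u _; exact: is_derive_beval.
- by move=> u _; exact: is_derive_beval.
- move=> u /andP[u0 u1].
  have u1' : `|u| <= 1 by rewrite ger0_norm.
  rewrite ler_pdivlMr//; apply: le_trans (rot_defect_le Cs Ys dX u1' s1).
  have E (z : R) : `|z| * B = `|B * z| by rewrite normrM gtr0_norm// mulrC.
  have E2 (a b d : R) : B * (a + b * (d / B)) = B * a + b * d.
    by field; rewrite gt_eqF.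
  by rewrite mulrDl !E E2 -mulNr E2 mulNr.
Qed.

Lemma verify_sound (h : Z) (st st' : state) (a : arc) (s : R)
    (X V f g : R -> R) (t0 t1 : R) :
  verify h st a = Some st' -> `|s| <= 1 -> pendulum X V f g -> t0 <= t1 ->
  f t1 = f t0 + zr h / B ->
  encloses st s (f t0) (X t0) (V t0) -> encloses st' s (f t1) (X t1) (V t1).
Proof.
case: st => c sn ec x v cx sx eX eV eY; case: a => cs ss Xs Vs Cs Ys.
rewrite /verify; set dX := bderiv Xs; set dX2 := badd dX _; set q := badd _ cs.
set dc := rot_defect cs _ _; set dC := rot_defect Cs _ _.
set ec' := Z.add ec _; set eY' := Z.add eY _.
set r1 := Z.add _ (Z.mul _ (bnorm dX2)); set r2 := Z.add _ (Z.mul (Z.mul one h) _).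
set p1 := cdiv r1 _; set p2 := cdiv r2 _.
set eX' := cdiv (Z.mul (Z.add (Z.add eX p1) _) one) _.
set eV' := Z.add _ (cdiv (Z.mul _ eX') _).
case: ifP => // /andP[/andP[/andP[/andP[/andP[/andP[/andP[/andP[/andP[/andP[/andP[/andP[/andP[]]]]]]]]]]]]].
move=> Ec Es Ex Ev Ecx Esx h0 hB ecB eYB hc hC hX hV [<-] s1 pend t01 ft1.
(* From here the radii are arbitrary: only the comparisons tested by [verify] are used, not the
   formulas that proposed the values. *)
move=> [/= N1 N2 N3 N4]; clearbody eV' eX' eY' ec'.
have B0 := zr_one_gt0.
have n2 : zr 2 = 2 by rewrite !zrE; ring.
have n10 : zr 10 = 10 by rewrite !zrE; ring.
have n23 : zr 23 = 23 by rewrite !zrE; ring.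
have n79 : zr (-79) = - 79 by rewrite !zrE; ring.
have n81 : zr 81 = 81 by rewrite !zrE; ring.
have n100 : zr 100 = 100 by rewrite !zrE; ring.
have n100' : zr (-100) = - 100 by rewrite !zrE; ring.
have n158 : zr 158 = 158 by rewrite !zrE; ring.
have n869 : zr 869 = 869 by rewrite !zrE; ring.
have n1000 : zr 1000 = 1000 by rewrite !zrE; ring.
have hr0 : 0 < zr h by have := @zr_lt R 0 h h0; rewrite zr0.
have {hB} hrB : 2 * zr h <= B by move/(@zr_le R): hB; rewrite zrM n2.
have {ecB} ecB : zr ec' <= B by exact: zr_le.
have {eYB} eYB : zr eY' <= B by exact: zr_le.
have start P (p : seq Z) : same (head [::] P) p -> beval P 0 s = peval p s.
  by move=> e; rewrite (@beval0 R) (same_peval s e).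
have M1 r : 0 <= r <= 1 -> near_circle B (beval cs r s) (beval ss r s)
    (f t0 + zr h / B * r) (zr ec').
  move=> r01;
    apply: (@arc_rotation cs ss [:: [:: h]] (fun r => f t0 + zr h / B * r) s ec ec') => //.
    move=> u; rewrite /= !mulr0 !addr0; apply: is_derive_eq.
    by rewrite /GRing.scale/=; ring.
  by rewrite (start _ _ Ec) (start _ _ Es) mulr0 addr0.
have M2 r : 0 <= r <= 1 -> near_circle B (beval Cs r s) (beval Ys r s)
    (beval Xs r s / B) (zr eY').
  move=> r01; apply: (@arc_rotation Cs Ys dX (fun r => beval Xs r s / B) s eY eY') => //.
    move=> u; have ? := @is_derive_beval R Xs u s.
    by apply: is_derive_eq; rewrite /GRing.scale/= mulrC; ring.
  by rewrite (start _ _ Ecx) (start _ _ Esx) (start _ _ Ex).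
have in1 (r : R) : 0 <= r <= 1 -> `|r| <= 1 by move=> /andP[r0 r1']; rewrite ger0_norm.
have := @pendulum_arc_error R X V f g (fun r => beval cs r s) (fun r => beval Ys r s)
  (fun r => beval Xs r s) (fun r => beval Vs r s)
  (fun r => beval dX r s) (fun r => beval (bderiv Vs) r s) t0 t1 B (zr h)
  (zr ec') (zr eY') (zr (bnorm dX2))
  (zr (bnorm (badd (bmul (bmul q q) dX2) (bscale (Z.mul (Z.mul (-100) one) h) Vs))))
  (zr (bnorm (badd (bscale (Z.mul (Z.mul 1000 one) one) (bderiv Vs))
      (bscale (Z.mul (-79) h) (bmul q Ys)))))
  (zr eX) (zr eV) (zr eX') (zr eV') pend t01 B0 hr0 hrB ft1.
rewrite (start _ _ Ex) (start _ _ Ev) !(@beval1 R).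
have dX2E r : beval dX2 r s = beval dX r s + 2 * zr h.
  by rewrite /dX2 beval_badd /= zrM n2 !mulr0 !addr0.
have qE r : beval q r s = 10 * B + beval cs r s.
  by rewrite /q beval_badd /= zrM !mulr0 !addr0 n10.
case.
- by move=> r; exact: is_derive_beval.
- by move=> r; exact: is_derive_beval.
- by move=> r /M1 /near_circle_cos.
- by move=> r /M2 /near_circle_sin.
- exact: ecB.
- exact: eYB.
- by move=> r /in1 r1'; rewrite -dX2E; exact: beval_norm.
- move=> r /in1 r1'; rewrite -dX2E -qE; apply: le_trans (beval_norm _ r1' s1).
  by rewrite beval_badd !beval_bmul beval_bscale !zrM n100' expr2 !mulNr.
- move=> r /in1 r1'; rewrite -qE; apply: le_trans (beval_norm _ r1' s1).
  rewrite beval_badd !beval_bscale beval_bmul !zrM n1000 n79 expr2 !mulNr.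
  by rewrite !mulrA.
- exact: N3.
- exact: N4.
- by move/(@zr_le R): hX; rewrite /r1 !(zrB, zrD, zrM) n100 n23 n81 expr2 !mulrA.
- move/(@zr_le R): hV; rewrite /r2 !(zrB, zrD, zrM) n869 n158 n1000 expr2.
  by rewrite !mulrA.
- by move=> h1 h2; split => //=; [have := M1 1|have := M2 1];
    rewrite ?lexx ?ler01 ?mulr1 -?ft1 !(@beval1 R); apply.
Qed.

Lemma verify_gt0 (h : Z) (st st' : state) (a : arc) :
  verify h st a = Some st' -> 0 < zr h.
Proof.
case: st => c sn ec x v cx sx eX eV eY; case: a => cs ss Xs Vs Cs Ys.
rewrite /verify; case: ifP => // /andP[/andP[/andP[/andP[/andP[/andP[/andP[/andP[]]]]]]]] _.
by move=> h0 *; have := @zr_lt R 0 h h0; rewrite zr0.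
Qed.

Lemma run_sound (n d : nat) (hs : seq Z) (st st' : state) (s : R)
    (X V f g : R -> R) (t0 : R) :
  run n d hs st = Some st' -> `|s| <= 1 -> pendulum X V f g ->
  {mono f : a b / a <= b} -> (forall y, exists t, f t = y) ->
  encloses st s (f t0) (X t0) (V t0) ->
  exists2 t1, f t1 = f t0 + zr (foldr Z.add Z0 hs) / B &
    encloses st' s (f t1) (X t1) (V t1).
Proof.
move=> + s1 pend fmono fsurj; elim: hs st t0 => [|h hs IH] st t0 /=.
  by move=> [->] E; exists t0 => //; rewrite zr0 mul0r addr0.
case E : (verify _ _ _) => [st1|]// R1 E0.
have B0 := zr_one_gt0; have h0 := verify_gt0 E.
have [t1 ft1] := fsurj (f t0 + zr h / B).
have t01 : t0 <= t1 by rewrite -fmono ft1 lerDl divr_ge0// ltW.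
have [t2 ft2 E2] := IH _ t1 R1 (verify_sound E s1 pend t01 ft1 E0).
by exists t2 => //; rewrite ft2 ft1 zrD mulrDl addrA.
Qed.

Lemma init_sound (n d : nat) (X0 V0 : seq Z) (e : Z) (st : state) (s X V : R) :
  init n d X0 V0 e = Some st -> `|s| <= 1 ->
  `|B * X - peval X0 s| <= zr e -> `|B * V - peval V0 s| <= zr e ->
  encloses st s 0 X V.
Proof.
rewrite /init; case: gen_rot => Ys Cs.
set dC := rot_defect _ _ _; set eY := cdiv _ _; clearbody eY.
case: ifP => // /andP[/andP[Ec Es] hC] [<-] s1 hX hV.
have B0 := zr_one_gt0.
split => //=.
  by move=> psi; rewrite !zr0 !mulr0 !addr0 mul0r sub0r cosN addr0 subrr.
have start P (p : seq Z) : same (head [::] P) p -> beval P 0 s = peval p s.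
  by move=> h; rewrite (@beval0 R) (same_peval s h).
have := @arc_rotation Cs Ys [:: X0] (fun r => peval X0 s / B * r) s Z0 eY s1 _ hC.
rewrite (start _ _ Ec) (start _ _ Es) /= !mulr0 !addr0 => /(_ _ _)/wrap[|psi|].
- by move=> u; apply: is_derive_eq; rewrite /GRing.scale/= mulr0 mulr1 addr0.
- by rewrite zr0 mul0r sub0r cosN addr0 subrr.
by move=> /(_ 1); rewrite lexx ler01 mulr1 !(@beval1 R); exact.
Qed.
End soundness.

(** * Bounds for pi and for (1 - e^2)^(3/2), and the change of variables *)

Section enclosure.
Variable R : realType.
Local Notation zr := (@zr R).
Local Notation B := (zr one).

Lemma cos_range_sound n h lo hi : cos_range n h = Some (lo, hi) ->
  zr lo <= B * cos (zr h / B) <= zr hi.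
Proof.
rewrite /cos_range; case: gen_cs => cs ss.
set Cs := [seq _ | _ <- cs]; set Ss := [seq _ | _ <- ss].
set d := rot_defect _ _ _; set e := cdiv _ _; clearbody e.
set c := head _ (bsum _); clearbody c.
case: ifP => // /andP[/andP[/andP[Ec Es] hd] Ecc] [<- <-].
have B0 := zr_one_gt0 R.
have hy (u : R) : is_derive u 1 (fun r => zr h / B * r) (beval [:: [:: h]] u 0 / B).
  rewrite /= !mulr0 !addr0; apply: is_derive_eq.
  by rewrite /GRing.scale/=; ring.
have h0 : near_circle B (beval Cs 0 0) (beval Ss 0 0) (zr h / B * 0) (zr Z0).
  rewrite !beval0 (same_peval _ Ec) (same_peval _ Es) /= !mulr0 addr0.
  by move=> psi; rewrite zr0 mul0r sub0r cosN addr0 subrr.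
have n0 : `|0 : R| <= 1 by rewrite normr0.
have in1 : 0 <= (1 : R) <= (1 : R) by rewrite ler01 lexx.
have {}hd : Z.leb (Z.add (Z.mul Z0 one) d) (Z.mul e one) by [].
have /near_circle_cos := arc_rotation n0 hy hd h0 in1.
rewrite !beval1 (same_peval _ Ecc) /= mulr1 mul0r addr0.
by rewrite zrB zrD distrC ler_distl.
Qed.

Lemma pihalf_bounds (a b : R) : 0 <= a -> a <= 2 -> 0 <= b -> 0 < cos a ->
  cos b < 0 -> a < pi / 2 < b.
Proof.
move=> a0 a2 b0 h1 h2; have pi2 := @pi_ge2 R; apply/andP; split.
  rewrite ltNge; apply/negP => pa; move: h1; rewrite ltNge => /negP; apply.
  have i1 : a \in `[0, pi] by rewrite in_itv/= a0/=; lra.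
  have i2 : pi / 2 \in `[0, pi : R] by rewrite in_itv/=; apply/andP; split; lra.
  by rewrite -cos_pihalf leNgt (ltr_cos i1 i2) -leNgt.
rewrite ltNge; apply/negP => pb; move: h2; rewrite ltNge => /negP; apply.
by apply: cos_ge0_pihalf; rewrite pb andbT; lra.
Qed.

Lemma zr_oneE : B = 1073741824%:R.
Proof. by rewrite /one !zrE; ring. Qed.

Lemma cos_signs : 0 < cos (zr 1686629363 / B) /\ cos (zr 1686630435 / B) < 0.
Proof.
have B0 := zr_one_gt0 R; have [E1 E2] := cos_range_pihalf; split.
  have /andP[+ _] := cos_range_sound E1; rewrite -(pmulr_rgt0 _ B0).
  by apply: lt_le_trans; rewrite -zr0; exact: zr_lt.
have /andP[_] := cos_range_sound E2; rewrite -(pmulr_rlt0 _ B0).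
by move=> /le_lt_trans; apply; rewrite -zr0; exact: zr_lt.
Qed.

Let pi_bounds_of (u w : R) :
  u = 1686629363%:R / 1073741824%:R -> w = 1686630435%:R / 1073741824%:R ->
  0 < cos u -> cos w < 0 ->
  3141592%:R / 10 ^+ 6 < pi :> R /\ pi < 3141594%:R / 10 ^+ 6 :> R.
Proof.
move=> uE wE hu hw.
have u0 : 0 <= u by rewrite uE; lra.
have u2 : u <= 2 by rewrite uE; lra.
have w0 : 0 <= w by rewrite wE; lra.
have /andP[] := pihalf_bounds u0 u2 w0 hu hw.
by clear -uE wE; move=> h1 h2; rewrite uE in h1; rewrite wE in h2; split; lra.
Qed.

Lemma pi_bounds : 3141592%:R / 10 ^+ 6 < pi :> R /\ pi < 3141594%:R / 10 ^+ 6 :> R.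
Proof.
have [hu hw] := cos_signs; apply: pi_bounds_of hu hw.
  by rewrite zr_oneE !zrE; congr (_ / _); ring.
by rewrite zr_oneE !zrE; congr (_ / _); ring.
Qed.

Let K : R := (1 - (1 / 10) ^+ 2) `^ (3 / 2).

Lemma period_scale_sqr : K ^+ 2 = 970299%:R / 10 ^+ 6.
Proof.
have h : (1 - (1 / 10) ^+ 2 : R) = 99 / 100 by field.
rewrite /K h -powR_mulrn ?powR_ge0// -powRrM.
rewrite (_ : 3 / 2 * 2%:R = 3%:R); last by field.
by rewrite powR_mulrn; [field|lra].
Qed.

Lemma period_scale_gt0 : 0 < K.
Proof. by rewrite powR_gt0//; lra. Qed.

Lemma period_scale_bounds :
  985037562735553%:R / 10 ^+ 15 <= K <= 985037562735554%:R / 10 ^+ 15.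
Proof.
have K0 := period_scale_gt0; have K2 := period_scale_sqr.
have sq (a : R) : 0 <= a -> (a * a <= 970299%:R / 10 ^+ 6 -> a <= K) /\
    (970299%:R / 10 ^+ 6 <= a * a -> K <= a).
  move=> a0; rewrite -K2 expr2; have K0' := ltW K0.
  by split=> h; rewrite leNgt; apply/negP => h'; move: h; rewrite leNgt => /negP; apply;
    apply: ltr_pM.
apply/andP; split; [apply: (sq _ _).1|apply: (sq _ _).2].
- by lra.
- by lra.
- by lra.
- by lra.
Qed.

(** Measuring theta from pi / 2 reverses the sign of the sine. The cube of the radius contributes (1
    - e^2)^3 = K^2, which cancels the K in V and the one in the speed of f, so in the variable f all
    coefficients are rational. *)
Lemma solution_pendulum (theta phi f : R -> R) :
  is_solution (1 / 10) (79 / 100) theta phi f ->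
  pendulum (fun t => 2 * (theta t - pi / 2 - f t)) (fun t => 2 * K * phi t) f
    (fun t => (1 + cos (f t) / 10) ^+ 2 / K).
Proof.
move=> s t; have [h1 h2 h3] := s t.
have K0 := period_scale_gt0; have K2 := period_scale_sqr.
set q := 1 + cos (f t) / 10.
have q0 : 0 < q by have := cos_geN1 (f t); rewrite /q; lra.
have qE : 1 + 1 / 10 * cos (f t) = q by rewrite /q; field.
split.
- by rewrite divr_ge0 ?sqr_ge0 ?ltW.
- by apply: is_derive_eq; rewrite qE.
- apply: is_derive_eq; rewrite /GRing.scale/= qE -/K.
  by field; rewrite !gt_eqF.
- apply: is_derive_eq; rewrite /GRing.scale/= /orbital_radius qE.
  have -> : sin (2 * (theta t - f t)) = - sin (2 * (theta t - pi / 2 - f t)).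
    rewrite -sinDpi; congr sin; by field.
  set S := sin _.
  have -> : q ^+ 2 / K = q ^+ 2 * K / (970299%:R / 10 ^+ 6).
    by rewrite -K2; field; rewrite gt_eqF.
  by field; rewrite !gt_eqF.
Qed.
End enclosure.

(** * From the final state of a run to the image at f = 2 pi *)

Section edges.
Variable R : realType.
Local Notation zr := (@zr R).
Local Notation B := (zr one).
Local Notation K := ((1 - (1 / 10) ^+ 2) `^ (3 / 2) : R).

Let close (st : state) (s X V : R) :=
  `|B * X - peval (st_X st) s| <= zr (Z.add (st_eX st) 107374) /\
  `|B * V - peval (st_V st) s| <= zr (Z.add (st_eV st) 107374).

Lemma lin_dist al be st s X V : `|s| <= 1 -> close st s X V ->
  `|B * (zr al * X + zr be * V) - zr (head Z0 (lin al be st))| <= zr (lin_rad al be st).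
Proof.
move=> s1 [hX hV]; have B0 := zr_one_gt0 R.
have hp (p : seq Z) : `|peval p s - zr (head Z0 p)| <= zr (pnorm (behead p)).
  case: p => [|a p] /=; first by rewrite zr0 subrr normr0.
  rewrite addrC addKr normrM -[leRHS]mul1r ler_pM//.
  exact: peval_norm.
have := hp (lin al be st); rewrite {1}/lin peval_padd !peval_pscale => h.
have -> : B * (zr al * X + zr be * V) - zr (head Z0 (lin al be st)) =
    zr al * (B * X - peval (st_X st) s) + zr be * (B * V - peval (st_V st) s) +
    (zr al * peval (st_X st) s + zr be * peval (st_V st) s - zr (head Z0 (lin al be st))).
  by ring.
rewrite /lin_rad zrD [zr (Z.add (pnorm _) _)]zrD !zrM !zr_abs addrC addrA.
apply: le_trans (ler_normD _ _) (lerD (le_trans (ler_normD _ _) (lerD h _)) _).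
  by rewrite normrM ler_wpM2l.
by rewrite normrM ler_wpM2l.
Qed.

Lemma lin_gt_sound al be lo st s X V : `|s| <= 1 -> close st s X V ->
  lin_gt al be lo st -> zr lo < zr al * X + zr be * V.
Proof.
move=> s1 /(lin_dist al be s1); rewrite ler_distl => /andP[h _] /(@zr_lt R).
rewrite zrM zrB => /lt_le_trans /(_ h); have B0 := zr_one_gt0 R.
by rewrite mulrC ltr_pM2l.
Qed.

Lemma lin_lt_sound al be hi st s X V : `|s| <= 1 -> close st s X V ->
  lin_lt al be hi st -> zr al * X + zr be * V < zr hi.
Proof.
move=> s1 /(lin_dist al be s1); rewrite ler_distl => /andP[_ h] /(@zr_lt R).
rewrite zrM zrD => /(le_lt_trans h); have B0 := zr_one_gt0 R.
by rewrite [ltRHS]mulrC ltr_pM2l.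
Qed.

Definition strip (t : target) (X V : R) :=
  zr (tg_lo t) < zr (tg_al t) * X - zr (tg_be t) * V < zr (tg_hi t).
Definition beyond (sd : side) (t : target) (X V : R) :=
  match sd with
  | Left => zr (tg_al t) * X + zr (tg_be t) * V < zr (tg_L t)
  | Right => zr (tg_R t) < zr (tg_al t) * X + zr (tg_be t) * V
  | Entry => true
  end.

Lemma in_strip_sound t st s X V : `|s| <= 1 -> close st s X V ->
  in_strip t st -> strip t X V.
Proof.
move=> s1 c /andP[/(lin_gt_sound s1 c) h1 /(lin_lt_sound s1 c) h2].
by move: h1 h2; rewrite /strip zrN mulNr => -> ->.
Qed.

Lemma on_side_sound sd t st s X V : `|s| <= 1 -> close st s X V ->
  on_side sd t st -> beyond sd t X V.
Proof.
move=> s1 c; case: sd => //=; [exact: (lin_lt_sound s1 c)|exact: (lin_gt_sound s1 c)].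
Qed.

(* f overshoots the rational end time of the integration by at most 5e-6 *)
Lemma pendulum_tail (X V f g : R -> R) (a b : R) : pendulum X V f g -> a <= b ->
  f b - f a <= 5 / 10 ^+ 6 -> `|V a| <= 8 ->
  `|X b - X a| <= 1 / 10 ^+ 4 - 1 / 10 ^+ 5 /\ `|V b - V a| <= 1 / 10 ^+ 4 - 1 / 10 ^+ 5.
Proof.
move=> pend ab fab Va.
have g0 t : 0 <= g t by have [] := pend t.
have fd (t : R) : is_derive t 1 f (g t) by have [] := pend t.
have Xd (t : R) : is_derive t 1 X (g t * (V t / (1 + cos (f t) / 10) ^+ 2 - 2)).
  by have [] := pend t.
have Vd (t : R) :
    is_derive t 1 V (g t * (79 / 100 * (1 + cos (f t) / 10) * sin (X t))).
  by have [] := pend t.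
have qb t : 9 / 10 <= 1 + cos (f t) / 10 /\ 1 + cos (f t) / 10 <= 11 / 10.
  by have := cos_geN1 (f t); have := cos_le1 (f t); split; lra.
have Vb t : a <= t <= b -> `|V t - V a| <= 869 / 1000 * (f t - f a).
  move=> /andP[at_ tb]; rewrite mulrBr.
  apply: (@ler_norm_of_derive _ V (fun t => 869 / 1000 * f t) _
    (fun t => 869 / 1000 * g t) a t at_ (fun u _ => Vd u)).
  move=> u _; rewrite normrM ger0_norm// [leRHS]mulrC ler_wpM2l//.
  have [q1 q2] := qb u.
  rewrite (normrM _ (sin _)) (normrM (79 / 100)) (ger0_norm (_ : 0 <= 79 / 100)); last by lra.
  rewrite [`|1 + _|]ger0_norm; last by lra.
  apply: (@le_trans _ _ (79 / 100 * (11 / 10) * 1)); last by lra.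
  apply: ler_pM; [|by []| |exact: sin_max]; last by rewrite ler_pM2l//; lra.
  by apply: mulr_ge0; lra.
have fmono t : a <= t <= b -> f t <= f b.
  move=> /andP[_ tb]; rewrite -subr_ge0 -(subrr 0).
  exact: (@ler_of_derive _ (fun=> 0) f (fun=> 0) g t b tb).
have V9 t : a <= t <= b -> `|V t| <= 81 / 10.
  move=> tab; have h := Vb t tab; have h2 := fmono t tab.
  have : `|V t| <= `|V a| + `|V t - V a| by rewrite -{1}[V t](subrKC (V a)) ler_normD.
  by lra.
have bb : a <= b <= b by rewrite ab lexx.
split; last by have := Vb b bb; lra.
(* 12 = (81/10) (100/81) + 2 bounds |V / q^2 - 2|, and 12 times 5 10^-6 is below 9 10^-5. *)
apply: (@le_trans _ _ (12 * (f b - f a))); last by lra.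
rewrite mulrBr.
apply: (@ler_norm_of_derive _ X (fun t => 12 * f t) _ (fun t => 12 * g t) a b ab (fun u _ => Xd u)).
move=> u uab; rewrite normrM ger0_norm// [leRHS]mulrC ler_wpM2l//.
have [q1 q2] := qb u; set q := 1 + _ in q1 q2 *.
have q81 : (q ^+ 2)^-1 <= 100 / 81.
  rewrite -[100 / 81]invrK lef_pV2 ?posrE ?exprn_gt0 ?invr_gt0//; try lra.
  by rewrite invf_div; nra.
apply: le_trans (ler_normB _ _) _; rewrite normrM normfV (ger0_norm (sqr_ge0 q)).
rewrite (ger0_norm (_ : 0 <= 2))//.
have : `|V u| / q ^+ 2 <= 81 / 10 * (100 / 81).
  by apply: ler_pM => //; [rewrite invr_ge0 sqr_ge0|exact: V9].
by lra.
Qed.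
End edges.

Local Opaque one Z.pow.

Section rounding.
Variable R : realType.

Lemma unit_slack (u w : R) : u = 1073741824%:R -> w = 107374%:R ->
  u * (1 / 10 ^+ 4 - 1 / 10 ^+ 5) <= w.
Proof. by move=> -> ->; lra. Qed.

Lemma unit_le (u : R) : u = 1073741824%:R -> u <= 2 ^+ 31.
Proof. by move=> ->; lra. Qed.

Lemma period_scale_approx (k u : R) : u = 985037562735554%:R ->
  985037562735553%:R / 10 ^+ 15 <= k <= 985037562735554%:R / 10 ^+ 15 ->
  `|k - u / 10 ^+ 15| <= 1 / 10 ^+ 14.
Proof. by move=> uE /andP[k1 k2]; apply/ler_normlP; split; lra. Qed.

Lemma period_scale_le1 (k : R) :
  985037562735553%:R / 10 ^+ 15 <= k <= 985037562735554%:R / 10 ^+ 15 -> k <= 1.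
Proof. by move=> /andP[_ k2]; lra. Qed.
Lemma norm_le9 (u v : R) : `|u - v| <= 1 / 10 ^+ 4 - 1 / 10 ^+ 5 -> `|v| <= 8 ->
  `|u| <= 9.
Proof.
move=> h1 h2; rewrite -(subrK v u); apply: le_trans (ler_normD _ _) _.
by apply: le_trans (lerD h1 h2) _; lra.
Qed.

(** With t for 10, the difference between the exact 2 K phi and its scaled integer polynomial,
    before floors are taken, is grouped into the errors of K, of the centre and of the second row of
    the matrix. *)
Lemma velocity_rounding (t u0 u1 u2 u3 u4 u5 u6 u7 u8 p c d s : R) : t != 0 ->
  u0 * (2 * u1 * (p + t ^- 3 * (c * ((u5 + s * u6) / t) + d * ((u7 + s * u8) / t)))) -
  (2 * u0 * u2 * (u3 * t ^+ 5 + u4 * (u5 - u7)) / t ^+ 35 +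
   s * (2 * u0 * u2 * (u4 * (u6 - u8)) / t ^+ 35)) =
  u0 * (2 * ((u1 - u2 / t ^+ 15) *
    (p + 1 / t ^+ 3 * (c * ((u5 + s * u6) / t) + d * ((u7 + s * u8) / t))) +
    u2 / t ^+ 15 * (p - u3 / t ^+ 15 +
     1 / t ^+ 3 * ((c - u4 / t ^+ 16) * ((u5 + s * u6) / t) +
                   (d + u4 / t ^+ 16) * ((u7 + s * u8) / t))))).
Proof. by move=> t0; field. Qed.

End rounding.

Section edge_soundness.
Variable R : realType.
Local Notation zr := (@zr R).
Local Notation B := (zr one).
Let K := ((1 - (1 / 10) ^+ 2) `^ (3 / 2) : R).

Lemma satellite_eccentricity : `|1 / 10 : R| < 1.
Proof. by rewrite ger0_norm; lra. Qed.

Lemma optionP (T : Type) (o : option T) (p : pred T) :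
  (if o is Some x then p x else false) -> exists2 x, o = Some x & p x.
Proof. by case: o => [x px|//]; exists x. Qed.

(** The run ends shortly before f = 2 pi. The remaining drift is added to the radii of X and V, and
    the term 2 pi in the final X is the value of f there. The bound on V is kept because, together
    with the strip, it bounds X. *)
Lemma edge_sound n d hs bx t0 t1 sd am ah bm bh (s : R) (z : R * R) :
  edge_ok n d hs bx t0 t1 sd am ah bm bh -> `|s| <= 1 ->
  `|B * (2 * (z.1 - pi / 2)) - peval (edge_X bx am ah bm bh) s| <= zr 10 ->
  `|B * (2 * K * z.2) - peval (edge_V bx am ah bm bh) s| <= zr 10 ->
  let z' := period_map (1 / 10) (79 / 100) z in
  let X := 2 * (z'.1 - pi / 2 - 2 * pi) in
  let V := 2 * K * z'.2 in
  `|V| <= 9 /\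
  [/\ strip t0 X V, beyond sd t0 X V, strip t1 X V & beyond sd t1 X V].
Proof.
rewrite /edge_ok => /andP[/andP[T1 T2]].
move=> /optionP[st E0]; cbv beta => /optionP[st' E1]; cbv beta.
move=> /andP[/andP[/andP[/andP[hV S0] D0] S1] D1] s1 hx hv.
set z' := period_map _ _ z; set X := 2 * (_ - 2 * pi); set V := 2 * K * z'.2.
have [theta [phi [f [T [sol f0 fT zE z'E]]]]] := period_mapP (79 / 100) satellite_eccentricity z.
have pend := solution_pendulum sol.
have B0 := zr_one_gt0 R.
have mono := anomaly_increasing satellite_eccentricity sol.
have fsurj y : exists t, f t = y.
  exact: (anomaly_surjective satellite_eccentricity sol).
move: hx hv; rewrite zE /= => hx hv.
have E0' : encloses st s (f 0) (2 * (theta 0 - pi / 2 - f 0)) (2 * K * phi 0).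
  by rewrite f0; apply: (init_sound E0 s1); rewrite ?subr0.
have [t1' ft1 [_ _ N3 N4]] := run_sound E1 s1 pend mono fsurj E0'.
have BE := zr_oneE R.
have [p1 p2] := pi_bounds R.
have {}T1 : 6283183%:R / 10 ^+ 6 <= zr (foldr Z.add Z0 hs) / B.
  move/(@zr_le R): T1; rewrite !zrM ler_pdivlMr//.
  have -> : zr 6283183 = 6283183%:R by rewrite !zrE; ring.
  have -> : zr 1000000 = 1000000%:R by rewrite !zrE; ring.
  lra.
have {}T2 : zr (foldr Z.add Z0 hs) / B <= 6283184%:R / 10 ^+ 6.
  move/(@zr_le R): T2; rewrite !zrM ler_pdivrMr//.
  have -> : zr 6283184 = 6283184%:R by rewrite !zrE; ring.
  have -> : zr 1000000 = 1000000%:R by rewrite !zrE; ring.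
  lra.
rewrite f0 add0r in ft1.
have tT : t1' <= T by rewrite -mono ft1 fT; lra.
have dT : f T - f t1' <= 5 / 10 ^+ 6 by rewrite ft1 fT; lra.
have V8 : `|2 * K * phi t1'| <= 8.
  rewrite -(@ler_pM2l _ B)// -{1}(gtr0_norm B0) -normrM.
  have h : `|peval (st_V st') s| <= zr (pnorm (st_V st')) by exact: peval_norm.
  move/(@zr_le R): hV; rewrite zrD zrM.
  have -> : zr 8 = 8 by rewrite !zrE; ring.
  rewrite -(subrK (peval (st_V st') s) (B * _)) [leRHS]mulrC => hV.
  by apply: le_trans (ler_normD _ _) _; rewrite addrC; apply: le_trans (lerD h N4) hV.
have [dX dV] := pendulum_tail pend tT dT V8.
rewrite /= fT in dX dV.
have n107 : zr 107374 = 107374%:R by rewrite !zrE; ring.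
have BS : B * (1 / 10 ^+ 4 - 1 / 10 ^+ 5) <= zr 107374.
  exact: unit_slack BE n107.
clear BE n107 T1 T2 dT.
have grow (c u v w e : R) : B * (1 / 10 ^+ 4 - 1 / 10 ^+ 5) <= c ->
    `|B * u - w| <= e -> `|v - u| <= 1 / 10 ^+ 4 - 1 / 10 ^+ 5 ->
    `|B * v - w| <= e + c.
  move=> hc h1 h2; have -> : B * v - w = (B * u - w) + B * (v - u) by ring.
  apply: le_trans (ler_normD _ _) (lerD h1 _); apply: le_trans hc.
  by rewrite normrM (gtr0_norm B0) (ler_pM2l B0).
have XE : X = 2 * (theta T - pi / 2 - 2 * pi) by rewrite /X /z' z'E.
have VE : V = 2 * K * phi T by rewrite /V /z' z'E.
have cl : `|B * X - peval (st_X st') s| <= zr (Z.add (st_eX st') 107374) /\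
    `|B * V - peval (st_V st') s| <= zr (Z.add (st_eV st') 107374).
  by rewrite !zrD XE VE; split; [exact: grow BS N3 dX|exact: grow BS N4 dV].
split.
  by rewrite VE; exact: norm_le9 dV V8.
split; [exact: in_strip_sound cl S0|exact: on_side_sound cl D0
       |exact: in_strip_sound cl S1|exact: on_side_sound cl D1].
Qed.

Let zr_div (a b : Z) : Z.ltb 0 b -> `|zr a / zr b - zr (Z.div a b)| <= 1.
Proof.
move=> b0; have b0' : 0 < zr b by have := @zr_lt R 0 b b0; rewrite zr0.
have bn : b <> Z0 by move: b0; lia.
have E := Z.div_mod a b bn.
have m0 : zr 0 <= zr (Z.modulo a b) by apply: zr_le; have := Z.mod_pos_bound a b; move: b0; lia.
have m1 : zr (Z.modulo a b) <= zr b by apply: zr_le; have := Z.mod_pos_bound a b; move: b0; lia.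
rewrite {1}E zrD zrM mulrDl mulrAC mulfV ?gt_eqF// mul1r addrC addKr.
rewrite zr0 in m0.
rewrite ger0_norm; last by apply: divr_ge0 => //; exact: ltW.
by rewrite ler_pdivrMr// mul1r.
Qed.

(** The approximate matrix, centre and K cost at most 2 units, and the floor of each of the two
    coefficients at most 1 more, well below the initial radius 10. *)
Lemma edge_start (bx : box) (am ah bm bh : Z) (P : R * R) (M : 'M[R]_2) (s : R)
    (z : R * R) :
  let mu := zr (bx_mu bx) / 10 ^+ 16 in
  let ka := zr (bx_ka bx) / 10 ^+ 16 in
  let a := (zr am + s * zr ah) / 10 in let b := (zr bm + s * zr bh) / 10 in
  `|s| <= 1 -> `|a| <= 300 -> `|b| <= 300 ->
  P.1 = pi / 2 -> `|P.2 - zr (bx_p bx) / 10 ^+ 15| <= 1 / 10 ^+ 12 ->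
  `|M 0 0 - mu| <= 2 / 10 ^+ 11 -> `|M 0 1 - mu| <= 2 / 10 ^+ 11 ->
  `|M 1 0 - ka| <= 2 / 10 ^+ 11 -> `|M 1 1 + ka| <= 2 / 10 ^+ 11 ->
  `|ka| <= 1 -> `|P.2| <= 2 ->
  z = affine_pt P M (a, b) ->
  `|B * (2 * (z.1 - pi / 2)) - peval (edge_X bx am ah bm bh) s| <= zr 10 /\
  `|B * (2 * K * z.2) - peval (edge_V bx am ah bm bh) s| <= zr 10.
Proof.
move=> mu ka a b s1 ha hb P1 P2 h00 h01 h10 h11 hka hP ->.
have B0 := zr_one_gt0 R.
have n10 : zr 10 = 10 by rewrite !zrE; ring.
have n2 : zr 2 = 2 by rewrite !zrE; ring.
have nK : zr Kz = 985037562735554%:R by rewrite /Kz !zrE; ring.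
have KB : `|K - zr Kz / 10 ^+ 15| <= 1 / 10 ^+ 14.
  exact: period_scale_approx nK (period_scale_bounds R).
have K0 : 0 < K by exact: period_scale_gt0.
have K1 : K <= 1.
  exact: period_scale_le1 (period_scale_bounds R).
clear nK.
have rnd (u x0 x1 y0 y1 : R) : `|u - (x0 + s * x1)| <= 2 -> `|x0 - y0| <= 1 ->
    `|x1 - y1| <= 1 -> `|u - (y0 + s * (y1 + s * 0))| <= zr 10.
  rewrite n10 mulr0 addr0 => h1 h2 h3.
  have -> : u - (y0 + s * y1) = (u - (x0 + s * x1)) + ((x0 - y0) + s * (x1 - y1)) by ring.
  apply: (@le_trans _ _ (2 + (1 + 1))); last by lra.
  apply: le_trans (ler_normD _ _) (lerD h1 _).
  apply: le_trans (ler_normD _ _) (lerD h2 _).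
  by rewrite normrM -[leRHS]mulr1 ler_pM.
have BB : B <= 2 ^+ 31.
  exact: unit_le (zr_oneE R).
have small (u d : R) : `|u| <= d -> d * 2 ^+ 31 <= 2 -> `|B * u| <= 2.
  move=> h1 h2; rewrite normrM (gtr0_norm B0); apply: le_trans h2.
  by rewrite mulrC; apply: ler_pM => //; exact: ltW.
have p5 : zr (Z.pow 10 5) = 10 ^+ 5 := zr_pow10 R 5.
have p20 : zr (Z.pow 10 20) = 10 ^+ 20 := zr_pow10 R 20.
have p35 : zr (Z.pow 10 35) = 10 ^+ 35 := zr_pow10 R 35.
split; rewrite /edge_X /edge_V /=.
- apply: rnd; [|exact: zr_div|exact: zr_div].
  rewrite p20 !(zrM, zrD) n2 /affine_pt /= P1; clear p5 p20 p35.
  set w := (X in `|X|).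
  have -> : w = B * (2 / 10 ^+ 3 * ((M 0 0 - mu) * a + (M 0 1 - mu) * b)).
    by rewrite /w /mu /a /b; field.
  apply: (small _ (2 / 10 ^+ 3 * (2 / 10 ^+ 11 * 300 + 2 / 10 ^+ 11 * 300))).
    rewrite normrM ger0_norm; last by lra.
    apply: ler_wpM2l; first by lra.
    by rewrite (le_trans (ler_normD _ _))// lerD// normrM ler_pM.
  by lra.
- apply: rnd; [|exact: zr_div|exact: zr_div].
  rewrite p35; move: p5; clear p20 p35.
  generalize (Z.pow 10 5) => q qE; rewrite !(zrM, zrD, zrB) qE n2 /affine_pt /=; clear qE q.
  set w := (X in `|X|).
  have -> : w = B * (2 * ((K - zr Kz / 10 ^+ 15) * (P.2 + 1 / 10 ^+ 3 * (M 1 0 * a + M 1 1 * b))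
     + zr Kz / 10 ^+ 15 * ((P.2 - zr (bx_p bx) / 10 ^+ 15 ) +
       1 / 10 ^+ 3 * ((M 1 0 - ka) * a + (M 1 1 + ka) * b)))).
    rewrite /w /ka /a /b; apply: velocity_rounding; lra.
  clear w; set Q := 1 / 10 ^+ 3 * ((M 1 0 - ka) * a + (M 1 1 + ka) * b).
  have hQ : `|Q| <= 2 / 10 ^+ 11.
    rewrite /Q normrM ger0_norm; last by lra.
    apply: (@le_trans _ _ (1 / 10 ^+ 3 * (2 / 10 ^+ 11 * 300 + 2 / 10 ^+ 11 * 300))); last by lra.
    apply: ler_wpM2l; first by lra.
    by rewrite (le_trans (ler_normD _ _))// lerD// normrM ler_pM.
  have hM : `|P.2 + 1 / 10 ^+ 3 * (M 1 0 * a + M 1 1 * b)| <= 10.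
    have h (m k : R) : `|m - k| <= 2 / 10 ^+ 11 -> `|k| <= 1 -> `|m| <= 2.
      move=> h1 h2; rewrite -(subrK k m); apply: le_trans (ler_normD _ _) _.
      by apply: le_trans (lerD h1 h2) _; lra.
    have m1 : `|M 1 0| <= 2 by exact: h h10 hka.
    have m2 : `|M 1 1| <= 2 by apply: (h _ (- ka)); rewrite ?opprK ?normrN.
    apply: le_trans (ler_normD _ _) _.
    apply: (@le_trans _ _ (2 + 1 / 10 ^+ 3 * (2 * 300 + 2 * 300))); last by lra.
    rewrite lerD// normrM ger0_norm; last by lra.
    apply: ler_wpM2l; first by lra.
    by rewrite (le_trans (ler_normD _ _))// lerD// normrM ler_pM.
  have hK : `|zr Kz / 10 ^+ 15| <= 2.
    rewrite -(subrK K (zr Kz / _)); apply: le_trans (ler_normD _ _) _.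
    rewrite distrC (gtr0_norm K0).
    by apply: le_trans (lerD KB K1) _; lra.
  apply: (small _ (2 * (1 / 10 ^+ 14 * 10 + 2 * (1 / 10 ^+ 12 + 2 / 10 ^+ 11)))); last by lra.
  rewrite normrM ger0_norm; last by lra.
  apply: ler_wpM2l; first by lra.
  apply: le_trans (ler_normD _ _) (lerD _ _); rewrite normrM ler_pM//.
  exact: le_trans (ler_normD _ _) (lerD P2 hQ).
Qed.
End edge_soundness.

(** * Images of the edges *)

Section target_geometry.
Variable R : realType.
Local Notation zr := (@zr R).
Lemma norm_le1 (u : R) : 0 <= u <= 1 -> `|u| <= 1.
Proof. by case/andP => u0 u1; rewrite ger0_norm. Qed.

Lemma prod_bound (u v a b : R) : `|u| <= a -> `|v| <= b -> - (a * b) <= u * v <= a * b.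
Proof. by move=> h1 h2; rewrite -ler_norml normrM ler_pM. Qed.

Lemma det_near (a00 a01 a10 a11 mu ka : R) : `|mu| <= 1 -> `|ka| <= 1 ->
  `|a00 - mu| <= 2 / 10 ^+ 11 -> `|a01 - mu| <= 2 / 10 ^+ 11 ->
  `|a10 - ka| <= 2 / 10 ^+ 11 -> `|a11 + ka| <= 2 / 10 ^+ 11 ->
  `|a01 * a10 - a00 * a11 - 2 * ka * mu| <= 9 / 10 ^+ 11.
Proof.
move=> m1 k1 h00 h01 h10 h11.
have f1 := prod_bound h01 h10; have f2 := prod_bound h00 h11.
have f3 := prod_bound h01 k1; have f4 := prod_bound h10 m1.
have f5 := prod_bound h11 m1; have f6 := prod_bound h00 k1.
by clear - f1 f2 f3 f4 f5 f6; apply/ler_normlP; split; lra.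
Qed.

(* The four inequalities of target_ok, read at any chart matrix A and centre p
   that the box approximates. *)
Lemma target_chart (ka mu K p0 p al be lo hi L Rr c d1 d2 d3 d4 a00 a01 a10 a11 x y : R) :
  0 <= ka <= 1 -> 0 <= mu <= 1 -> 0 <= K <= 1 ->
  `|al - ka| <= 1 / 10 ^+ 6 -> `|be * K - mu| <= 2 / 10 ^+ 6 ->
  `|p - p0| <= 1 / 10 ^+ 12 ->
  `|a00 - mu| <= 2 / 10 ^+ 11 -> `|a01 - mu| <= 2 / 10 ^+ 11 ->
  `|a10 - ka| <= 2 / 10 ^+ 11 -> `|a11 + ka| <= 2 / 10 ^+ 11 ->
  `|d1| <= 200 -> `|d2| <= 200 -> `|d3| <= 200 -> `|d4| <= 200 ->
  `|x + c| <= 8 -> `|x| <= 12 -> `|y + p| <= 8 -> `|y| <= 8 ->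
  let X := 2 * (x + c) in let V := 2 * K * (y + p) in
  let D := a01 * a10 - a00 * a11 in
  let d := 4 * ka * mu / 10 ^+ 3 in
  (d * d1 + 2 * ka * c - 2 * mu * p0 + 1 / 10 ^+ 3 <= lo -> lo < al * X - be * V ->
    d1 * D < 1000 * (a10 * x - a00 * y)) /\
  (hi <= d * d2 + 2 * ka * c - 2 * mu * p0 - 1 / 10 ^+ 3 -> al * X - be * V < hi ->
    1000 * (a10 * x - a00 * y) < d2 * D) /\
  (L <= d * d3 + 2 * ka * c + 2 * mu * p0 - 1 / 10 ^+ 3 -> al * X + be * V < L ->
    1000 * (a01 * y - a11 * x) < d3 * D) /\
  (d * d4 + 2 * ka * c + 2 * mu * p0 + 1 / 10 ^+ 3 <= Rr -> Rr < al * X + be * V ->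
    d4 * D < 1000 * (a01 * y - a11 * x)).
Proof.
move=> k01 m01 K01 hal hbe hp h00 h01 h10 h11 b1 b2 b3 b4 hX hx hV hy X V D d.
(* Once every product of an error with a coordinate has been bounded, the four claims are linear in
   the remaining monomials. *)
have e1 := prod_bound hal hX; have e2 := prod_bound hbe hV.
have m1 := norm_le1 m01; have e3 := prod_bound hp m1.
have e00 := prod_bound h00 hy; have e01 := prod_bound h01 hy.
have e10 := prod_bound h10 hx; have e11 := prod_bound h11 hx.
have hD : `|D - 2 * ka * mu| <= 9 / 10 ^+ 11.
  by apply: det_near => //; exact: norm_le1.
have g1 := prod_bound hD b1; have g2 := prod_bound hD b2.
have g3 := prod_bound hD b3; have g4 := prod_bound hD b4.
clear hal hbe hp h00 h01 h10 h11 hX hx hV hy hD b1 b2 b3 b4 k01 m01 K01 m1.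
have A (w : R) : w * D = (D - 2 * ka * mu) * w + 2 * ka * mu * w by ring.
rewrite !A; clearbody D; clear A.
rewrite /X /V /d; split; [|split; [|split]] => h1 h2; lra.
Qed.
End target_geometry.

Section certified_targets.
Variable R : realType.
Local Notation zr := (@zr R).
Definition approximates (b : box) (P : R * R) (A : 'M[R]_2) : Prop :=
  [/\ P.1 = pi / 2, `|P.2 - zr (bx_p b) / 10 ^+ 15| <= 1 / 10 ^+ 12,
      `|A 0 0 - zr (bx_mu b) / 10 ^+ 16| <= 2 / 10 ^+ 11 /\
      `|A 0 1 - zr (bx_mu b) / 10 ^+ 16| <= 2 / 10 ^+ 11
    & `|A 1 0 - zr (bx_ka b) / 10 ^+ 16| <= 2 / 10 ^+ 11 /\
      `|A 1 1 + zr (bx_ka b) / 10 ^+ 16| <= 2 / 10 ^+ 11].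

Lemma box_okP i (mu := zr (bx_mu (boxes i)) / 10 ^+ 16)
    (ka := zr (bx_ka (boxes i)) / 10 ^+ 16) :
  [/\ 1 / 10 <= ka <= 1, 1 / 10 <= mu <= 1,
    `|zr (bx_p (boxes i)) / 10 ^+ 15| <= 19 / 10,
    `|zr (box_left i) / 10| <= 200 /\ `|zr (box_right i) / 10| <= 200
  & `|zr (box_bottom i) / 10| <= 200 /\ `|zr (box_top i) / 10| <= 200].
Proof.
rewrite /mu /ka; case/and5P: (box_okT i) => + + + + /and5P[].
move=> /(@zr_le R) + /(@zr_le R) + /(@zr_le R) + /(@zr_le R) + /(@zr_le R) + /(@zr_le R) +
  /(@zr_le R) + /(@zr_le R) + /(@zr_le R) +.
have p14 : zr (Z.pow 10 14) = 10 ^+ 14 := zr_pow10 R 14.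
have p15 : zr (Z.pow 10 15) = 10 ^+ 15 := zr_pow10 R 15.
have p16 : zr (Z.pow 10 16) = 10 ^+ 16 := zr_pow10 R 16.
have n2 : zr 2000 = 2000 by rewrite !zrE; ring.
have n19 : zr 19 = 19 by rewrite !zrE; ring.
rewrite zrM !zr_abs p14 p15 p16 n2 n19; clear p14 p15 p16 n2 n19.
have no (u : R) : `|u| <= 2000 -> `|u / 10| <= 200.
  by move=> /ler_normlP[h1 h2]; apply/ler_normlP; split; lra.
move: (zr (bx_ka _)) (zr (bx_mu _)) (zr (bx_p _)) => u1 u2 u3 h1 h2 h3 h4 h5.
move=> /no -> /no -> /no -> /no ->.
split=> //; last by case/ler_normlP: h5 => h5 h6; apply/ler_normlP; split; lra.
all: apply/andP; lra.
Qed.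

(** This lemma and the next three turn the integer comparisons of [target_ok] into real units; q
    stands for pi and u / 10^6 for its rational bound. *)
Lemma lower_scale (k m b n p lo q u : R) :
  4 * k * m * b + 2 * k * n * u * 10 ^+ 14 - 2 * m * p * 10 ^+ 5 + 10 ^+ 33 <= lo * 10 ^+ 30 ->
  k * n * q <= k * n * (u / 10 ^+ 6) ->
  4 * (k / 10 ^+ 16) * (m / 10 ^+ 16) / 10 ^+ 3 * (b / 10) + 2 * (k / 10 ^+ 16) * (n * q) -
    2 * (m / 10 ^+ 16) * (p / 10 ^+ 15) + 1 / 10 ^+ 3 <= lo / 10 ^+ 6.
Proof. by move=> h1 h2; lra. Qed.

Lemma upper_scale (k m b n p hi q u : R) :
  hi * 10 ^+ 30 <= 4 * k * m * b + 2 * k * n * u * 10 ^+ 14 - 2 * m * p * 10 ^+ 5 - 10 ^+ 33 ->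
  k * n * (u / 10 ^+ 6) <= k * n * q ->
  hi / 10 ^+ 6 <= 4 * (k / 10 ^+ 16) * (m / 10 ^+ 16) / 10 ^+ 3 * (b / 10) +
    2 * (k / 10 ^+ 16) * (n * q) - 2 * (m / 10 ^+ 16) * (p / 10 ^+ 15) - 1 / 10 ^+ 3.
Proof. by move=> h1 h2; lra. Qed.

Lemma lower_scale_opp (k m b n p lo q u : R) :
  4 * k * m * b + 2 * k * n * u * 10 ^+ 14 + 2 * m * p * 10 ^+ 5 + 10 ^+ 33 <= lo * 10 ^+ 30 ->
  k * n * q <= k * n * (u / 10 ^+ 6) ->
  4 * (k / 10 ^+ 16) * (m / 10 ^+ 16) / 10 ^+ 3 * (b / 10) + 2 * (k / 10 ^+ 16) * (n * q) +
    2 * (m / 10 ^+ 16) * (p / 10 ^+ 15) + 1 / 10 ^+ 3 <= lo / 10 ^+ 6.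
Proof. by move=> h1 h2; lra. Qed.

Lemma upper_scale_opp (k m b n p hi q u : R) :
  hi * 10 ^+ 30 <= 4 * k * m * b + 2 * k * n * u * 10 ^+ 14 + 2 * m * p * 10 ^+ 5 - 10 ^+ 33 ->
  k * n * (u / 10 ^+ 6) <= k * n * q ->
  hi / 10 ^+ 6 <= 4 * (k / 10 ^+ 16) * (m / 10 ^+ 16) / 10 ^+ 3 * (b / 10) +
    2 * (k / 10 ^+ 16) * (n * q) + 2 * (m / 10 ^+ 16) * (p / 10 ^+ 15) - 1 / 10 ^+ 3.
Proof. by move=> h1 h2; lra. Qed.

Lemma slope_scale (a k : R) : `|a * 10 ^+ 10 - k| <= 10 ^+ 10 ->
  `|a / 10 ^+ 6 - k / 10 ^+ 16| <= 1 / 10 ^+ 6.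
Proof. by move=> /ler_normlP[h1 h2]; apply/ler_normlP; split; lra. Qed.

Lemma slope_scale2 (a k m : R) : `|a * k - m * 10 ^+ 5| <= 10 ^+ 15 ->
  `|a / 10 ^+ 6 * (k / 10 ^+ 15) - m / 10 ^+ 16| <= 1 / 10 ^+ 6.
Proof. by move=> /ler_normlP[h1 h2]; apply/ler_normlP; split; lra. Qed.

Lemma target_okP i j (t := targets i j) (mu := zr (bx_mu (boxes j)) / 10 ^+ 16)
    (ka := zr (bx_ka (boxes j)) / 10 ^+ 16) (p := zr (bx_p (boxes j)) / 10 ^+ 15)
    (d := 4 * ka * mu / 10 ^+ 3) (c := zr (turns i) * pi)
    (S := 10 ^+ 6) :
  [/\ `|zr (tg_al t) / S - ka| <= 1 / 10 ^+ 6,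
      `|zr (tg_be t) / S * (zr Kz / 10 ^+ 15) - mu| <= 1 / 10 ^+ 6,
      d * (zr (box_bottom j) / 10) + 2 * ka * c - 2 * mu * p + 1 / 10 ^+ 3 <= zr (tg_lo t) / S /\
      zr (tg_hi t) / S <= d * (zr (box_top j) / 10) + 2 * ka * c - 2 * mu * p - 1 / 10 ^+ 3,
      zr (tg_L t) / S <= d * (zr (box_left j) / 10) + 2 * ka * c + 2 * mu * p - 1 / 10 ^+ 3 /\
      d * (zr (box_right j) / 10) + 2 * ka * c + 2 * mu * p + 1 / 10 ^+ 3 <= zr (tg_R t) / S
    & forall X V : R, `|V| <= 9 -> strip t X V -> `|X| <= 16].
Proof.
case/and5P: (target_okT i j) => + + + + /and5P[+ + + + /andP[]].
move=> /(@zr_lt R) + /(@zr_le R) + /(@zr_le R) + /(@zr_le R) + /(@zr_le R) + /(@zr_le R) +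
  /(@zr_le R) + /(@zr_le R) + /(@zr_le R) + /(@zr_le R) +.
have p5 : zr (Z.pow 10 5) = 10 ^+ 5 := zr_pow10 R 5.
have p10 : zr (Z.pow 10 10) = 10 ^+ 10 := zr_pow10 R 10.
have p14 : zr (Z.pow 10 14) = 10 ^+ 14 := zr_pow10 R 14.
have p15 : zr (Z.pow 10 15) = 10 ^+ 15 := zr_pow10 R 15.
have p30 : zr (Z.pow 10 30) = 10 ^+ 30 := zr_pow10 R 30.
have p33 : zr (Z.pow 10 33) = 10 ^+ 33 := zr_pow10 R 33.
have n2 : zr 2 = 2 by rewrite !zrE; ring.
have n4 : zr 4 = 4 by rewrite !zrE; ring.
have n9 : zr 9 = 9 by rewrite !zrE; ring.
have n16 : zr 16 = 16 by rewrite !zrE; ring.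
have [q1 q2] := pi_bounds R.
have n_lo : zr 3141592 = 3141592%:R by rewrite !zrE; ring.
have n_hi : zr 3141594 = 3141594%:R by rewrite !zrE; ring.
have r1 : zr 3141592 / 10 ^+ 6 <= pi :> R.
  by rewrite n_lo; exact: ltW.
have r2 : pi <= zr 3141594 / 10 ^+ 6 :> R.
  by rewrite n_hi; exact: ltW.
clear q1 q2 n_lo n_hi.
move: p5 p10 p14 p15 p30 p33.
generalize (Z.pow 10 5) (Z.pow 10 10) (Z.pow 10 14) (Z.pow 10 15) (Z.pow 10 30) (Z.pow 10 33).
move=> w1 w2 w3 w4 w5 w6 E1 E2 E3 E4 E5 E6.
rewrite !zr_abs !(zrM, zrD, zrB, zrN, zr0) E1 E2 E3 E4 E5 E6 n2 n4 n9 n16.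
clear E1 E2 E3 E4 E5 E6 w1 w2 w3 w4 w5 w6 n2 n4 n9 n16.
rewrite -/t => al0 be0 hX1 hX2 hal hbe h1 h2 h3 h4.
have [/andP[ka0 _] _ _ _ _] := box_okP j.
have kn : 0 <= zr (bx_ka (boxes j)) * zr (turns i).
  apply: mulr_ge0; last by case: (i); rewrite /turns ?zr0 ?zr1.
  by move: ka0; rewrite ler_pdivlMr// => /(le_trans _); apply.
have s1 := ler_wpM2l kn r1; have s2 := ler_wpM2l kn r2.
split.
- exact: slope_scale hal.
- exact: slope_scale2 hbe.
- by split; [exact: lower_scale h1 s2|exact: upper_scale h2 s1].
- by split; [exact: upper_scale_opp h3 s1|exact: lower_scale_opp h4 s2].
- move=> X V hV /andP[]; rewrite -/t => hl hh.
  clear - be0 hV hX1 hX2 hl hh al0; move: hX1 hX2 hl hh al0 be0.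
  move: (zr (tg_al t)) (zr (tg_be t)) (zr (tg_lo t)) (zr (tg_hi t)) => al be lo hi.
  move=> hX1 hX2 hl hh al0 be0.
  have : `|be * V| <= be * 9 by rewrite normrM (ger0_norm be0); apply: ler_wpM2l.
  move=> /ler_normlP[v1 v2]; rewrite -(ler_pM2l al0) -{1}(gtr0_norm al0) -normrM.
  by apply/ler_normlP; split; lra.
Qed.
End certified_targets.

Section image_in_chart.
Variable R : realType.
Local Notation zr := (@zr R).
Let K := ((1 - (1 / 10) ^+ 2) `^ (3 / 2) : R).

Lemma scale_error (k u : R) : `|k - u / 10 ^+ 15| <= 1 / 10 ^+ 14 ->
  forall be mu : R, `|be| <= 2 -> `|be * (u / 10 ^+ 15) - mu| <= 1 / 10 ^+ 6 ->
  `|be * k - mu| <= 2 / 10 ^+ 6.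
Proof.
move=> h be mu b1 h2.
have -> : be * k - mu = be * (k - u / 10 ^+ 15) + (be * (u / 10 ^+ 15) - mu) by ring.
apply: le_trans (ler_normD _ _) _.
apply: (@le_trans _ _ (2 * (1 / 10 ^+ 14) + 1 / 10 ^+ 6)); last by lra.
by apply: lerD => //; rewrite normrM ler_pM.
Qed.

Lemma pi_lt4 : 3 < pi :> R /\ pi < 4 :> R.
Proof. by have [h1 h2] := pi_bounds R; split; lra. Qed.

Lemma scale_gt9 : 9 / 10 <= K.
Proof. by case/andP: (period_scale_bounds R) => h1 _; rewrite /K; lra. Qed.

Lemma scale_le1 : K <= 1.
Proof. exact: period_scale_le1 (period_scale_bounds R). Qed.

Lemma scale_near : `|K - zr Kz / 10 ^+ 15| <= 1 / 10 ^+ 14.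
Proof.
apply: period_scale_approx (period_scale_bounds R).
by rewrite /Kz !zrE; ring.
Qed.

Lemma norm_le2_of_near (u v : R) : `|u - v| <= 1 / 10 ^+ 12 -> `|v| <= 19 / 10 -> `|u| <= 2.
Proof.
move=> h1 h2; rewrite -(subrK v u); apply: le_trans (ler_normD _ _) _.
by apply: le_trans (lerD h1 h2) _; lra.
Qed.

Lemma slope_le2 (be u mu : R) : `|be * u - mu| <= 1 / 10 ^+ 6 -> mu <= 1 -> 0 <= mu ->
  8 / 10 <= u -> `|be| <= 2.
Proof.
move=> /ler_normlP[h1 h2] m1 m0 u8; have u0 : 0 < u by lra.
rewrite -(ler_pM2r u0) -{1}(gtr0_norm u0) -normrM.
by apply/ler_normlP; split; lra.
Qed.

Lemma near_scale (k u : R) : `|k - u| <= 1 / 10 ^+ 14 -> 9 / 10 <= k -> 8 / 10 <= u.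
Proof. by move=> /ler_normlP[h1 h2]; lra. Qed.

Lemma det_gt0 (a00 a01 a10 a11 mu ka : R) : 1 / 10 <= ka -> 1 / 10 <= mu ->
  `|a00 - mu| <= 2 / 10 ^+ 11 -> `|a01 - mu| <= 2 / 10 ^+ 11 ->
  `|a10 - ka| <= 2 / 10 ^+ 11 -> `|a11 + ka| <= 2 / 10 ^+ 11 ->
  0 < a01 * a10 - a00 * a11.
Proof.
move=> k1 m1 /ler_normlP[h1 h1'] /ler_normlP[h2 h2'] /ler_normlP[h3 h3'] /ler_normlP[h4 h4'].
rewrite -mulrN; apply: addr_gt0; apply: mulr_gt0; lra.
Qed.

Lemma unit_of_tenth (u : R) : 1 / 10 <= u <= 1 -> 0 <= u <= 1.
Proof. by move=> /andP[h1 h2]; apply/andP; split; lra. Qed.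

Lemma turn_bound i : `|zr (turns i) * pi| <= 4.
Proof.
have [q1 q2] := pi_lt4; case: i; rewrite /turns ?zr0 ?zr1 ?mul0r ?mul1r ?normr0//.
by rewrite ger0_norm ltW//; apply: lt_trans q1.
Qed.

Lemma position_bound (x t : R) : `|t| <= 4 -> `|2 * (x + t)| <= 16 ->
  `|x + t| <= 8 /\ `|x| <= 12.
Proof.
move=> /ler_normlP[h1 h2] /ler_normlP[h3 h4].
by split; apply/ler_normlP; split; lra.
Qed.

Lemma height_bound (y p : R) : `|p| <= 2 -> `|2 * K * y| <= 9 ->
  `|y - p + p| <= 8 /\ `|y - p| <= 8.
Proof.
move=> hp hV; have K9 := scale_gt9.
have y5 : `|y| <= 5.
  have h : 9 / 10 * `|y| <= K * `|y| by rewrite ler_wpM2r.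
  rewrite !normrM (@ger0_norm _ 2)// (@ger0_norm _ K) in hV; last by apply: le_trans K9; lra.
  clear K9 hp; lra.
split; first by rewrite subrK; apply: le_trans y5 _; lra.
by apply: le_trans (ler_normB _ _) (le_trans (lerD y5 hp) _); lra.
Qed.

(** Cramer's rule: the coordinates [ab], multiplied by minus the determinant, are the two linear
    forms of [target_chart]. That factor is positive, so inequalities for the forms pass to the
    coordinates. *)
Lemma image_chart i j (P : R * R) (A : 'M[R]_2) (w ab : R * R) :
  approximates (boxes j) P A ->
  w = affine_pt P A ab ->
  let X := 2 * (w.1 - pi / 2 + zr (turns i) * pi) in let V := 2 * K * w.2 in
  `|V| <= 9 -> strip (targets i j) X V ->
  [/\ zr (box_bottom j) / 10 < ab.2 < zr (box_top j) / 10,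
      beyond Left (targets i j) X V -> ab.1 < zr (box_left j) / 10
    & beyond Right (targets i j) X V -> zr (box_right j) / 10 < ab.1].
Proof.
case=> P1 hp [h00 h01] [h10 h11] wE X V hV hs.
have [k01 m01 p2 [d3 d4] [d1 d2]] := box_okP R j.
have [hal hbe [t1 t2] [t3 t4] hXV] := target_okP R i j.
have hX := hXV X V hV hs.
have hP := norm_le2_of_near hp p2.
have [x1 x2] := position_bound (turn_bound i) hX.
have [y2 y1] := height_bound hP hV.
have D0 : 0 < A 0 1 * A 1 0 - A 0 0 * A 1 1.
  by case/andP: k01 => k0 _; case/andP: m01 => m0 _; exact: det_gt0 h00 h01 h10 h11.
have k01' := unit_of_tenth k01; have m01' := unit_of_tenth m01.
have bK : `|zr (tg_be (targets i j)) / 10 ^+ 6 * K - zr (bx_mu (boxes j)) / 10 ^+ 16|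
    <= 2 / 10 ^+ 6.
  apply: (scale_error scale_near _ hbe); case/andP: m01' => m0 m1.
  exact: slope_le2 hbe m1 m0 (near_scale scale_near scale_gt9).
have K01 : 0 <= K <= 1.
  by rewrite scale_le1 (le_trans _ scale_gt9)//; apply: divr_ge0.
have [c1 [c2 [c3 c4']]] := target_chart
  (zr (tg_lo (targets i j)) / 10 ^+ 6) (zr (tg_hi (targets i j)) / 10 ^+ 6)
  (zr (tg_L (targets i j)) / 10 ^+ 6) (zr (tg_R (targets i j)) / 10 ^+ 6)
  k01' m01' K01 hal bK hp h00 h01 h10 h11 d1 d2 d3 d4 x1 x2 y2 y1.
have S0 : 0 < (10 ^+ 6)^-1 :> R by rewrite invr_gt0 exprn_gt0.
have lin1 (al be : R) : al / 10 ^+ 6 * (2 * (w.1 - pi / 2 + zr (turns i) * pi)) -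
    be / 10 ^+ 6 * (2 * K * (w.2 - P.2 + P.2)) = (al * X - be * V) / 10 ^+ 6.
  by rewrite subrK /X /V; ring.
have lin2 (al be : R) : al / 10 ^+ 6 * (2 * (w.1 - pi / 2 + zr (turns i) * pi)) +
    be / 10 ^+ 6 * (2 * K * (w.2 - P.2 + P.2)) = (al * X + be * V) / 10 ^+ 6.
  by rewrite subrK /X /V; ring.
have e2 : 1000 * (A 1 0 * (w.1 - pi / 2) - A 0 0 * (w.2 - P.2)) =
    ab.2 * (A 0 1 * A 1 0 - A 0 0 * A 1 1).
  by rewrite -P1 wE /affine_pt /=; field.
have e1 : 1000 * (A 0 1 * (w.2 - P.2) - A 1 1 * (w.1 - pi / 2)) =
    ab.1 * (A 0 1 * A 1 0 - A 0 0 * A 1 1).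
  by rewrite -P1 wE /affine_pt /=; field.
move: (c1 t1) (c2 t2) (c3 t3) (c4' t4).
rewrite e1 e2 !lin1 !lin2 !(ltr_pM2r D0) !(ltr_pM2r S0) => {}c1 {}c2 {}c3 {}c4.
case/andP: hs => s1 s2.
by split; [rewrite c1// c2|exact: c3|exact: c4].
Qed.
End image_in_chart.

Local Opaque edge_ok.

Section edge_images.
Variable R : realType.
Local Notation zr := (@zr R).

Definition lift_map (i : bool) (z : R * R) : R * R :=
  let z' := period_map (1 / 10) (79 / 100) z in
  (z'.1 - (if i then 3 else 2 : int)%:~R * pi, z'.2).

(** The target j is quantified inside, since one integration of an edge is tested against both
    boxes. *)
Definition lands (i : bool) (sd : side) (z : R * R) : Prop :=
  forall j (P : R * R) (A : 'M[R]_2) (ab : R * R),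
  approximates (boxes j) P A -> lift_map i z = affine_pt P A ab ->
  zr (box_bottom j) / 10 < ab.2 < zr (box_top j) / 10 /\
  match sd with
  | Left => ab.1 < zr (box_left j) / 10
  | Right => zr (box_right j) / 10 < ab.1
  | Entry => true
  end.

Definition small_box (am ah bm bh : Z) : bool :=
  Z.leb (Z.add (Z.abs am) (Z.abs ah)) 3000 && Z.leb (Z.add (Z.abs bm) (Z.abs bh)) 3000.

Lemma small_coord (u v s : R) : `|s| <= 1 -> `|u| + `|v| <= 3000 -> `|(u + s * v) / 10| <= 300.
Proof.
move=> s1 h.
have h2 : `|u + s * v| <= 3000.
  apply: le_trans (ler_normD _ _) (le_trans _ h).
  by rewrite lerD2l normrM -[leRHS]mul1r ler_wpM2r.
by case/ler_normlP: h2 => h2 h3; apply/ler_normlP; split; lra.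
Qed.

Lemma edge_lands n d hs i sd am ah bm bh (P : R * R) (A : 'M[R]_2) (s : R) :
  edge_ok n d hs (boxes i) (targets i false) (targets i true) sd am ah bm bh ->
  small_box am ah bm bh -> approximates (boxes i) P A -> `|s| <= 1 ->
  lands i sd (affine_pt P A ((zr am + s * zr ah) / 10, (zr bm + s * zr bh) / 10)).
Proof.
move=> ok /andP[/(@zr_le R) sa /(@zr_le R) sb] [P1 hp [h00 h01] [h10 h11]] s1.
have n3 : zr 3000 = 3000 by rewrite !zrE; ring.
rewrite !zrD !zr_abs n3 in sa sb.
have [/andP[k0 k1] _ p2 _ _] := box_okP R i.
have hP := norm_le2_of_near hp p2.
have ka1 : `|zr (bx_ka (boxes i)) / 10 ^+ 16| <= 1.
  by rewrite ger0_norm// (le_trans _ k0)//; apply: divr_ge0.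
set z := affine_pt _ _ _.
have [eX eV] := edge_start s1 (small_coord s1 sa) (small_coord s1 sb)
  P1 hp h00 h01 h10 h11 ka1 hP (erefl z).
have [hV [S0 D0 S1 D1]] := edge_sound ok s1 eX eV.
move=> j P' A' ab hA hz.
have wX : 2 * ((period_map (1 / 10) (79 / 100) z).1 - pi / 2 - 2 * pi) =
    2 * ((lift_map i z).1 - pi / 2 + zr (turns i) * pi).
  by rewrite /lift_map /=; case: (i); rewrite /turns ?zr0 ?zr1; ring.
have wV : (period_map (1 / 10) (79 / 100) z).2 = (lift_map i z).2 by [].
rewrite wX wV in hV S0 D0 S1 D1.
have hS : strip (targets i j) (2 * ((lift_map i z).1 - pi / 2 + zr (turns i) * pi))
    (2 * (1 - (1 / 10) ^+ 2) `^ (3 / 2) * (lift_map i z).2) by case: (j).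
have hD : beyond sd (targets i j) (2 * ((lift_map i z).1 - pi / 2 + zr (turns i) * pi))
    (2 * (1 - (1 / 10) ^+ 2) `^ (3 / 2) * (lift_map i z).2) by case: (j).
have [c1 c2 c3] := image_chart hA hz hV hS.
split=> //; move: hD; case: (sd) => //.
Qed.

Lemma interval_param (a u v : R) : 0 < v -> u - v <= a <= u + v ->
  exists2 s, `|s| <= 1 & a = u + s * v.
Proof.
move=> v0 /andP[a1 a2]; exists ((a - u) / v); last by field; lra.
rewrite normrM (gtr0_norm (x := v^-1)) ?invr_gt0// ler_pdivrMr// mul1r.
by apply/ler_normlP; split; lra.
Qed.

Lemma vertical_edge_lands n d hs i sd am bm bh (P : R * R) (A : 'M[R]_2) (b : R) :
  edge_ok n d hs (boxes i) (targets i false) (targets i true) sd am Z0 bm bh ->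
  small_box am Z0 bm bh -> Z.ltb 0 bh -> approximates (boxes i) P A ->
  zr bm - zr bh <= b * 10 <= zr bm + zr bh ->
  lands i sd (affine_pt P A (zr am / 10, b)).
Proof.
move=> ok sm /(@zr_lt R); rewrite zr0 => bh0 hA /(interval_param bh0)[s s1 bE].
have := edge_lands ok sm hA s1.
by rewrite zr0 mulr0 addr0 -bE mulfK.
Qed.

Lemma horizontal_edge_lands n d hs i sd am ah bm (P : R * R) (A : 'M[R]_2) (a : R) :
  edge_ok n d hs (boxes i) (targets i false) (targets i true) sd am ah bm Z0 ->
  small_box am ah bm Z0 -> Z.ltb 0 ah -> approximates (boxes i) P A ->
  zr am - zr ah <= a * 10 <= zr am + zr ah ->
  lands i sd (affine_pt P A (a, zr bm / 10)).
Proof.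
move=> ok sm /(@zr_lt R); rewrite zr0 => ah0 hA /(interval_param ah0)[s s1 aE].
have := edge_lands ok sm hA s1.
by rewrite zr0 mulr0 addr0 -aE mulfK.
Qed.

Lemma tenths (x y u v a : R) : x / 10 <= a -> a <= y / 10 -> u <= x -> y <= v ->
  u <= a * 10 <= v.
Proof. by move=> h1 h2 h3 h4; apply/andP; split; lra. Qed.

Lemma in_range (u v m h : Z) (a : R) : zr u / 10 <= a -> a <= zr v / 10 ->
  Z.leb (Z.sub m h) u && Z.leb v (Z.add m h) -> zr m - zr h <= a * 10 <= zr m + zr h.
Proof.
move=> h1 h2 /andP[/(@zr_le R) + /(@zr_le R) +]; rewrite zrB zrD.
exact: tenths.
Qed.

Lemma left_lands i (P : R * R) (A : 'M[R]_2) (b : R) : approximates (boxes i) P A ->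
  zr (box_bottom i) / 10 <= b <= zr (box_top i) / 10 ->
  lands i Left (affine_pt P A (zr (box_left i) / 10, b)).
Proof.
move=> hA /andP[b1 b2]; case: i hA b1 b2 => hA b1 b2.
  by apply: (vertical_edge_lands edge1_left) => //; apply: in_range b1 b2 _.
by apply: (vertical_edge_lands edge0_left) => //; apply: in_range b1 b2 _.
Qed.

Lemma right_lands i (P : R * R) (A : 'M[R]_2) (b : R) : approximates (boxes i) P A ->
  zr (box_bottom i) / 10 <= b <= zr (box_top i) / 10 ->
  lands i Right (affine_pt P A (zr (box_right i) / 10, b)).
Proof.
move=> hA /andP[b1 b2]; case: i hA b1 b2 => hA b1 b2.
  by apply: (vertical_edge_lands edge1_right) => //; apply: in_range b1 b2 _.
(* The cuts are the upper ends of the lower two certified pieces; each piece overlaps its neighbour,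
   so the cut points are covered. *)
have [b3|/ltW b3] := leP b (zr (-1366) / 10).
  by apply: (vertical_edge_lands edge0_right_bottom) => //; apply: in_range b1 b3 _.
have [b4|/ltW b4] := leP b (zr (-499) / 10).
  by apply: (vertical_edge_lands edge0_right_mid) => //; apply: in_range b3 b4 _.
by apply: (vertical_edge_lands edge0_right_top) => //; apply: in_range b4 b2 _.
Qed.

Lemma bottom_lands i (P : R * R) (A : 'M[R]_2) (a : R) : approximates (boxes i) P A ->
  zr (box_left i) / 10 <= a <= zr (box_right i) / 10 ->
  lands i Entry (affine_pt P A (a, zr (box_bottom i) / 10)).
Proof.
move=> hA /andP[b1 b2]; case: i hA b1 b2 => hA b1 b2.
  by apply: (horizontal_edge_lands edge1_bottom) => //; apply: in_range b1 b2 _.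
by apply: (horizontal_edge_lands edge0_bottom) => //; apply: in_range b1 b2 _.
Qed.

Lemma top_lands i (P : R * R) (A : 'M[R]_2) (a : R) : approximates (boxes i) P A ->
  zr (box_left i) / 10 <= a <= zr (box_right i) / 10 ->
  lands i Entry (affine_pt P A (a, zr (box_top i) / 10)).
Proof.
move=> hA /andP[b1 b2]; case: i hA b1 b2 => hA b1 b2.
  by apply: (horizontal_edge_lands edge1_top) => //; apply: in_range b1 b2 _.
by apply: (horizontal_edge_lands edge0_top) => //; apply: in_range b1 b2 _.
Qed.
End edge_images.

(** * Covering relations *)

Section strips.
Variable R : realType.

Lemma continuous_fst_comp (T : topologicalType) (f : T -> R * R) :
  continuous f -> continuous (fun z => (f z).1).
Proof. by move=> cf z; apply: (continuous_comp (cf z)); exact: cvg_fst. Qed.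

Lemma continuous_snd_comp (T : topologicalType) (f : T -> R * R) :
  continuous f -> continuous (fun z => (f z).2).
Proof. by move=> cf z; apply: (continuous_comp (cf z)); exact: cvg_snd. Qed.

Lemma continuous_pair (T : topologicalType) (f g : T -> R) :
  continuous f -> continuous g -> continuous (fun z => (f z, g z)).
Proof. by move=> cf cg z; apply: (cvg_pair (cf z) (cg z)). Qed.

Lemma square_compact : compact (@square R).
Proof.
exact: (compact_setX (segment_compact (a := -1) (b := 1)) (segment_compact (a := -1) (b := 1))).
Qed.

Lemma squareP (z : R * R) : square z <-> `|z.1| <= 1 /\ `|z.2| <= 1.
Proof. by rewrite /square /= !in_itv /= !ler_norml. Qed.

Lemma continuous_bounded_square (f : R * R -> R) : continuous f ->
  exists C, forall z, square z -> `|f z| <= C.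
Proof.
move=> cf.
have /compact_bounded[C [_ hC]] : compact (f @` @square R).
  by apply: continuous_compact square_compact; exact: continuous_subspaceT.
exists (C + 1) => z sz; apply: (hC (C + 1)); first by rewrite ltrDl.
by exists z.
Qed.

Lemma continuous_segment_meets (f : R -> R) (a b c : R) : a <= b -> continuous f ->
  f a <= c <= f b -> exists2 x, a <= x <= b & f x = c.
Proof.
move=> ab cf /andP[h1 h2].
have [||x xab fx] := @IVT R f a b c ab.
- exact: continuous_subspaceT.
- by rewrite ge_min h1/= le_max h2 orbT.
- by exists x => //; move: xab; rewrite in_itv.
Qed.

(* The vertical ray from the image of a bad point leaves the image of the
   square, hence meets the image of its boundary, outside the strip. *)
Lemma boundary_strip (phi psi : R * R -> R * R) : continuous phi -> continuous psi ->
  cancel phi psi -> cancel psi phi ->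
  (forall z, square z -> `|z.1| = 1 \/ `|z.2| = 1 -> `|(phi z).2| < 1) ->
  forall z, square z -> `|(phi z).2| < 1.
Proof.
move=> cphi cpsi phiK psiK hb z sz; rewrite ltNge; apply/negP => h.
pose s : R := Num.sg (phi z).2.
have s1 : `|s| = 1 by rewrite normr_sg; case: eqP h => // ->; rewrite normr0 ler10.
have sE : (phi z).2 = s * `|(phi z).2| by rewrite /s -numEsg.
pose w (r : R) := psi ((phi z).1, (phi z).2 + s * r).
have cw : continuous w.
  move=> r; apply: (@continuous_comp _ _ _ (fun r => ((phi z).1, (phi z).2 + s * r)) psi);
    last exact: cpsi.
  apply: continuous_pair r; first by move=> r; exact: cst_continuous.
  move=> r; apply: (@continuousD _ _ _ (cst (phi z).2) (fun r => s * r)).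
    exact: cst_continuous.
  by apply: (@continuousM _ _ (cst s) id); [exact: cst_continuous|exact: cvg_id].
(* The maximum norm of the point pulled back from the ray: at most 1 at r = 0, and at least 1 once
   the ray has left the image of the square. Where it equals 1 the ray meets the image of the
   boundary. *)
pose m r := Num.max `|(w r).1| `|(w r).2|.
have cm : continuous m.
  move=> r; apply: (@continuous_max _ _ (fun r => `|(w r).1|) (fun r => `|(w r).2|)).
    apply: (@continuous_comp _ _ _ (fun r => (w r).1) Num.norm); last exact: norm_continuous.
    exact: continuous_fst_comp.
  apply: (@continuous_comp _ _ _ (fun r => (w r).2) Num.norm); last exact: norm_continuous.
  exact: continuous_snd_comp.
have phiw r : `|(phi (w r)).2| = `| `|(phi z).2| + r|.
  by rewrite psiK /= {1}sE -mulrDr normrM s1 mul1r.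
have [C hC] := continuous_bounded_square (continuous_snd_comp cphi).
have C0 : 0 <= C by apply: le_trans (hC _ sz).
have m0 : m 0 <= 1.
  rewrite /m /w mulr0 addr0 -surjective_pairing phiK ge_max.
  by have [-> ->] := (squareP z).1 sz.
have mC : 1 <= m (C + 1).
  rewrite leNgt; apply/negP; rewrite gt_max => /andP[/ltW h1 /ltW h2].
  have := hC _ ((squareP (w (C + 1))).2 (conj h1 h2)).
  by rewrite phiw ger0_norm ?addr_ge0//; have := normr_ge0 (phi z).2; lra.
have C1 : 0 <= C + 1 by lra.
have [r /andP[r0 _] mr] := continuous_segment_meets C1 cm (introT andP (conj m0 mC)).
have sw : square (w r).
  by apply/squareP; split; rewrite -mr /m le_max lexx ?orbT.
have bw : `|(w r).1| = 1 \/ `|(w r).2| = 1.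
  by move: mr; rewrite /m /Num.max; case: ifP => _ ->; [right|left].
have := hb _ sw bw; rewrite phiw ger0_norm ?addr_ge0//; lra.
Qed.

Let blend (t x y : R) : 0 <= t -> t <= 1 -> 1 < x -> 1 < y -> 1 < (1 - t) * x + t * y.
Proof.
move=> t0 t1 x1 y1; pose c := Num.min x y.
have c1 : 1 < c by rewrite lt_min x1 y1.
have cx : c <= x by rewrite ge_min lexx.
have cy : c <= y by rewrite ge_min lexx orbT.
have h1 : 0 <= (1 - t) * (x - c) by apply: mulr_ge0; rewrite subr_ge0.
have h2 : 0 <= t * (y - c) by apply: mulr_ge0; rewrite ?subr_ge0.
lra.
Qed.

Definition crosses (F : R * R -> R * R) (M N : hset R) : Prop :=
  [/\ forall z, square z -> `|(chart N (F (chart_inv M z))).2| < 1,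
      forall y, `|y| <= 1 -> (chart N (F (chart_inv M (-1, y)))).1 < -1
    & forall y, `|y| <= 1 -> 1 < (chart N (F (chart_inv M (1, y)))).1].

Lemma crosses_covers (F : R * R -> R * R) (M N : hset R) : continuous F ->
  crosses F M N -> covers F M N.
Proof.
move=> cF [hs hl hr].
pose g z := chart N (F (chart_inv M z)).
have cg : continuous g.
  move=> z; apply: (@continuous_comp _ _ _ (fun z => F (chart_inv M z)) (chart N));
    last exact: chart_continuous.
  by apply: (@continuous_comp _ _ _ (chart_inv M) F); [exact: chart_inv_continuous|exact: cF].
pose h (u : R * (R * R)) : R * R :=
  ((1 - u.1) * (g u.2).1 + u.1 * (2 * u.2.1), (1 - u.1) * (g u.2).2).
exists h, (GRing.scale (2 : R) : {linear R^o -> R^o}); split.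
- apply: continuous_subspaceT.
  have c1 : continuous (fun u : R * (R * R) => u.1) by move=> u; exact: cvg_fst.
  have c2 : continuous (fun u : R * (R * R) => u.2) by move=> u; exact: cvg_snd.
  have cg2 : continuous (fun u : R * (R * R) => g u.2).
    by move=> u; apply: (@continuous_comp _ _ _ (fun u : R * (R * R) => u.2) g u (c2 u)); exact: cg.
  have c1' : continuous (fun u : R * (R * R) => 1 - u.1).
    by move=> u; apply: continuousB; [exact: cst_continuous|exact: c1].
  have mulC (f k : R * (R * R) -> R) : continuous f -> continuous k ->
      continuous (fun u => f u * k u).
    by move=> cf ck u; exact: (continuousM (cf u) (ck u)).
  apply: continuous_pair; last by apply: mulC => //; exact: continuous_snd_comp.
  have d1 := mulC _ _ c1' (continuous_fst_comp cg2).
  have d2 := mulC _ _ c1 (mulC _ _ (@cst_continuous _ _ (2 : R)) (continuous_fst_comp c2)).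
  by move=> u; exact: (continuousD (d1 u) (d2 u)).
- by move=> z _; rewrite /h /= subr0 !mul1r mul0r addr0 -surjective_pairing.
- have b2 : (1 : R) < 2 by lra.
  split=> t z.
  + move=> /andP[t0 t1] [/= zl]; rewrite in_itv /= -ler_norml => z2.
    move=> /squareP[+ _]; rewrite /h /= => /ler_normlP[h1 h2].
    case: z zl z2 h1 h2 => x y /= [->|->] hy; rewrite -/(g _).
      have hg := hl _ hy; rewrite -/(g _) in hg => h1 _.
      have b1 : 1 < - (g (-1, y)).1 by lra.
      by have := blend t0 t1 b1 b2; lra.
    have hg := hr _ hy; rewrite -/(g _) in hg => _ h2.
    by have := blend t0 t1 hg b2; lra.
  + move=> /andP[t0 t1] /hs; rewrite -/(g _) => hg [/= _].
    have : `|(1 - t) * (g z).2| < 1.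
      rewrite normrM ger0_norm ?subr_ge0//.
      have h1 : 0 <= t * `|(g z).2| by apply: mulr_ge0.
      lra.
    by move=> + [|] E; rewrite E ?normrN normr1 ltxx.
- by move=> x y _; rewrite /h /= subrr !mul0r add0r mul1r.
- move=> x hx; change (~ (-1 < (2 : R) * x < 1)).
  by case: hx => ->; rewrite ?mulr1 ?mulrN1 => /andP[]; lra.
Qed.
End strips.

(** * Symbolic dynamics *)

Section crossing.
Variable R : realType.

Lemma last_crossing (f : R -> R) (a b c : R) : continuous f -> a <= b -> f a <= c -> c < f b ->
  exists2 x, a <= x <= b & f x = c /\ forall t, x < t <= b -> c < f t.
Proof.
move=> cf ab fa fb.
pose E := [set t | a <= t <= b /\ f t <= c].
have Ea : E a by rewrite /E /= lexx ab.
have Eb : has_ubound E by exists b => t [/andP[]].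
have cE : closed E.
  have -> : E = `[a, b] `&` (f @^-1` [set y | y <= c]).
    by apply/seteqP; split=> t /=; rewrite in_itv.
  apply: closedI; first exact: itv_closed.
  apply: closed_comp; [by move=> ? _; exact: cf|exact: closed_le].
have Es : E (sup E) by apply: cE; apply: closure_sup => //; exists a.
have [/andP[as_ sb] fs] := Es.
have after t : sup E < t <= b -> c < f t.
  move=> /andP[st tb]; rewrite ltNge; apply/negP => ft.
  have : E t by split=> //; rewrite tb (le_trans as_ (ltW st)).
  by move/(ub_le_sup Eb); rewrite leNgt st.
exists (sup E); rewrite ?as_ //; split=> //; apply/eqP; rewrite eq_le fs /= leNgt.
apply/negP => fsc.
have [x /andP[sx xb] fx] := continuous_segment_meets sb cf (introT andP (conj fs (ltW fb))).
have : sup E < x by rewrite lt_neqAle sx andbT; apply/eqP => E'; rewrite E' fx ltxx in fsc.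
by move=> h; have := after x; rewrite h xb fx ltxx => /(_ isT).
Qed.

(** The last crossing for the function -f(-t). *)
Lemma first_crossing (f : R -> R) (a b c : R) : continuous f -> a <= b -> f a < c -> c <= f b ->
  exists2 x, a <= x <= b & f x = c /\ forall t, a <= t < x -> f t < c.
Proof.
move=> cf ab fa fb.
have cg : continuous (fun t => - f (- t)).
  move=> t; apply: (@continuousN _ _ _ (fun t => f (- t))).
  by apply: (@continuous_comp _ _ _ -%R f); [exact: opp_continuous|exact: cf].
have [|||x /andP[x1 x2] [gx hx]] := @last_crossing _ (- b) (- a) (- c) cg.
- by rewrite lerN2.
- by rewrite opprK lerN2.
- by rewrite opprK ltrN2.
exists (- x); first by rewrite lerNr x2 lerNl x1.
split=> [|t /andP[t1 t2]]; first by rewrite -[LHS]opprK gx opprK.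
by have := hx (- t); rewrite opprK ltrN2; apply; rewrite ltrNr t2 lerN2.
Qed.

End crossing.

Section symbolic.
Variables (R : realType) (C : topologicalType) (H : topologicalType).
Variables (N : bool -> hset R) (F : bool -> R * R -> R * R).
Variables (q : R * R -> C) (G : C -> C) (eta : C -> H).
Hypothesis hausH : hausdorff_space H.
Hypothesis contF : forall i, continuous (F i).
Hypothesis contq : continuous q.
Hypothesis conteta : continuous eta.
Hypothesis injG : injective G.
Hypothesis liftF : forall i z, q (F i z) = G (q z).
Hypothesis crossF : forall i j, crosses (F i) (N i) (N j).
Hypothesis injq : forall i j z w, supp (N i) z -> supp (N j) w ->
  eta (q z) = eta (q w) -> z = w.
Hypothesis disjN : forall z, supp (N false) z -> ~ supp (N true) z.

Local Notation S i := (supp (N i)).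
Local Notation T := (prod_topology (fun _ : int => (R * R)%type)).

Let suppP i z : S i z <-> square (chart (N i) z).
Proof.
rewrite -(chart_supp (N i)); split=> [Sz|[w Sw /(can_inj (chartK (N i))) <-//]].
by exists z.
Qed.

Fixpoint traj (c : nat -> bool) k z :=
  if k is k'.+1 then traj (fun m => c m.+1) k' (F (c 0%N) z) else z.

Lemma trajS c k z : traj c k.+1 z = F (c k) (traj c k z).
Proof. by elim: k c z => [//|k IH] c z; rewrite [LHS]IH. Qed.

(* A curve crossing the first h-set from left to right contains a subcurve whose
   image crosses the next one. *)
Lemma curve_crossing n (c : nat -> bool) (g : R -> R * R) (a b : R) :
  continuous g -> a <= b -> (forall t, a <= t <= b -> S (c 0%N) (g t)) ->
  (chart (N (c 0%N)) (g a)).1 = -1 -> (chart (N (c 0%N)) (g b)).1 = 1 ->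
  exists2 t, a <= t <= b & forall k, (k <= n)%N -> S (c k) (traj c k (g t)).
Proof.
elim: n c g a b => [|n IH] c g a b cg ab hS ga gb.
  by exists a; rewrite ?lexx// => k; rewrite leqn0 => /eqP ->; apply: hS; rewrite lexx.
have cF : continuous (fun t => F (c 0%N) (g t)).
  by move=> t; apply: (@continuous_comp _ _ _ g (F (c 0%N))); [exact: cg|exact: contF].
pose v t := chart (N (c 1%N)) (F (c 0%N) (g t)).
have cv : continuous v.
  move=> t; apply: (@continuous_comp _ _ _ (fun t => F (c 0%N) (g t)) (chart (N (c 1%N)))).
    exact: cF.
  exact: chart_continuous.
have [hs hl hr] := crossF (c 0%N) (c 1%N).
have hv t : a <= t <= b -> `|(v t).2| < 1.
  move=> /hS/suppP/hs; by rewrite chartK.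
have edge t : a <= t <= b -> `|(chart (N (c 0%N)) (g t)).2| <= 1.
  by move=> /hS/suppP/squareP[].
have va : (v a).1 < -1.
  have := hl _ (edge a _); rewrite -ga -surjective_pairing chartK; apply.
  by rewrite lexx.
have vb : 1 < (v b).1.
  have := hr _ (edge b _); rewrite -gb -surjective_pairing chartK gb; apply.
  by rewrite lexx ab.
have cv1 := continuous_fst_comp cv.
have lt11 : (-1 : R) < 1 by lra.
(* After its last passage through -1 and before its next passage through 1 the exit coordinate stays
   between -1 and 1, so this piece of the image curve lies in the next box and crosses it. *)
have [a' /andP[aa' a'b] [va' ha']] := last_crossing cv1 ab (ltW va) (lt_trans lt11 vb).
have va'1 : (v a').1 < 1 by rewrite va'.
have [b' /andP[a'b' b'b] [vb' hb']] := first_crossing cv1 a'b va'1 (ltW vb).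
have [|t /andP[t1 t2] ht] :=
  IH (fun m => c m.+1) (fun t => F (c 0%N) (g t)) a' b' cF a'b' _ va' vb'.
  move=> t /andP[t1 t2]; apply/suppP/squareP; rewrite -/(v t).
  have hab : a <= t <= b by rewrite (le_trans aa' t1) (le_trans t2 b'b).
  split; last exact: ltW (hv _ hab).
  have [<-|ta'] := eqVneq a' t; first by rewrite va' normrN normr1.
  have [->|tb'] := eqVneq t b'; first by rewrite vb' normr1.
  have {}t1 : a' < t by rewrite lt_neqAle ta'.
  have {}t2 : t < b' by rewrite lt_neqAle tb'.
  have h1 : -1 < (v t).1 by apply: ha'; rewrite t1 (le_trans (ltW t2) b'b).
  have h2 : (v t).1 < 1 by apply: hb'; rewrite (ltW t1) t2.
  by apply/ler_normlP; split; lra.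
have tab : a <= t <= b by rewrite (le_trans aa' t1) (le_trans t2 b'b).
by exists t => // -[|k] kn; [exact: hS|exact: ht].
Qed.

Definition itinerary (x : T) : Sigma2 := fun n => `[< S true (x n) >].

(** Orbits are sequences in the plane: each step applies the lift attached to the box that contains
    the point, so the next point is again in one of the two planar boxes and no representative has
    to be chosen. *)
Definition orbits : set T :=
  [set x | forall n : int, exists i, S i (x n) /\ x (n + 1) = F i (x n)].

Definition step_in (n : int) (i : bool) : set T :=
  [set x | S i (x n) /\ x (n + 1) = F i (x n)].

Lemma eval_continuous n : continuous (fun x : T => x n).
Proof. exact: (@proj_continuous int (fun _ => (R * R)%type) n). Qed.

Lemma supp_closed i : closed (S i).
Proof.
apply: compact_closed; last exact: supp_compact.
exact: norm_hausdorff.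
Qed.

Lemma step_in_closed n i : closed (step_in n i).
Proof.
apply: (@closedI _ [set x : T | S i (x n)] [set x | x (n + 1) = F i (x n)]).
  apply: (@closed_comp _ _ (fun x : T => x n)) => [x _|]; last exact: supp_closed.
  exact: eval_continuous.
have -> : [set x : T | x (n + 1) = F i (x n)] = (fun x : T => x (n + 1) - F i (x n)) @^-1` [set 0].
  by apply/seteqP; split=> x /= => [->|/subr0_eq]; rewrite ?subrr.
apply: closed_comp => [x _|].
  apply: continuousB; first exact: eval_continuous.
  apply: (@continuous_comp _ _ _ (fun x : T => x n) (F i)); first exact: eval_continuous.
  exact: contF.
apply: accessible_closed_set1; apply: hausdorff_accessible; exact: norm_hausdorff.
Qed.

Definition sequences : set T := [set x | forall n : int, (S false `|` S true) (x n)].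

Lemma sequences_compact : compact sequences.
Proof.
apply: (@tychonoff int (fun _ => (R * R)%type) (fun _ => S false `|` S true)) => _.
by apply: compactU; exact: supp_compact.
Qed.

Lemma orbits_compact : compact orbits.
Proof.
apply: (subclosed_compact _ sequences_compact).
  have -> : orbits = \bigcap_n (step_in n false `|` step_in n true).
    apply/seteqP; split=> x h n; last by have [//|?|?] := h n; [exists false|exists true].
    by move=> _; have [[] hi] := h n; [right|left].
  by apply: closed_bigI => n _; apply: closedU; exact: step_in_closed.
by move=> x h n; have [[] [hi _]] := h n; [right|left].
Qed.

(** The horizontal midline of the box for time -n is a curve crossing it; following it for 2 n steps
    realises the window, and the indices are then recentred. *)
Lemma window_exists (c : int -> bool) (n : nat) : exists2 x : T, sequences x &
  forall k : int, - n%:Z <= k < n%:Z -> step_in k (c k) x.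
Proof.
pose c' k := c (k%:Z - n%:Z).
have seg (x : R) : -1 <= x <= 1 -> square (x, 0).
  by move=> hx; apply/squareP; rewrite normr0 ler_norml hx; split.
have csq : continuous (fun t : R => chart_inv (N (c' 0%N)) (t, 0)).
  move=> t; apply: (@continuous_comp _ _ _ (fun t : R => (t, 0 : R)) (chart_inv (N (c' 0%N)))).
    by apply: continuous_pair => s; [exact: cvg_id|exact: cst_continuous].
  exact: chart_inv_continuous.
have le11 : (-1 : R) <= 1 by lra.
have [|||t _ ht] := @curve_crossing n.*2 c' _ _ _ csq le11.
- by move=> t ht; apply/suppP; rewrite chart_invK; exact: seg.
- by rewrite chart_invK.
- by rewrite chart_invK.
set z := chart_inv _ _ in ht.
(* Outside the window the sequence is filled with the centre of a box, which keeps it in the compact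
   set [sequences]. *)
pose x (m : int) : R * R := if (- n%:Z <= m <= n%:Z) then traj c' (absz (m + n%:Z)) z
  else chart_inv (N false) (0, 0).
have xin m : - n%:Z <= m <= n%:Z -> S (c m) (x m).
  move=> hm; rewrite /x hm; have := ht (absz (m + n%:Z)).
  have -> : c' (absz (m + n%:Z)) = c m by rewrite /c'; congr c; lia.
  by apply; lia.
exists (x : T) => [m|k hk].
  case hm: (- n%:Z <= m <= n%:Z).
    by have := xin m hm; case: (c m); [right|left].
  left; rewrite /x hm; apply/suppP; rewrite chart_invK; apply: seg.
  by apply/andP; lra.
split; first by apply: xin; lia.
rewrite /x; have -> : - n%:Z <= k + 1 <= n%:Z by lia.
have -> : - n%:Z <= k <= n%:Z by lia.
have -> : absz (k + 1 + n%:Z) = (absz (k + n%:Z)).+1 by lia.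
by rewrite trajS; congr (F _ _); rewrite /c'; congr c; lia.
Qed.

(** A cluster point of the windows: for each k the closed condition [step_in k (c k)] holds for all
    windows with n > |k|, hence in the limit. *)
Lemma orbit_exists (c : int -> bool) : exists x : T, forall k, step_in k (c k) x.
Proof.
have /choice[w wP] : forall n : nat, exists x : T, sequences x /\
    forall k : int, - n%:Z <= k < n%:Z -> step_in k (c k) x.
  by move=> n; have [x h1 h2] := window_exists c n; exists x.
have Fs : (w @ \oo) sequences by exists 0%N => // n _; have [] := wP n.
have [x [_ clx]] := sequences_compact (fmap_proper_filter w eventually_filter) Fs.
exists x => k; apply: step_in_closed => U Ux.
have Fk : (w @ \oo) (step_in k (c k)).
  by exists (absz k).+1 => // n /= hn; have [_ h] := wP n; apply: h; lia.
have [y [hy Uy]] := clx _ _ Fk Ux.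
by exists y.
Qed.

Lemma orbits_inj x y : orbits x -> orbits y -> eta (q (x 0)) = eta (q (y 0)) -> x = y.
Proof.
move=> ox oy xy.
have step (z : T) n : orbits z -> q (z (n + 1)) = G (q (z n)).
  by move=> oz; have [i [_ ->]] := oz n; rewrite liftF.
have eq0 n : eta (q (x n)) = eta (q (y n)) -> x n = y n.
  by have [i [hi _]] := ox n; have [j [hj _]] := oy n; exact: injq hi hj.
suff E n : q (x n) = q (y n) by apply/funext => n; apply: eq0; rewrite E.
have q0 : q (x 0) = q (y 0) by rewrite (eq0 _ xy).
elim/int_rect: n => [//|n IH|n IH].
  by rewrite -addn1 PoszD !step// IH.
apply: injG; rewrite -!step//.
by have -> : - n.+1%:Z + 1 = - n%:Z :> int by lia.
Qed.

Lemma itinerary_step x c : (forall k, step_in k (c k) x) -> itinerary x = c.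
Proof.
move=> h; apply/funext => n; rewrite /itinerary; have [+ _] := h n.
by case: (c n) => hn; [apply/asboolT|apply/asboolF/(disjN hn)].
Qed.

Definition shift_orbit (m : int) (x : T) : T := fun n => x (n + m).

Lemma orbits_shift m x : orbits x -> orbits (shift_orbit m x).
Proof. by move=> h n; rewrite /shift_orbit addrAC; exact: h. Qed.

Lemma itinerary_shift x : itinerary (shift_orbit 1 x) = shift_map (itinerary x).
Proof. by []. Qed.

(** By [orbits_inj] only one orbit passes through a point of the invariant set, so there the choice
    made by [xget] does not affect the value. *)
Definition code (p : C) : Sigma2 :=
  itinerary (xget (fun _ => (0, 0)) [set x : T | orbits x /\ q (x 0) = p]).

Lemma codeE x : orbits x -> code (q (x 0)) = itinerary x.
Proof.
move=> ox; rewrite /code; case: xgetP => [y _ [oy yx]|/(_ x)]; last by case.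
by congr itinerary; apply: orbits_inj => //; rewrite yx.
Qed.

Definition invariant_set : set C := (fun x : T => q (x 0)) @` orbits.

Lemma base_continuous : continuous (fun x : T => q (x 0)).
Proof.
move=> x; apply: (@continuous_comp _ _ _ (fun x : T => x 0) q); first exact: eval_continuous.
exact: contq.
Qed.

(** The orbits with the opposite symbol at time n form a compact set. Its image under [eta] is
    closed, as [H] is Hausdorff, and misses the image of the present point by [orbits_inj]; the
    complement gives the neighbourhood. Separation is needed in [H] only, not in [C]. *)
Lemma code_locally_constant n p : invariant_set p ->
  \forall p' \near p, invariant_set p' -> code p' n = code p n.
Proof.
move=> [x ox <-]; rewrite codeE//.
set b := itinerary x n.
pose D := (fun y : T => eta (q (y 0))) @` (orbits `&` [set y | S (~~ b) (y n)]).
have cD : compact D.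
  apply: continuous_compact.
    apply: continuous_subspaceT => y.
    apply: (@continuous_comp _ _ _ (fun y : T => q (y 0)) eta); first exact: base_continuous.
    exact: conteta.
  apply: compact_closedI; first exact: orbits_compact.
  apply: (@closed_comp _ _ (fun x : T => x n)) => [y _|]; last exact: supp_closed.
  exact: eval_continuous.
have oD : open (~` D) by rewrite openC; exact: compact_closed.
have itE (y : T) i : S i (y n) -> itinerary y n = i.
  by rewrite /itinerary; case: i => h; [apply/asboolT|apply/asboolF/(disjN h)].
have xD : (~` D) (eta (q (x 0))).
  move=> [y [oy Sy] /(orbits_inj oy ox) yx]; move: (itE _ _ Sy).
  by rewrite yx -/b; case: (b).
have := conteta (open_nbhs_nbhs (conj oD xD)); rewrite /nbhs/= => h.
near=> p' => -[y oy yp]; rewrite -yp codeE//.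
have : (~` D) (eta p') by near: p'; exact: h.
rewrite -yp => yD; have [i [Si _]] := oy n.
have [ib|ib] := eqVneq i b; first by rewrite (itE _ _ Si).
exfalso; apply: yD; exists y => //; split=> //=.
by move: Si ib; case: (i); case: (b).
Unshelve. all: by end_near. Qed.

Lemma code_continuous : {within invariant_set, continuous code}.
Proof.
apply/subspace_continuousP => p Ip; apply/cvg_sup => n U [V [[W oW <-] Wp WU]].
apply: filterS WU _; rewrite /= nbhs_simpl /=.
have := code_locally_constant n Ip; rewrite /within /=; apply: filterS => p' h /h E.
by change (W (code p' n)); rewrite E; exact: Wp.
Qed.

End symbolic.

Lemma symbolic_dynamics_of_crosses (R : realType) (H : topologicalType)
    (N : bool -> hset R) (F : bool -> R * R -> R * R)
    (G : cylinder R -> cylinder R) (eta : cylinder R -> H) :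
  hausdorff_space H -> (forall i, continuous (F i)) -> continuous (@to_cylinder R) ->
  continuous eta -> injective G ->
  (forall i z, to_cylinder (F i z) = G (to_cylinder z)) ->
  (forall i j, crosses (F i) (N i) (N j)) ->
  (forall i j z w, supp (N i) z -> supp (N j) w ->
    eta (to_cylinder z) = eta (to_cylinder w) -> z = w) ->
  (forall z, supp (N false) z -> ~ supp (N true) z) ->
  symbolic_dynamics G.
Proof.
move=> hausH contF contq conteta injG liftF crossF injq disjN.
pose q := @to_cylinder R.
have stepq x n : orbits N F x -> q (x (n + 1)) = G (q (x n)).
  by move=> ox; have [i [_ ->]] := ox n; exact: liftF.
have E := codeE injG liftF injq.
exists (invariant_set N F q), (code N F q); split.
- apply: continuous_compact; last exact: orbits_compact.
  by apply: continuous_subspaceT; exact: base_continuous.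
- apply/seteqP; split=> [_ [_ [x ox <-] <-]|_ [x ox <-]].
    exists (shift_orbit 1 x); first exact: orbits_shift.
    exact: (stepq x 0).
  exists (q (x (-1))); last by rewrite -stepq// addNr.
  exists (shift_orbit (-1) x); first exact: orbits_shift.
  by rewrite /shift_orbit add0r.
- exact: (code_continuous hausH contF contq conteta injG liftF injq disjN).
- apply/seteqP; split=> // c _.
  have [x hx] := orbit_exists contF crossF c.
  have ox : orbits N F x by move=> n; exists (c n); exact: hx.
  exists (q (x 0)); first by exists x.
  by rewrite E// (itinerary_step disjN hx).
- move=> _ [x ox <-].
  by rewrite -stepq// add0r (E x ox) -itinerary_shift -(E _ (orbits_shift 1 ox)).
Qed.

(** * The two boxes *)

Section lifts.
Variable R : realType.
Local Notation zr := (@zr R).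

Definition lift_map_inv (i : bool) (z : R * R) : R * R :=
  period_map_inv (1 / 10) (79 / 100) (z.1 + (if i then 3 else 2 : int)%:~R * pi, z.2).

Let ecc : `|1 / 10 : R| < 1 := satellite_eccentricity R.

Lemma shift_continuous (c : R) : continuous (fun z : R * R => (z.1 + c, z.2)).
Proof.
apply: continuous_pair => z; last exact: cvg_snd.
by apply: (@continuousD _ _ _ fst (cst c)); [exact: cvg_fst|exact: cst_continuous].
Qed.

Lemma lift_continuous i : continuous (@lift_map R i).
Proof.
move=> z; apply: (@continuous_comp _ _ _ (period_map (1 / 10) (79 / 100))
  (fun z : R * R => (z.1 - (if i then 3 else 2 : int)%:~R * pi, z.2))).
  exact: (period_map_continuous ecc).
exact: shift_continuous.
Qed.

Lemma lift_inv_continuous i : continuous (lift_map_inv i).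
Proof.
move=> z; apply: (@continuous_comp _ _ _
  (fun z : R * R => (z.1 + (if i then 3 else 2 : int)%:~R * pi, z.2))
  (period_map_inv (1 / 10) (79 / 100))).
  exact: shift_continuous.
exact: (period_map_inv_continuous ecc).
Qed.

Lemma liftK i : cancel (@lift_map R i) (lift_map_inv i).
Proof.
move=> z; rewrite /lift_map /lift_map_inv /= subrK -surjective_pairing.
exact: (period_mapK _ ecc).
Qed.

Lemma lift_invK i : cancel (lift_map_inv i) (@lift_map R i).
Proof.
move=> z; rewrite /lift_map /lift_map_inv (period_map_invK _ ecc) /= addrK.
by rewrite -surjective_pairing.
Qed.

Lemma to_cylinder_eqP (z w : R * R) :
  to_cylinder z = to_cylinder w <-> exists m : int, z = (w.1 + m%:~R * pi, w.2).
Proof.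
split=> [[/to_circle_eqP[m zw] z2]|[m ->]].
  by exists m; rewrite -zw addrC subrK -z2 -surjective_pairing.
by congr (_, _); apply/to_circle_eqP; exists m; rewrite addrC addKr.
Qed.

Lemma poincare_lift i (z : R * R) :
  to_cylinder (lift_map i z) = poincare (1 / 10) (79 / 100) (to_cylinder z).
Proof.
rewrite (poincare_period_map _ ecc); apply/to_cylinder_eqP.
by exists (- (if i then 3 else 2)); rewrite mulrNz mulNr.
Qed.

Lemma to_cylinder_surj (p : cylinder R) : exists z, p = to_cylinder z.
Proof.
case: p => p y; exists (repr p, y); congr (_, _).
by rewrite /to_circle reprK.
Qed.

Lemma poincare_inj : injective (poincare (1 / 10 : R) (79 / 100)).
Proof.
move=> p p'; have [z ->] := to_cylinder_surj p; have [w ->] := to_cylinder_surj p'.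
rewrite !(poincare_period_map _ ecc) => /to_cylinder_eqP[m].
rewrite -(period_mapD_pi _ ecc) => /(can_inj (period_mapK _ ecc)) zw.
by apply/to_cylinder_eqP; exists m.
Qed.

Lemma to_cylinder_continuous : continuous (@to_cylinder R).
Proof.
have cpi : continuous (fun z : R * R => to_circle pi z.1).
  move=> z; apply: (@continuous_comp _ _ _ (fst : R * R -> R) (to_circle pi)).
    exact: cvg_fst.
  exact: pi_continuous.
by move=> z; apply: (cvg_pair (cpi z) (@cvg_snd _ _ (nbhs z.1) (nbhs z.2) _)).
Qed.

(** The map to a Hausdorff space required by the symbolic argument. It does not depend on the
    representative of theta modulo pi, and it is injective where theta is within pi / 4 of pi / 2,
    which contains both boxes. *)
Definition sine_height (p : cylinder R) : R * R := (sin (2 * repr p.1), p.2).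

Lemma sine_heightE z : sine_height (to_cylinder z) = (sin (2 * z.1), z.2).
Proof.
rewrite /sine_height; congr (_, _).
have [m mE] := (to_circle_eqP pi (repr (to_circle pi z.1)) z.1).1 (reprK _).
have -> : 2 * repr (to_circle pi z.1) = 2 * z.1 + m%:~R * (2 * pi).
  by rewrite -(subrK z.1 (repr _)) mE; ring.
by rewrite sinD_period.
Qed.

Lemma sine_height_continuous : continuous sine_height.
Proof.
apply: continuous_pair => p; last exact: cvg_snd.
apply: (@continuous_comp _ _ _ (fst : cylinder R -> circle pi)
  ((fun x : R => sin (2 * x)) \o repr)).
  exact: cvg_fst.
apply: repr_comp_continuous => [x|x y /eqP xy].
  have c2 : {for x, continuous (fun x : R => 2 * x)} by exact: mulrl_continuous.
  exact: (@continuous_comp _ _ _ (fun x : R => 2 * x) (@sin R) x c2 (@continuous_sin R _)).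
have [m xyE] := (to_circle_eqP pi x y).1 xy.
have -> : 2 * x = 2 * y + m%:~R * (2 * pi) by rewrite -(subrK y x) xyE; ring.
by rewrite sinD_period.
Qed.

Lemma sin_double_inj (x y : R) : `|x - pi / 2| <= pi / 4 -> `|y - pi / 2| <= pi / 4 ->
  sin (2 * x) = sin (2 * y) -> x = y.
Proof.
have red (u : R) : `|u - pi / 2| <= pi / 4 ->
    2 * u - pi \in `[- (pi / 2), pi / 2] /\ sin (2 * u) = - sin (2 * u - pi).
  move=> /ler_normlP[h1 h2]; rewrite in_itv /=; split; first by apply/andP; split; lra.
  by rewrite -{1}(subrK pi (2 * u)) sinDpi.
move=> /red[hx ->] /red[hy ->] /oppr_inj /(sin_inj hx hy); lra.
Qed.

Lemma thousandths_lo k (n a : R) : n * 10 ^+ k <= a -> n / 1000 <= a / 10 ^+ k.+3.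
Proof.
rewrite ler_pdivlMr// => h; apply: le_trans h.
by rewrite !exprS; rewrite le_eqVlt; apply/orP; left; apply/eqP; field.
Qed.

Lemma thousandths_hi k (n a : R) : a <= n * 10 ^+ k -> a / 10 ^+ k.+3 <= n / 1000.
Proof.
rewrite ler_pdivrMr// => h; apply: (le_trans h).
by rewrite !exprS; rewrite le_eqVlt; apply/orP; left; apply/eqP; field.
Qed.

Lemma box_decimals i (mu := zr (bx_mu (boxes i)) / 10 ^+ 16)
    (ka := zr (bx_ka (boxes i)) / 10 ^+ 16) (p := zr (bx_p (boxes i)) / 10 ^+ 15) :
  if i then [/\ 733 / 1000 <= mu <= 735 / 1000, 678 / 1000 <= ka <= 679 / 1000
    & 1294 / 1000 <= p] else
  [/\ 706 / 1000 <= mu <= 708 / 1000, 706 / 1000 <= ka <= 708 / 1000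
    & p <= 1099 / 1000].
Proof.
rewrite /mu /ka /p; clear mu ka p; have p16 : zr (Z.pow 10 13) = 10 ^+ 13 := zr_pow10 R 13.
have p15 : zr (Z.pow 10 12) = 10 ^+ 12 := zr_pow10 R 12.
have lo n a : Z.leb (Z.mul n (Z.pow 10 13)) a -> zr n / 1000 <= zr a / 10 ^+ 16.
  by move=> /(@zr_le R); rewrite zrM p16 => /thousandths_lo.
have hi n a : Z.leb a (Z.mul n (Z.pow 10 13)) -> zr a / 10 ^+ 16 <= zr n / 1000.
  by move=> /(@zr_le R); rewrite zrM p16 => /thousandths_hi.
have lo' n a : Z.leb (Z.mul n (Z.pow 10 12)) a -> zr n / 1000 <= zr a / 10 ^+ 15.
  by move=> /(@zr_le R); rewrite zrM p15 => /thousandths_lo.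
have hi' n a : Z.leb a (Z.mul n (Z.pow 10 12)) -> zr a / 10 ^+ 15 <= zr n / 1000.
  by move=> /(@zr_le R); rewrite zrM p15 => /thousandths_hi.
have n733 : zr 733 = 733 by rewrite !zrE; ring.
have n735 : zr 735 = 735 by rewrite !zrE; ring.
have n678 : zr 678 = 678 by rewrite !zrE; ring.
have n679 : zr 679 = 679 by rewrite !zrE; ring.
have n1294 : zr 1294 = 1294 by rewrite !zrE; ring.
have n706 : zr 706 = 706 by rewrite !zrE; ring.
have n708 : zr 708 = 708 by rewrite !zrE; ring.
have n1099 : zr 1099 = 1099 by rewrite !zrE; ring.
case: i.
  by rewrite -n733 -n735 -n678 -n679 -n1294; split;
    rewrite ?lo ?hi ?lo' ?hi'//; vm_compute.
by rewrite -n706 -n708 -n1099; split; rewrite ?lo ?hi ?lo' ?hi'//; vm_compute.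
Qed.
End lifts.

(** * Crossings between the given h-sets and separation of the boxes *)

Section boxes_in_plane.
Variable R : realType.
Local Notation zr := (@zr R).

Definition unbox (b1 b2 b3 b4 : R) (z : R * R) : R * R :=
  ((z.1 * (b2 - b1) + b1 + b2) / 2, (z.2 * (b4 - b3) + b3 + b4) / 2).

Lemma unboxK b1 b2 b3 b4 : b1 < b2 -> b3 < b4 ->
  cancel (unbox b1 b2 b3 b4) (box_to_square b1 b2 b3 b4).
Proof.
move=> b12 b34 [x y]; have h1 : b2 - b1 != 0 by rewrite subr_eq0 gt_eqF.
have h2 : b4 - b3 != 0 by rewrite subr_eq0 gt_eqF.
by rewrite /unbox /box_to_square /=; congr (_, _); field.
Qed.

Lemma chart_inv_affine (N : hset R) P A b1 b2 b3 b4 z : b1 < b2 -> b3 < b4 ->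
  is_affine_hset N P A b1 b2 b3 b4 ->
  chart_inv N z = affine_pt P A (unbox b1 b2 b3 b4 z).
Proof.
move=> b12 b34 [_ _ hc].
by rewrite -[in RHS](chartK N (affine_pt _ _ _)) hc unboxK.
Qed.

Lemma unbox_low (b1 b2 x : R) : b1 < b2 -> (x * (b2 - b1) + b1 + b2) / 2 < b1 -> x < -1.
Proof.
move=> b12 h; have b0 : 0 < b2 - b1 by rewrite subr_gt0.
by rewrite -(ltr_pM2r b0); lra.
Qed.

Lemma unbox_high (b1 b2 x : R) : b1 < b2 -> b2 < (x * (b2 - b1) + b1 + b2) / 2 -> 1 < x.
Proof.
move=> b12 h; have b0 : 0 < b2 - b1 by rewrite subr_gt0.
by rewrite -(ltr_pM2r b0); lra.
Qed.

Lemma unbox_inside (b1 b2 x : R) : b1 < b2 ->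
  b1 < (x * (b2 - b1) + b1 + b2) / 2 < b2 -> `|x| < 1.
Proof.
move=> b12 /andP[h1 h2]; have b0 : 0 < b2 - b1 by rewrite subr_gt0.
rewrite -(ltr_pM2r b0) -{1}(gtr0_norm b0) -normrM.
by apply/ltr_normlP; split; lra.
Qed.

Lemma unbox_range (b1 b2 x : R) : b1 < b2 -> `|x| <= 1 ->
  b1 <= (x * (b2 - b1) + b1 + b2) / 2 <= b2.
Proof.
move=> b12; have b0 : 0 <= b2 - b1 by rewrite subr_ge0 ltW.
rewrite ler_norml => /andP[h1 h2].
have := ler_wpM2r b0 h1; have := ler_wpM2r b0 h2; lra.
Qed.

Definition is_box (i : bool) (N : hset R) (P : R * R) (A : 'M[R]_2) :=
  is_affine_hset N P A (zr (box_left i) / 10) (zr (box_right i) / 10)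
    (zr (box_bottom i) / 10) (zr (box_top i) / 10).

Lemma sides i : zr (box_left i) / 10 < zr (box_right i) / 10 /\
  zr (box_bottom i) / 10 < zr (box_top i) / 10.
Proof.
by split; rewrite ltr_pM2r//; apply: zr_lt; case: i.
Qed.

Lemma crosses_lift i j (N N' : hset R) P A P' A' :
  approximates (boxes i) P A -> approximates (boxes j) P' A' ->
  is_box i N P A -> is_box j N' P' A' -> crosses (lift_map i) N N'.
Proof.
move=> hA hA' hN hN'; have [lr du] := sides i; have [lr' du'] := sides j.
have inv z := chart_inv_affine z lr du hN.
have img sd z : lands i sd (chart_inv N z) ->
    let w := chart N' (lift_map i (chart_inv N z)) in
    `|w.2| < 1 /\ match sd with Left => w.1 < -1 | Right => 1 < w.1 | Entry => true end.
  move=> h w; have E : lift_map i (chart_inv N z) =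
      affine_pt P' A' (unbox (zr (box_left j) / 10) (zr (box_right j) / 10)
        (zr (box_bottom j) / 10) (zr (box_top j) / 10) w).
    by rewrite -(chart_inv_affine w lr' du' hN') /w chartK.
  have [h1 h2] := h j P' A' _ hA' E.
  split; first exact: unbox_inside du' h1.
  by move: h2; case: (sd) => //; [exact: unbox_low lr'|exact: unbox_high lr'].
have left y : `|y| <= 1 -> lands i Left (chart_inv N (-1, y)).
  move=> hy; rewrite inv; have -> : unbox (zr (box_left i) / 10) (zr (box_right i) / 10)
      (zr (box_bottom i) / 10) (zr (box_top i) / 10) (-1, y) =
      (zr (box_left i) / 10, (y * (zr (box_top i) / 10 - zr (box_bottom i) / 10) +
        zr (box_bottom i) / 10 + zr (box_top i) / 10) / 2).
    by congr (_, _); rewrite /=; field.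
  exact: left_lands hA (unbox_range du hy).
have right y : `|y| <= 1 -> lands i Right (chart_inv N (1, y)).
  move=> hy; rewrite inv; have -> : unbox (zr (box_left i) / 10) (zr (box_right i) / 10)
      (zr (box_bottom i) / 10) (zr (box_top i) / 10) (1, y) =
      (zr (box_right i) / 10, (y * (zr (box_top i) / 10 - zr (box_bottom i) / 10) +
        zr (box_bottom i) / 10 + zr (box_top i) / 10) / 2).
    by congr (_, _); rewrite /=; field.
  exact: right_lands hA (unbox_range du hy).
have bottom x : `|x| <= 1 -> lands i Entry (chart_inv N (x, -1)).
  move=> hx; rewrite inv; have -> : unbox (zr (box_left i) / 10) (zr (box_right i) / 10)
      (zr (box_bottom i) / 10) (zr (box_top i) / 10) (x, -1) =
      ((x * (zr (box_right i) / 10 - zr (box_left i) / 10) +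
        zr (box_left i) / 10 + zr (box_right i) / 10) / 2, zr (box_bottom i) / 10).
    by congr (_, _); rewrite /=; field.
  exact: bottom_lands hA (unbox_range lr hx).
have top x : `|x| <= 1 -> lands i Entry (chart_inv N (x, 1)).
  move=> hx; rewrite inv; have -> : unbox (zr (box_left i) / 10) (zr (box_right i) / 10)
      (zr (box_bottom i) / 10) (zr (box_top i) / 10) (x, 1) =
      ((x * (zr (box_right i) / 10 - zr (box_left i) / 10) +
        zr (box_left i) / 10 + zr (box_right i) / 10) / 2, zr (box_top i) / 10).
    by congr (_, _); rewrite /=; field.
  exact: top_lands hA (unbox_range lr hx).
split=> [|y /left/img[]//|y /right/img[]//].
pose phi z := chart N' (lift_map i (chart_inv N z)).
pose psi z := chart N (lift_map_inv i (chart_inv N' z)).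
have comp (f g : R * R -> R * R) : continuous f -> continuous g -> continuous (fun z => f (g z)).
  by move=> cf cg z; apply: (@continuous_comp _ _ _ g f); [exact: cg|exact: cf].
apply: (@boundary_strip _ phi psi).
- apply: (comp _ (fun z => lift_map i (chart_inv N z))); first exact: chart_continuous.
  by apply: comp; [exact: lift_continuous|exact: chart_inv_continuous].
- apply: (comp _ (fun z => lift_map_inv i (chart_inv N' z))); first exact: chart_continuous.
  by apply: comp; [exact: lift_inv_continuous|exact: chart_inv_continuous].
- by move=> z; rewrite /psi /phi chartK liftK chart_invK.
- by move=> z; rewrite /psi /phi chartK lift_invK chart_invK.
- have pm (u : R) : `|u| = 1 -> u = 1 \/ u = -1.
    by move/eqP; rewrite eqr_norml ler01 andbT => /orP[]/eqP; [left|right].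
  move=> [x y] /squareP[/= hx hy] [/pm|/pm] []->.
  + by have [] := img _ _ (right _ hy).
  + by have [] := img _ _ (left _ hy).
  + by have [] := img _ _ (top _ hx).
  + by have [] := img _ _ (bottom _ hx).
Qed.

Lemma coordinate_bound i (a b : R) :
  zr (box_left i) / 10 <= a <= zr (box_right i) / 10 ->
  zr (box_bottom i) / 10 <= b <= zr (box_top i) / 10 ->
  `|a| <= (if i then 10 else 8 / 10) /\ `|b| <= 200.
Proof.
have n100 : zr (-100) = -100 by rewrite !zrE; ring.
have n8 : zr 8 = 8 by rewrite !zrE; ring.
have n8' : zr (-8) = -8 by rewrite !zrE; ring.
have n50 : zr 50 = 50 by rewrite !zrE; ring.
have n750 : zr (-750) = -750 by rewrite !zrE; ring.
have n1800 : zr (-1800) = -1800 by rewrite !zrE; ring.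
have n2000 : zr 2000 = 2000 by rewrite !zrE; ring.
have n800 : zr 800 = 800 by rewrite !zrE; ring.
case: i; rewrite /box_left /box_right /box_bottom /box_top ?n100 ?n8 ?n8' ?n50
    ?n750 ?n1800 ?n2000 ?n800;
  clear n100 n8 n8' n50 n750 n1800 n2000 n800.
  by move=> /andP[h1 h2] /andP[h3 h4]; split; apply/ler_normlP; split; lra.
by move=> /andP[h1 h2] /andP[h3 h4]; split; apply/ler_normlP; split; lra.
Qed.

Lemma entry_bound (u v : R) : `|u - v| <= 2 / 10 ^+ 11 -> 0 <= v <= 8 / 10 -> `|u| <= 1.
Proof. by move=> /ler_normlP[h1 h2] /andP[h3 h4]; apply/ler_normlP; split; lra. Qed.

Lemma entry_diff (u v x y d : R) : `|u - x| <= 2 / 10 ^+ 11 -> `|v + y| <= 2 / 10 ^+ 11 ->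
  `|x - y| <= d -> `|u + v| <= d + 4 / 10 ^+ 11.
Proof.
by move=> /ler_normlP[h1 h2] /ler_normlP[h3 h4] /ler_normlP[h5 h6]; apply/ler_normlP; split; lra.
Qed.

Lemma combine (u v : R) (c : R) : - c <= u <= c -> - c <= v <= c ->
  `|10 ^- 3 * (u + v)| <= 10 ^- 3 * (c + c).
Proof. by move=> /andP[h1 h2] /andP[h3 h4]; apply/ler_normlP; split; lra. Qed.

Lemma split_sum (p a00 a01 a10 a11 a b c c' : R) :
  - c <= (a00 + a10) * a <= c -> - c' <= (a01 + a11) * b <= c' ->
  p - (c + c') / 10 ^+ 3 <= 10 ^- 3 * (a00 * a + a01 * b) + (p + 10 ^- 3 * (a10 * a + a11 * b))
  <= p + (c + c') / 10 ^+ 3.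
Proof. by move=> /andP[h1 h2] /andP[h3 h4]; apply/andP; split; lra. Qed.

Lemma box_matrix_bounds i (mu ka p : R) :
  (if i then [/\ 733 / 1000 <= mu <= 735 / 1000, 678 / 1000 <= ka <= 679 / 1000
    & 1294 / 1000 <= p] else
  [/\ 706 / 1000 <= mu <= 708 / 1000, 706 / 1000 <= ka <= 708 / 1000
    & p <= 1099 / 1000]) ->
  [/\ 0 <= mu <= 8 / 10, 0 <= ka <= 8 / 10 &
    `|mu - ka| <= if i then 6 / 100 else 1 / 100].
Proof.
case: i => -[/andP[k1 k2] /andP[k3 k4] _].
  by split; [apply/andP; split|apply/andP; split|apply/ler_normlP; split]; lra.
by split; [apply/andP; split|apply/andP; split|apply/ler_normlP; split]; lra.
Qed.

Lemma exit_le200 (i : bool) : (if i then 10 else 8 / 10 : R) <= 200.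
Proof. by case: i; lra. Qed.

Lemma half_width : 10 ^- 3 * (1 * 200 + 1 * 200) <= 1 / 2 :> R.
Proof. by lra. Qed.

(** The sum of theta - pi / 2 and phi separates the boxes. Along the long entry side, of direction
    close to (mu, -ka) with mu near ka, it hardly varies, and its values at the two centres are
    about 1.10 and 1.29. *)
Lemma supp_bounds i (N : hset R) P A z :
  approximates (boxes i) P A -> is_box i N P A -> supp N z ->
  `|z.1 - pi / 2| <= 1 / 2 /\
  (if i then 12 / 10 <= z.1 - pi / 2 + z.2 else z.1 - pi / 2 + z.2 <= 115 / 100).
Proof.
move=> [P1 hp [h00 h01] [h10 h11]] [_ -> _] [[a b] [/=]].
rewrite !in_itv /= => ha hb; have {ha hb}[ha hb] := coordinate_bound ha hb.
move=> <-; rewrite /affine_pt /= P1 addrAC subrr add0r.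
have := box_decimals R i; move: h00 h01 h10 h11 hp.
move: (zr (bx_mu _) / _) (zr (bx_ka _) / _) (zr (bx_p _) / _) => mu ka p.
move: (A 0 0) (A 0 1) (A 1 0) (A 1 1) (P.2) => a00 a01 a10 a11 p'.
move=> h00 h01 h10 h11 hp dec.
have [mu1 ka1 d1] := box_matrix_bounds dec.
have b00 := entry_bound h00 mu1; have b01 := entry_bound h01 mu1.
have b10 := entry_bound h10 ka1; have bs2 := entry_diff h01 h11 d1.
have bs : `|a00 + a10| <= 2 by apply: le_trans (ler_normD _ _) (lerD b00 b10).
have a200 : `|a| <= 200 by apply: le_trans ha (exit_le200 i).
split; first exact: le_trans (combine (prod_bound b00 a200) (prod_bound b01 hb)) half_width.
have /andP[e1 e2] := split_sum p' (prod_bound bs ha) (prod_bound bs2 hb).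
case/ler_normlP: hp => p1 p2; move: e1 e2 p1 p2 dec.
move: (_ + (p' + _)) => w; clear.
by case: i => e1 e2 p1 p2 [_ _ p3]; lra.
Qed.
End boxes_in_plane.

(** * The stated intervals and sides in terms of the integer boxes *)

Section hypotheses.
Variable R : realType.
Local Notation zr := (@zr R).

Lemma approximates_box0 (P : R * R) (M : 'M[R]_2) :
  P.1 = pi / 2 /\
    1098956671156713%:R / 10 ^+ 15 <= P.2 <= 1098956671156731%:R / 10 ^+ 15 ->
  7069564693959338%:R / 10 ^+ 16 <= M 0 0 <= 7069564693977127%:R / 10 ^+ 16 ->
  7069564693959345%:R / 10 ^+ 16 <= M 0 1 <= 7069564693977133%:R / 10 ^+ 16 ->
  7072570610281695%:R / 10 ^+ 16 <= M 1 0 <= 7072570610335063%:R / 10 ^+ 16 ->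
  - (7072570610335054%:R / 10 ^+ 16) <= M 1 1 <= - (7072570610281689%:R / 10 ^+ 16) ->
  approximates (boxes false) P M.
Proof.
move=> [P1 hP] h00 h01 h10 h11.
have nmu : zr (bx_mu box0) = 7069564693968235%:R by rewrite !zrE; ring.
have nka : zr (bx_ka box0) = 7072570610308376%:R by rewrite !zrE; ring.
have np : zr (bx_p box0) = 1098956671156722%:R by rewrite !zrE; ring.
split; [exact: P1|rewrite np| |].
    by clear -hP; case/andP: hP => *; apply/ler_normlP; split; lra.
  rewrite nmu; split; first by clear -h00; case/andP: h00 => *; apply/ler_normlP; split; lra.
  by clear -h01; case/andP: h01 => *; apply/ler_normlP; split; lra.
rewrite nka; split; first by clear -h10; case/andP: h10 => *; apply/ler_normlP; split; lra.
by clear -h11; case/andP: h11 => *; apply/ler_normlP; split; lra.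
Qed.

Lemma approximates_box1 (P : R * R) (M : 'M[R]_2) :
  P.1 = pi / 2 /\
    1294511656257196%:R / 10 ^+ 15 <= P.2 <= 1294511656257254%:R / 10 ^+ 15 ->
  7344289378330728%:R / 10 ^+ 16 <= M 0 0 <= 7344289378407212%:R / 10 ^+ 16 ->
  7344289378330732%:R / 10 ^+ 16 <= M 0 1 <= 7344289378407215%:R / 10 ^+ 16 ->
  6786855938153962%:R / 10 ^+ 16 <= M 1 0 <= 6786855938378076%:R / 10 ^+ 16 ->
  - (6786855938378071%:R / 10 ^+ 16) <= M 1 1 <= - (6786855938153957%:R / 10 ^+ 16) ->
  approximates (boxes true) P M.
Proof.
move=> [P1 hP] h00 h01 h10 h11.
have nmu : zr (bx_mu box1) = 7344289378368971%:R by rewrite !zrE; ring.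
have nka : zr (bx_ka box1) = 6786855938266016%:R by rewrite !zrE; ring.
have np : zr (bx_p box1) = 1294511656257225%:R by rewrite !zrE; ring.
split; [exact: P1|rewrite np| |].
    by clear -hP; case/andP: hP => *; apply/ler_normlP; split; lra.
  rewrite nmu; split; first by clear -h00; case/andP: h00 => *; apply/ler_normlP; split; lra.
  by clear -h01; case/andP: h01 => *; apply/ler_normlP; split; lra.
rewrite nka; split; first by clear -h10; case/andP: h10 => *; apply/ler_normlP; split; lra.
by clear -h11; case/andP: h11 => *; apply/ler_normlP; split; lra.
Qed.

Lemma is_box0 (N : hset R) P A :
  is_affine_hset N P A (- (8 / 10)) (8 / 10) (- 180) 80 -> is_box false N P A.
Proof.
rewrite /is_box /box_left /box_right /box_bottom /box_top.
have -> : zr (-8) / 10 = - (8 / 10) by rewrite !zrE; field.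
have -> : zr 8 / 10 = 8 / 10 by rewrite !zrE; field.
have -> : zr (-1800) / 10 = - 180 by rewrite !zrE; field.
by have -> : zr 800 / 10 = 80 by rewrite !zrE; field.
Qed.

Lemma is_box1 (N : hset R) P A :
  is_affine_hset N P A (- 10) 5 (- 75) 200 -> is_box true N P A.
Proof.
rewrite /is_box /box_left /box_right /box_bottom /box_top.
have -> : zr (-100) / 10 = - 10 by rewrite !zrE; field.
have -> : zr 50 / 10 = 5 by rewrite !zrE; field.
have -> : zr (-750) / 10 = - 75 by rewrite !zrE; field.
by have -> : zr 2000 / 10 = 200 by rewrite !zrE; field.
Qed.
End hypotheses.

Theorem theorem5 (R : realType) (P1 P2 : R * R) (M1 M2 : 'M[R]_2)
  (N0 N1 : hset R)
  (hP1 : P1.1 = pi / 2 /\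
    1098956671156713%:R / 10 ^+ 15 <= P1.2 <= 1098956671156731%:R / 10 ^+ 15)
  (hP2 : P2.1 = pi / 2 /\
    1294511656257196%:R / 10 ^+ 15 <= P2.2 <= 1294511656257254%:R / 10 ^+ 15)
  (hM1_00 : 7069564693959338%:R / 10 ^+ 16 <= M1 0 0 <= 7069564693977127%:R / 10 ^+ 16)
  (hM1_01 : 7069564693959345%:R / 10 ^+ 16 <= M1 0 1 <= 7069564693977133%:R / 10 ^+ 16)
  (hM1_10 : 7072570610281695%:R / 10 ^+ 16 <= M1 1 0 <= 7072570610335063%:R / 10 ^+ 16)
  (hM1_11 : - (7072570610335054%:R / 10 ^+ 16) <= M1 1 1 <= - (7072570610281689%:R / 10 ^+ 16))
  (hM2_00 : 7344289378330728%:R / 10 ^+ 16 <= M2 0 0 <= 7344289378407212%:R / 10 ^+ 16)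
  (hM2_01 : 7344289378330732%:R / 10 ^+ 16 <= M2 0 1 <= 7344289378407215%:R / 10 ^+ 16)
  (hM2_10 : 6786855938153962%:R / 10 ^+ 16 <= M2 1 0 <= 6786855938378076%:R / 10 ^+ 16)
  (hM2_11 : - (6786855938378071%:R / 10 ^+ 16) <= M2 1 1 <= - (6786855938153957%:R / 10 ^+ 16))
  (hN0 : is_affine_hset N0 P1 M1 (- (8 / 10)) (8 / 10) (- 180) 80)
  (hN1 : is_affine_hset N1 P2 M2 (- 10) 5 (- 75) 200) :
  let P := poincare (1 / 10 : R) (79 / 100) in
  (cyl_covers P N0 N0 /\ cyl_covers P N0 N1 /\
   cyl_covers P N1 N1 /\ cyl_covers P N1 N0) /\
  symbolic_dynamics P.
Proof.
move=> P.
pose N (i : bool) := if i then N1 else N0.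
pose Q (i : bool) := if i then P2 else P1.
pose M (i : bool) := if i then M2 else M1.
have apx i : approximates (boxes i) (Q i) (M i).
  case: i.
    exact: (approximates_box1 hP2 hM2_00 hM2_01 hM2_10 hM2_11).
  exact: (approximates_box0 hP1 hM1_00 hM1_01 hM1_10 hM1_11).
have box i : is_box i (N i) (Q i) (M i).
  by case: i; [exact: (is_box1 hN1)|exact: (is_box0 hN0)].
clear hP1 hP2 hM1_00 hM1_01 hM1_10 hM1_11 hM2_00 hM2_01 hM2_10 hM2_11 hN0 hN1.
have cross i j : crosses (lift_map i) (N i) (N j).
  exact: (crosses_lift (apx i) (apx j) (box i) (box j)).
have cov i j : cyl_covers P (N i) (N j).
  exists (lift_map i); split; last exact: crosses_covers (@lift_continuous R i) (cross i j).
  by split; [exact: lift_continuous|exact: poincare_lift].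
split.
  by split; [exact: (cov false false)|split; [exact: (cov false true)|split;
    [exact: (cov true true)|exact: (cov true false)]]].
(* As 1/2 <= pi / 4, both boxes lie where [sine_height] is injective. *)
have near i z : supp (N i) z -> `|z.1 - pi / 2| <= pi / 4.
  move=> /(supp_bounds (apx i) (box i))[h _]; apply: (le_trans h).
  by have [h1 h2] := pi_bounds R; lra.
apply: (@symbolic_dynamics_of_crosses R (R * R)%type N (@lift_map R) P (@sine_height R)).
- exact: norm_hausdorff.
- exact: lift_continuous.
- exact: to_cylinder_continuous.
- exact: sine_height_continuous.
- exact: poincare_inj.
- exact: poincare_lift.
- exact: cross.
- move=> i j z w /near hz /near hw; rewrite !sine_heightE => -[s1 s2].
  by rewrite (surjective_pairing z) (surjective_pairing w) s2 (sin_double_inj hz hw s1).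
- move=> z /(supp_bounds (apx false) (box false))[_ h0].
  move=> /(supp_bounds (apx true) (box true))[_]; lra.
Qed.
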